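(* Suppose that model assumptions (i)–(vi) of the context hold, that $\frac1n\hat{\Sigma}\to Q_0$ in probability as $n\to\infty$, where $Q_0$ is a nonrandom positive definite matrix, and that the sequence of local alternative restrictions $R_1BR_2=\theta+\theta_0/\sqrt n$, $n=1,2,\dots$, holds, where $\theta_0$ is fixed with $\|\theta_0\|<\infty$. Then, as $n\to\infty$, $$n^{1/2}\begin{pmatrix} \hat B_1-B\\ \tilde B(\hat\Sigma)-B\end{pmatrix}\xrightarrow{d}\begin{pmatrix}\eta_1\\ \eta^*\end{pmatrix}\sim\mathcal N_{2p\times q}\left(\begin{pmatrix}0\\ \mu(Q_0)\end{pmatrix},\begin{pmatrix}\Sigma_{11}&\Sigma_{12}(Q_0)\\ \Sigma_{21}(Q_0)&\Sigma_{22}(Q_0)\end{pmatrix}\right),$$ where $\mu(Q_0)=-Q_0^{-1}R_1'(R_1Q_0^{-1}R_1')^{-1}\theta_0(R_2'R_2)^{-1}R_2'$, $\Sigma_{11}=A_1\Lambda A_1'$, $\Sigma_{12}(Q_0)=A_1\Lambda A_2(Q_0)'$, $\Sigma_{21}(Q_0)=\Sigma_{12}(Q_0)'$, $\Sigma_{22}(Q_0)=A_2(Q_0)\Lambda A_2(Q_0)'$, with $A_1=(\Sigma K)^{-1}\otimes I_q$ and $$A_2(Q_0)=A_1-\Big(Q_0^{-1}R_1'(R_1Q_0^{-1}R_1')^{-1}R_1(\Sigma K)^{-1}\Big)\otimes\Big(R_2(R_2'R_2)^{-1}R_2'\Big).$$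
   Context: Conventions: $'$ is transpose, $\otimes$ the Kronecker product, $I_m$ the $m$-dimensional identity matrix. A random $a\times b$ matrix $Y$ is $\mathcal N_{a\times b}(\mu,\Omega)$ if the vector obtained by stacking the rows of $Y$ is (possibly degenerate) $ab$-variate normal with mean the vector obtained by stacking the rows of $\mu$ and covariance matrix $\Omega$. Model: $Z=DB+E$, $X=D+\Delta$, $D=M+\Psi$, where $Z,E$ are $n\times q$, $D,X,\Delta,M,\Psi$ are $n\times p$, $B$ is the $p\times q$ matrix of regression coefficients, $M$ is a matrix of fixed components, and $E=(\epsilon_{ij})$ (errors), $\Delta=(\delta_{ij})$ (measurement errors), $\Psi=(\psi_{ij})$ are random; $Z$ and $X$ are observable, $D$ is not. The matrices $R_1$ ($r_1\times p$), $R_2$ ($q\times r_2$), $\theta$ ($r_1\times r_2$) are known, and $\theta_0$ is $r_1\times r_2$. Assumptions: (i) for each $i$, the elements of the vector $[\epsilon_{1i},\epsilon_{2i},\dots,\epsilon_{ni}]$ are independent with mean $0$, variance $\sigma_\epsilon^2$, third moment $\gamma_{1\epsilon}\sigma_\epsilon^3$ and fourth moment $(\gamma_{2\epsilon}+3)\sigma_\epsilon^4$; (ii) the $\delta_{ij}$ are independent and identically distributed with mean $0$, variance $\sigma_\delta^2$, third moment $\gamma_{1\delta}\sigma_\delta^3$ and fourth moment $(\gamma_{2\delta}+3)\sigma_\delta^4$; (iii) the $\psi_{ij}$ are independent and identically distributed with mean $0$, variance $\sigma_\psi^2$, third moment $\gamma_{1\psi}\sigma_\psi^3$ and fourth moment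 $(\gamma_{2\psi}+3)\sigma_\psi^4$; (iv) $\Delta,\Psi,E$ are mutually independent; (v) $M_{(n)}\to\sigma_M$ as $n\to\infty$ with $\sigma_M$ finite, where $M_{(n)}\in\mathbb R^p$ is the $n$-th row of $M$ written as a column vector; (vi) $\operatorname{rank}X=p$, $\operatorname{rank}R_1=r_1$, $\operatorname{rank}R_2=r_2$. Notation: $\Sigma_X=n^{-1}M'M+\sigma_\psi^2I_p+\sigma_\delta^2I_p$, $\Sigma_D=n^{-1}M'M+\sigma_\psi^2I_p$, $K_X=\Sigma_X^{-1}\Sigma_D$, $\Sigma=\sigma_M\sigma_M'+\sigma_\psi^2I_p+\sigma_\delta^2I_p$, $K=\Sigma^{-1}(\Sigma-\sigma_\delta^2I_p)$. Further $\bar K_X=(\Sigma_X-\Sigma_D)\Sigma_X^{-1}$, $H=n^{-1/2}X'X-n^{1/2}\Sigma_X$, $h=n^{-1/2}X'(E-\Delta B)+n^{1/2}\sigma_\delta^2B$, and $\Lambda=\lim_{n\to\infty}\mathrm E[u_nu_n']$ (a $pq\times pq$ matrix, known to exist), where $u_n\in\mathbb R^{pq}$ is obtained by stacking the columns of the $q\times p$ matrix $h'+B'\bar K_XH$. Estimators: the unrestricted estimator is $\hat B_1=K_X^{-1}(X'X)^{-1}X'Z$. For an observable symmetric positive definite $p\times p$ matrix $\hat\Sigma$, the restricted estimator is $$\tilde B(\hat\Sigma)=\hat B_1-\hat\Sigma^{-1}R_1'\big[R_1\hat\Sigma^{-1}R_1'\big]^{-1}(R_1\hat B_1R_2-\t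heta)(R_2'R_2)^{-1}R_2'.$$
   Formalization: Assumption (i) is strengthened to independence of the rows of E (dependence within a row allowed), since independence within columns alone does not give a joint normal limit; B and θ may vary with n, with B bounded; ΣK is assumed invertible. *)

(* Defs.v *)
From HB Require Import structures.
From mathcomp Require Import all_boot all_order all_algebra.
From mathcomp Require Import all_classical all_reals all_analysis.
From mathcomp Require Export mxtens.

Set Implicit Arguments.
Unset Strict Implicit.
Unset Printing Implicit Defensive.

Import Order.TTheory GRing.Theory Num.Theory.
Import numFieldNormedType.Exports.

Local Open Scope classical_set_scope.
Local Open Scope ereal_scope.
Local Open Scope ring_scope.

Section Stacking.
Variable R : Type.

Definition stack_rows a b (A : 'M[R]_(a, b)) : 'cV[R]_(a * b) := (mxvec A)^T.

Definition stack_cols a b (A : 'M[R]_(a, b)) : 'cV[R]_(b * a) :=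
  stack_rows A^T.

End Stacking.

(* [mxvec] and the Kronecker product [*t] index pairs in the same (row-major)
   order. *)
Lemma mxvec_index_tens a b (i : 'I_a) (j : 'I_b) :
  mxvec_index i j = mxtens_index (i, j).
Proof.
have index_pair (s : seq 'I_a) (t : seq 'I_b) : i \in s -> j \in t ->
    index (i, j) [seq (x, y) | x <- s, y <- t]
    = (index i s * size t + index j t)%N.
  move=> + jt; elim: s => //= x s IHs; rewrite in_cons index_cat eq_sym.
  have [->|xNi] /= := eqVneq x i; last first.
    rewrite ifN ?size_map => [/IHs ->|]; first by rewrite mulSn addnA.
    by apply/mapP => -[y _ [ix]]; rewrite ix eqxx in xNi.
  by rewrite mem_map ?jt ?index_map // => y z [].
have enum_prod : enum {: 'I_a * 'I_b} =
    [seq (x, y) | x <- enum 'I_a, y <- enum 'I_b].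
  by rewrite enumT unlock.
apply: val_inj => /=.
rewrite -[LHS](index_uniq (i, j) _ (enum_uniq {: 'I_a * 'I_b})) -?cardE //.
rewrite -enum_val_nth enum_rankK enum_prod index_pair ?mem_enum //.
by rewrite !index_enum_ord size_enum_ord.
Qed.

Lemma stack_rows_mul (R : comPzRingType) a b c d (A : 'M[R]_(c, a))
    (Y : 'M[R]_(a, b)) (C : 'M[R]_(b, d)) :
  stack_rows (A *m Y *m C) = (A *t C^T) *m stack_rows Y.
Proof.
apply/colP => k; case: k / (mxtens_indexP k) => i l.
rewrite !mxE -mxvec_index_tens mxvecE !mxE.
under eq_bigr => y _ do rewrite mxE big_distrl /=.
rewrite exchange_big pair_big /= [RHS](reindex (@mxtens_index a b)) /=; last first.
  by exists (@mxtens_unindex a b) => z _; rewrite (mxtens_indexK, mxtens_unindexK).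
apply: eq_bigr => -[x y] _ /=.
rewrite mxvec_index_tens !mxE !mxtens_indexK /= -mxvec_index_tens mxvecE.
by rewrite -!mulrA [Y x y * _]mulrC.
Qed.

Definition posdefmx (R : realType) p (A : 'M[R]_p) : Prop :=
  A^T = A /\ forall v : 'cV[R]_p, v != 0 -> 0 < (v^T *m A *m v) 0 0.

Section Independence.
Context d (T : measurableType d) (R : realType) (P : probability T R).

Definition sigma_of (I : Type) (Y : I -> T -> R) : set_system T :=
  <<s \bigcup_i preimage_set_system [set: T] (Y i) measurable >>.

Definition mutually_independent (I : choiceType) (F : I -> set_system T) :=
  forall (s : seq I) (A : I -> set T), uniq s ->
    (forall i, i \in s -> F i (A i)) ->
    P (\big[setI/setT]_(i <- s) A i) = (\prod_(i <- s) P (A i))%E.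

Definition iid (I : choiceType) (Y : I -> {RV P >-> R}) : Prop :=
  mutually_independent (fun i => sigma_of (fun _ : unit => Y i)) /\
  forall i i' A, measurable A -> distribution P (Y i) A = distribution P (Y i') A.

Definition has_moments (Y : {RV P >-> R}) (s g1 g2 : R) : Prop :=
  [/\ 'E_P[Y] = 0%E,
      'V_P[Y] = (s ^+ 2)%:E,
      'E_P[fun w => Y w ^+ 3] = (g1 * s ^+ 3)%:E &
      'E_P[fun w => Y w ^+ 4] = ((g2 + 3) * s ^+ 4)%:E].

End Independence.

Section RandomMatrices.
Variable R : realType.

Definition random_mx d (T : measurableType d) a b (Y : T -> 'M[R]_(a, b)) :=
  forall i j, measurable_fun [set: T] (fun w => Y w i j).

Definition expectation_mx d (T : measurableType d) (P : probability T R) a b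
    (Y : T -> 'M[R]_(a, b)) : 'M[R]_(a, b) :=
  \matrix_(i, j) fine 'E_P[fun w => Y w i j].

Definition cvg_in_probability d (T : measurableType d) (P : probability T R)
    a b (Y : nat -> T -> 'M[R]_(a, b)) (C : 'M[R]_(a, b)) : Prop :=
  forall i j (e : R), 0 < e ->
    P [set w | e <= `|Y n w i j - C i j|] @[n --> \oo] --> 0%E.

Definition cvg_in_distribution d (T : measurableType d) (P : probability T R)
    d' (T' : measurableType d') (P' : probability T' R)
    a b (Y : nat -> T -> 'M[R]_(a, b)) (Y' : T' -> 'M[R]_(a, b)) : Prop :=
  [/\ forall n, random_mx (Y n), random_mx Y' &
      forall f : 'M[R]_(a, b) -> R, continuous f ->
        (exists C, forall x, `|f x| <= C) ->
        'E_P[f \o Y n] @[n --> \oo] --> 'E_P'[f \o Y']].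

(* The library's [normal_prob m 0] is not the point mass at m, hence the case
   distinction. *)
Definition normal1 (m v : R) (A : set R) : \bar R :=
  if v == 0 then \d_ m A else normal_prob m (Num.sqrt v) A.

(* Degenerate normal laws are allowed: a random vector is normal when every
   linear combination of its coordinates is. *)
Definition matrix_normal d (T : measurableType d) (P : probability T R)
    a b (Y : T -> 'M[R]_(a, b))
    (mu : 'M[R]_(a, b)) (Omega : 'M[R]_(a * b)) : Prop :=
  [/\ random_mx Y,
      Omega^T = Omega,
      forall c : 'cV[R]_(a * b), 0 <= (c^T *m Omega *m c) 0 0 &
      forall (c : 'cV[R]_(a * b)) (A : set R), measurable A ->
        P [set w | A ((c^T *m stack_rows (Y w)) 0 0)] =
        normal1 ((c^T *m stack_rows mu) 0 0) ((c^T *m Omega *m c) 0 0) A].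

End RandomMatrices.

(* Rows are indexed from 0 and extend to infinity; sample size n uses the rows
   k < n.  Under local alternatives R1 B R2 = theta + theta0 / sqrt n with a
   fixed theta0 <> 0, B and theta cannot both be constant in n, so B (here) and
   theta (in Btilde) are sequences; either may be taken constant. *)
Record ultrastructural d (T : measurableType d) (R : realType)
    (P : probability T R) (p q : nat) := Ultrastructural {
  M_row : nat -> 'rV[R]_p;
  Bcoef : nat -> 'M[R]_(p, q);
  eps : nat -> 'I_q -> {RV P >-> R};
  delta : nat -> 'I_p -> {RV P >-> R};
  psi : nat -> 'I_p -> {RV P >-> R};
  s_eps : R; g1_eps : R; g2_eps : R;
  s_delta : R; g1_delta : R; g2_delta : R;
  s_psi : R; g1_psi : R; g2_psi : R
}.

Section Model.
Context d (T : measurableType d) (R : realType) (P : probability T R).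
Variables (p q : nat) (mo : ultrastructural P p q).
Implicit Types (n : nat) (w : T).

Definition M_mx n : 'M[R]_(n, p) := \matrix_(k < n) M_row mo k.
Definition E_mx n w : 'M[R]_(n, q) := \matrix_(k < n, j < q) eps mo k j w.
Definition Delta_mx n w : 'M[R]_(n, p) := \matrix_(k < n, j < p) delta mo k j w.
Definition Psi_mx n w : 'M[R]_(n, p) := \matrix_(k < n, j < p) psi mo k j w.
Definition D_mx n w := M_mx n + Psi_mx n w.

Definition X n w : 'M[R]_(n, p) := D_mx n w + Delta_mx n w.
Definition Z n w : 'M[R]_(n, q) := D_mx n w *m Bcoef mo n + E_mx n w.

Definition Sigma_D n : 'M[R]_p :=
  n%:R^-1 *: ((M_mx n)^T *m M_mx n) + (s_psi mo ^+ 2)%:M.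
Definition Sigma_X n : 'M[R]_p := Sigma_D n + (s_delta mo ^+ 2)%:M.
Definition K_X n : 'M[R]_p := invmx (Sigma_X n) *m Sigma_D n.
Definition Kbar_X n : 'M[R]_p := (Sigma_X n - Sigma_D n) *m invmx (Sigma_X n).

Definition Sigma (sM : 'cV[R]_p) : 'M[R]_p :=
  sM *m sM^T + (s_psi mo ^+ 2)%:M + (s_delta mo ^+ 2)%:M.
Definition K (sM : 'cV[R]_p) : 'M[R]_p :=
  invmx (Sigma sM) *m (Sigma sM - (s_delta mo ^+ 2)%:M).

Definition H n w : 'M[R]_p :=
  (Num.sqrt n%:R)^-1 *: ((X n w)^T *m X n w) - Num.sqrt n%:R *: Sigma_X n.
Definition h n w : 'M[R]_(p, q) :=
  (Num.sqrt n%:R)^-1 *: ((X n w)^T *m (E_mx n w - Delta_mx n w *m Bcoef mo n))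
  + (Num.sqrt n%:R * s_delta mo ^+ 2) *: Bcoef mo n.
Definition u n w : 'cV[R]_(p * q) :=
  stack_cols ((h n w)^T + (Bcoef mo n)^T *m Kbar_X n *m H n w).

Definition Bhat1 n w : 'M[R]_(p, q) :=
  invmx (K_X n) *m invmx ((X n w)^T *m X n w) *m ((X n w)^T *m Z n w).

Definition Btilde r1 r2 (R1 : 'M[R]_(r1, p)) (R2 : 'M[R]_(q, r2))
    (theta : nat -> 'M[R]_(r1, r2)) (Sh : nat -> T -> 'M[R]_p) n w :=
  let SI := invmx (Sh n w) in
  Bhat1 n w - SI *m R1^T *m invmx (R1 *m SI *m R1^T)
              *m (R1 *m Bhat1 n w *m R2 - theta n)
              *m invmx (R2^T *m R2) *m R2^T.

(* Measurable with respect to the data (X, Z) of the sample of size n. *)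
Definition observable (Sh : nat -> T -> 'M[R]_p) : Prop :=
  forall n i j (A : set R), measurable A ->
    sigma_of (fun x : ('I_n * 'I_p) + ('I_n * 'I_q) => fun w =>
      match x with
      | inl kl => X n w kl.1 kl.2
      | inr kl => Z n w kl.1 kl.2
      end) [set w | A (Sh n w i j)].

(* The rows of E are independent, with arbitrary dependence inside a row.
   Independence within each column alone does not determine the joint law of
   the columns, and no joint normal limit would follow: take the second column
   to be s times the first, with independent symmetric signs throughout. *)
Definition assumption_i : Prop :=
  mutually_independent P (fun k : nat => sigma_of (fun j => eps mo k j)) /\
  forall k j, has_moments (eps mo k j) (s_eps mo) (g1_eps mo) (g2_eps mo).

Definition assumption_ii : Prop :=
  iid (fun kj : nat * 'I_p => delta mo kj.1 kj.2) /\
  forall k j,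
    has_moments (delta mo k j) (s_delta mo) (g1_delta mo) (g2_delta mo).

Definition assumption_iii : Prop :=
  iid (fun kj : nat * 'I_p => psi mo kj.1 kj.2) /\
  forall k j, has_moments (psi mo k j) (s_psi mo) (g1_psi mo) (g2_psi mo).

(* C = setT, etc., give the pairwise product rules. *)
Definition assumption_iv : Prop :=
  forall A1 A2 A3 : set T,
    sigma_of (fun kj : nat * 'I_p => delta mo kj.1 kj.2) A1 ->
    sigma_of (fun kj : nat * 'I_p => psi mo kj.1 kj.2) A2 ->
    sigma_of (fun kj : nat * 'I_q => eps mo kj.1 kj.2) A3 ->
    P (A1 `&` A2 `&` A3) = (P A1 * P A2 * P A3)%E.

Definition assumption_v (sM : 'cV[R]_p) : Prop :=
  (M_row mo n)^T @[n --> \oo] --> sM.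

Definition assumption_vi r1 r2 (R1 : 'M[R]_(r1, p)) (R2 : 'M[R]_(q, r2)) :=
  [/\ \forall n \near \oo, {ae P, forall w, \rank (X n w) = p},
      \rank R1 = r1 & \rank R2 = r2].

Section Limit.
Variables (r1 r2 : nat) (R1 : 'M[R]_(r1, p)) (R2 : 'M[R]_(q, r2)).
Variables (theta0 : 'M[R]_(r1, r2)) (sM : 'cV[R]_p) (Q0 : 'M[R]_p).

Definition mu : 'M[R]_(p, q) :=
  - (invmx Q0 *m R1^T *m invmx (R1 *m invmx Q0 *m R1^T)
     *m theta0 *m invmx (R2^T *m R2) *m R2^T).

Definition A1 : 'M[R]_(p * q) := invmx (Sigma sM *m K sM) *t (1%:M : 'M[R]_q).

Definition A2 : 'M[R]_(p * q) :=
  A1 - (invmx Q0 *m R1^T *m invmx (R1 *m invmx Q0 *m R1^T)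
        *m R1 *m invmx (Sigma sM *m K sM))
       *t (R2 *m invmx (R2^T *m R2) *m R2^T).

Definition limit_cov (Lambda : 'M[R]_(p * q)) : 'M[R]_((p + p) * q) :=
  castmx (esym (mulnDl p p q), esym (mulnDl p p q))
    (block_mx (A1 *m Lambda *m A1^T) (A1 *m Lambda *m A2^T)
              (A1 *m Lambda *m A2^T)^T (A2 *m Lambda *m A2^T)).

End Limit.

End Model.

(* Main.v *)
Require Import Defs.
From HB Require Import structures.
From mathcomp Require Import all_boot all_order all_algebra.
From mathcomp Require Import all_classical all_reals all_analysis.
From mathcomp Require Import measurable_realfun ring lra.

Set Implicit Arguments.
Unset Strict Implicit.
Unset Printing Implicit Defensive.

Import Order.TTheory GRing.Theory Num.Theory.
Import numFieldNormedType.Exports.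

Local Open Scope classical_set_scope.
Local Open Scope ring_scope.

(** On the event that X'X/n and K_X are invertible, sqrt n (Bhat1 - B) equals
    K_X^-1 (X'X/n)^-1 U, where u_n stacks the rows of U, and sqrt n (Btilde - B)
    is an affine function of it whose coefficients converge in probability.  By
    Slutsky's lemma it is enough to show that u_n is asymptotically normal with
    covariance Lambda.  Now u_n is n^(-1/2) times a sum over the rows of the
    sample of linear combinations, with bounded coefficients, of the centred
    products x_i x_j, x_i eps_j and x_i delta_j; distinct rows are independent,
    and Lindeberg's condition follows from the third moments of the products of
    two independent factors and from the identical distribution of the squares.

    The functions (t, c) |-> E cos (<t, Y> + c) replace characteristic
    functions.  They determine convergence in distribution of a tight sequence
    because a bounded continuous function is approximated, uniformly on a box
    and without exceeding its bound, by trigonometric polynomials. *)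

(** * Expectations *)

(** The phase [c] in [cos (<t, Y> + c)] takes the place of complex numbers: shifting it by pi / 2
    gives the sine transform, and a nonzero mean only changes the phase. Normality is defined
    through linear combinations, so transforms of real variables must determine laws; this
    uniqueness is itself drawn from the continuity theorem, applied to a constant sequence.

    Three features of the model shape the limit theorem. [Bcoef mo n] varies with [n], so the rows
    form a triangular array; as its coefficients are bounded, one sequence independent of [n]
    dominates it. Only fourth moments are given, so the squares of [delta] and [psi] are only known
    to have two moments and Lyapunov's condition is out of reach for them. The entries of [eps]
    share moments but not a law; they are multiplied only by factors independent of them, so that
    third moments of the products exist.

    The covariance is never computed: [Lambda] is the limit of the second moments of [u_n], hence
    symmetric and semidefinite, and it is the variance that the limit theorem asks for. It may be
    singular, so the limit is built as an affine image of independent standard normals. *)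

Notation L1 P Y := (integrable P [set: _] (fun w => (Y w)%:E)).

Section Expectation.
Context d (T : measurableType d) (R : realType) (P : probability T R).
Implicit Types (Y Z : T -> R) (c e : R).

Lemma L1_measurable Y : L1 P Y -> measurable_fun [set: T] Y.
Proof. by move=> /integrableP[/measurable_EFinP]. Qed.

Lemma L1_bounded Y c : measurable_fun [set: T] Y -> (forall w, `|Y w| <= c) ->
  L1 P Y.
Proof.
move=> mY Yc; apply: measurable_bounded_integrable => //.
  by rewrite (le_lt_trans (probability_le1 P _)) ?ltry.
exists c; split; first exact: num_real.
by move=> x cx w _; exact: le_trans (Yc w) (ltW cx).
Qed.

Lemma L1_le Y Z : measurable_fun [set: T] Y -> L1 P Z ->
  (forall w, `|Y w| <= Z w) -> L1 P Y.
Proof.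
move=> mY iZ YZ; apply: le_integrable iZ => //; first exact/measurable_EFinP.
by move=> w _; rewrite /= lee_fin (le_trans (YZ w)) // ler_norm.
Qed.

Lemma L1_cst c : L1 P (fun=> c).
Proof. exact: (@L1_bounded _ `|c|). Qed.

Lemma L1D Y Z : L1 P Y -> L1 P Z -> L1 P (fun w => Y w + Z w).
Proof. by move=> iY iZ; under eq_fun do rewrite EFinD; exact: integrableD. Qed.

Lemma L1B Y Z : L1 P Y -> L1 P Z -> L1 P (fun w => Y w - Z w).
Proof. by move=> iY iZ; under eq_fun do rewrite EFinB; exact: integrableB. Qed.

Lemma L1Z c Y : L1 P Y -> L1 P (fun w => c * Y w).
Proof. by move=> iY; under eq_fun do rewrite EFinM; exact: integrableZl. Qed.

Lemma L1_norm Y : L1 P Y -> L1 P (fun w => `|Y w|).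
Proof. exact: integrable_abse. Qed.

Lemma L1_sum (I : Type) (r : seq I) (Q : pred I) (Y : I -> T -> R) :
  (forall i, L1 P (Y i)) -> L1 P (fun w => \sum_(i <- r | Q i) Y i w).
Proof.
by move=> iY; under eq_fun do rewrite -sumEFin; exact: integrable_sum.
Qed.

Lemma Ecst c : \int[P]_w c = c.
Proof. by rewrite Rintegral_cst // [X in fine X]probability_setT mulr1. Qed.

Lemma ED Y Z : L1 P Y -> L1 P Z ->
  \int[P]_w (Y w + Z w) = \int[P]_w Y w + \int[P]_w Z w.
Proof. by move=> iY iZ; rewrite RintegralD. Qed.

Lemma EB Y Z : L1 P Y -> L1 P Z ->
  \int[P]_w (Y w - Z w) = \int[P]_w Y w - \int[P]_w Z w.
Proof. by move=> iY iZ; rewrite RintegralB. Qed.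

Lemma EZ c Y : L1 P Y -> \int[P]_w (c * Y w) = c * \int[P]_w Y w.
Proof. by move=> iY; rewrite RintegralZl. Qed.

Lemma E_ge0 Y : (forall w, 0 <= Y w) -> 0 <= \int[P]_w Y w.
Proof. by move=> Y0; apply: Rintegral_ge0. Qed.

Lemma E_le Y Z : L1 P Y -> L1 P Z -> (forall w, Y w <= Z w) ->
  \int[P]_w Y w <= \int[P]_w Z w.
Proof. by move=> iY iZ YZ; apply: le_Rintegral. Qed.

Lemma E_norm Y : L1 P Y -> `|\int[P]_w Y w| <= \int[P]_w `|Y w|.
Proof. by move=> iY; apply: le_normr_Rintegral. Qed.

Lemma E_norm_le Y Z : measurable_fun [set: T] Y -> L1 P Z ->
  (forall w, `|Y w| <= Z w) -> `|\int[P]_w Y w| <= \int[P]_w Z w.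
Proof.
move=> mY iZ YZ; have iY := L1_le mY iZ YZ.
by rewrite (le_trans (E_norm iY)) // E_le //; exact: L1_norm.
Qed.

Lemma EFin_E Y : L1 P Y -> (\int[P]_w (Y w)%:E)%E = (\int[P]_w Y w)%:E.
Proof. by move=> iY; rewrite fineK //; exact: integrable_fin_num. Qed.

Lemma Esum (I : Type) (r : seq I) (Q : pred I) (Y : I -> T -> R) :
  (forall i, L1 P (Y i)) ->
  \int[P]_w (\sum_(i <- r | Q i) Y i w) =
  \sum_(i <- r | Q i) \int[P]_w Y i w.
Proof.
move=> iY; rewrite /Rintegral; under eq_integral do rewrite -sumEFin.
rewrite integral_sum //.
by under eq_bigr do rewrite EFin_E //; rewrite sumEFin.
Qed.

Lemma E_indic (A : set T) : measurable A -> \int[P]_w \1_A w = fine (P A).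
Proof. by move=> mA; rewrite /Rintegral integral_indic // setIT. Qed.

Lemma L1_indic (A : set T) : measurable A -> L1 P (\1_A : T -> R).
Proof.
by move=> mA; apply: (@L1_bounded _ 1) => // w; rewrite indicE; case: (_ \in _);
  rewrite ?normr1 ?normr0.
Qed.

Lemma L1_of_ge0 Y : measurable_fun [set: T] Y -> (forall w, 0 <= Y w) ->
  (\int[P]_w (Y w)%:E < +oo)%E -> L1 P Y.
Proof.
move=> mY Y0 Yoo; apply/integrableP; split; first exact/measurable_EFinP.
by under eq_integral do rewrite /= ger0_norm //.
Qed.

Lemma measurable_ge Y e : measurable_fun [set: T] Y ->
  measurable [set w | e <= Y w].
Proof.
move=> mY; rewrite (_ : mkset _ = [set: T] `&` Y @^-1` `[e, +oo[); first exact: mY.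
by apply/seteqP; split => w /=; rewrite in_itv /= andbT // => -[].
Qed.

Lemma E_markov Y e : L1 P Y -> (forall w, 0 <= Y w) -> 0 < e ->
  (P [set w | (e <= Y w)%R] <= (e^-1 * \int[P]_w Y w)%:E)%E.
Proof.
move=> iY Y0 e0; have mY := L1_measurable iY.
have mA := measurable_ge e mY.
have fP : P [set w | e <= Y w] \is a fin_num by exact: fin_num_measure.
rewrite -(fineK fP) lee_fin -(E_indic mA).
rewrite -EZ //; apply: E_le; [exact: L1_indic|exact: L1Z|].
move=> w; rewrite indicE; case: (boolP (_ \in _)) => [|_] /=.
  by rewrite inE /= ler_pdivlMl // mulr1.
by rewrite mulr_ge0 // invr_ge0 ltW.
Qed.

End Expectation.

(** * Levy's continuity theorem *)

Section Bernstein.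
Context {R : comPzRingType}.
Implicit Types (p c : R) (phi : nat -> R).

(** The binomial weight C(m, j) p^j (1 - p)^(m - j), defined by conditioning on one trial, so that
    sums over [j] are computed by induction on [m] without binomial coefficients. *)
Fixpoint bern (m j : nat) p : R :=
  match m, j with
  | 0, 0 => 1
  | 0, _.+1 => 0
  | m.+1, 0 => (1 - p) * bern m 0 p
  | m.+1, j.+1 => p * bern m j p + (1 - p) * bern m j.+1 p
  end.

Lemma bern_out m p : bern m m.+1 p = 0.
Proof.
suff H j : bern m (m.+1 + j) p = 0 by rewrite -[m.+1]addn0.
by elim: m j => //= m IHm j; rewrite !IHm -addnS IHm !mulr0 addr0.
Qed.

(** Conditioning on one trial: a success shifts the argument of [phi] by one. The total mass and the
    variance both follow from this recursion. *)
Lemma bern_sumS m p phi :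
  \sum_(j < m.+2) bern m.+1 j p * phi j =
  p * (\sum_(j < m.+1) bern m j p * phi j.+1) +
  (1 - p) * (\sum_(j < m.+1) bern m j p * phi j).
Proof.
rewrite big_ord_recl /= [in X in _ = _ + (1 - p) * X]big_ord_recl /=.
have -> : \sum_(i < m.+1) (p * bern m i p + (1 - p) * bern m i.+1 p) * phi i.+1
   = p * (\sum_(j < m.+1) bern m j p * phi j.+1) +
     (1 - p) * (\sum_(j < m) bern m j.+1 p * phi j.+1).
  transitivity (\sum_(i < m.+1) (p * (bern m i p * phi i.+1)
     + (1 - p) * (bern m i.+1 p * phi i.+1))).
    by apply: eq_bigr => i _; rewrite mulrDl !mulrA.
  rewrite big_split /= -!mulr_sumr; congr (_ + _ * _).
  by rewrite big_ord_recr /= bern_out mul0r addr0.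
by rewrite mulrDr !mulrA addrCA.
Qed.

Lemma bern_sum1 m p : \sum_(j < m.+1) bern m j p = 1.
Proof.
have E k : \sum_(j < k.+1) bern k j p = \sum_(j < k.+1) bern k j p * 1.
  by apply: eq_bigr => j _; rewrite mulr1.
elim: m => [|m IHm]; first by rewrite big_ord1.
rewrite E (bern_sumS m p (fun=> 1)) -!E IHm; ring.
Qed.

(** The free centre [c] carries the induction, because a success turns [c] into [c - 1]. At
    [c = m%:R * p] the first term vanishes and the variance remains. *)
Lemma bern_variance m p c :
  \sum_(j < m.+1) bern m j p * (j%:R - c) ^+ 2 =
  (m%:R * p - c) ^+ 2 + m%:R * p * (1 - p).
Proof.
elim: m c => [|m IHm] c; first by rewrite big_ord1 /=; ring.
rewrite (bern_sumS m p (fun j => (j%:R - c) ^+ 2)) IHm.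
under eq_bigr do rewrite -natr1 -addrA -(opprB c 1).
rewrite IHm -natr1; ring.
Qed.

End Bernstein.

Section BernsteinReal.
Context {R : realType}.
Implicit Types p : R.

Lemma bern_ge0 m j p : 0 <= p <= 1 -> 0 <= bern m j p.
Proof.
move=> /andP[p0 p1]; elim: m j => [|m IHm] [|j] //=.
  by rewrite mulr_ge0 // subr_ge0.
by rewrite addr_ge0 // mulr_ge0 // subr_ge0.
Qed.

Lemma bern_deviation m p : 0 <= p <= 1 ->
  \sum_(j < m.+2) bern m.+1 j p * (j%:R / m.+1%:R - p) ^+ 2 <= m.+1%:R^-1.
Proof.
move=> /andP[p0 p1]; set M := m.+1%:R : R.
have M0 : 0 < M by rewrite ltr0n.
have E (j : nat) : (j%:R / M - p) ^+ 2 = M ^- 2 * (j%:R - M * p) ^+ 2.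
  by field; rewrite gt_eqF.
under eq_bigr do rewrite E mulrCA.
rewrite -mulr_sumr bern_variance subrr expr0n add0r.
have -> : M ^- 2 * (M * p * (1 - p)) = M^-1 * (p * (1 - p)).
  by field; rewrite gt_eqF.
rewrite ler_piMr ?invr_ge0 ?ltW //; nra.
Qed.

(** The sine separates points uniformly although its derivative vanishes at pi / 2: in sin a - sin b
    = 2 cos ((a + b) / 2) sin ((a - b) / 2) the half-sum is at most [c0] < pi / 2 in absolute value.
    The two ranges differ because [a] will come from a point of the box and [b] from an arcsine. *)
Lemma sin_separated (e : R) : 0 < e ->
  exists2 k : R, 0 < k & forall a b : R, `|a| <= 1 / 2 -> `|b| <= pi / 2 ->
    `|sin a - sin b| < k -> `|a - b| < e.
Proof.
move=> e0; pose e' := Num.min e 1; pose c0 : R := (1 / 2 + pi / 2) / 2.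
have pi1 := @pihalf_ge1 R; have pi2 := @pihalf_lt2 R.
have e'0 : 0 < e' by rewrite lt_min e0 ltr01.
have e'1 : e' <= 1 by rewrite ge_min lexx orbT.
have cc0 : 0 < cos c0 by apply: cos_gt0_pihalf; rewrite /c0; lra.
have se0 : 0 < sin (e' / 2) by apply: sin_gt0_pihalf; lra.
exists (2 * cos c0 * sin (e' / 2)); first by rewrite !mulr_gt0.
move=> a b ha hb; apply: contraTT; rewrite -!leNgt => hab.
have e'ab : e' <= `|a - b| by rewrite ge_min hab.
pose u := (a + b) / 2; pose v := (a - b) / 2.
have [-> ->] : a = u + v /\ b = u - v by rewrite /u /v; split; field.
have -> : sin (u + v) - sin (u - v) = 2 * cos u * sin v.
  by rewrite sinD sinB; ring.
have hu : `|u| <= c0.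
  rewrite /u /c0 normrM [ `|2^-1|]ger0_norm ?invr_ge0 // ler_pM2r ?invr_gt0 //.
  exact: le_trans (ler_normD _ _) (lerD _ _).
have hv1 : `|v| <= c0.
  rewrite /v /c0 normrM [ `|2^-1|]ger0_norm ?invr_ge0 // ler_pM2r ?invr_gt0 //.
  exact: le_trans (ler_normB _ _) (lerD _ _).
have hv2 : e' / 2 <= `|v|.
  by rewrite /v normrM [ `|2^-1|]ger0_norm ?invr_ge0 // ler_pM2r ?invr_gt0.
have u0 := normr_ge0 u; have v0 := normr_ge0 v.
have hcos : cos c0 <= cos u.
  rewrite -[cos u]cos_norm leNgt ltr_cos ?in_itv /= -?leNgt //.
    rewrite /c0; lra.
  by rewrite u0 /= (le_trans hu) // /c0; lra.
have hsin : sin (e' / 2) <= `|sin v|.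
  have -> : `|sin v| = sin `|v|.
    have sv0 : 0 <= sin `|v|.
      by apply: sin_ge0_pi; rewrite v0 /= (le_trans hv1) // /c0; lra.
    have [vp|vn] := leP 0 v; first by rewrite [ `|v| ]ger0_norm // in sv0 *; rewrite ger0_norm.
    by rewrite [ `|v| ]ltr0_norm // in sv0 *; rewrite -normrN -sinN ger0_norm.
  rewrite leNgt ltr_sin ?in_itv /= -?leNgt //.
    by apply/andP; split; [lra|rewrite (le_trans hv1) // /c0; lra].
  by apply/andP; split; lra.
have cu0 : 0 <= cos u by rewrite (le_trans _ hcos) // ltW.
rewrite !normrM [ `|2|]ger0_norm // [ `|cos u|]ger0_norm //.
apply: ler_pM => //; [by rewrite mulr_ge0 // ltW|exact: ltW|].
by rewrite ler_pM2l.
Qed.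

End BernsteinReal.

(** * Uniform approximation by trigonometric polynomials *)

Section TrigPoly.
Context {R : realType}.
Variable N : nat.
Implicit Types (f g : 'rV[R]_N -> R) (t : 'I_N -> R).

Definition pairing t (x : 'rV[R]_N) : R := \sum_k t k * x 0 k.

(* Trigonometric polynomials; closure under products is [trig_mul]. *)
Inductive trig : ('rV[R]_N -> R) -> Prop :=
| trig_cos t c : trig (fun x => cos (pairing t x + c))
| trig_add f g : trig f -> trig g -> trig (fun x => f x + g x)
| trig_scale a f : trig f -> trig (fun x => a * f x).

Lemma trig_cst a : trig (fun=> a).
Proof.
suff -> : (fun=> a) = (fun x => a * cos (pairing (fun=> 0) x + 0)).
  exact/trig_scale/trig_cos.
apply/funext => x; rewrite /pairing big1 ?addr0 ?cos0 ?mulr1 // => k _.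
by rewrite mul0r.
Qed.

Lemma trig_sum (I : Type) (r : seq I) (F : I -> 'rV[R]_N -> R) :
  (forall i, trig (F i)) -> trig (fun x => \sum_(i <- r) F i x).
Proof.
move=> tF; elim: r => [|i r IHr].
  by under eq_fun do rewrite big_nil; exact: trig_cst.
by under eq_fun do rewrite big_cons; exact: trig_add.
Qed.

Lemma trig_mul f g : trig f -> trig g -> trig (fun x => f x * g x).
Proof.
elim=> [t c|f1 f2 _ IH1 _ IH2 tg|a f1 _ IH1 tg]; last first.
- by under eq_fun do rewrite -mulrA; exact/trig_scale/IH1.
- by under eq_fun do rewrite mulrDl; apply: trig_add; [exact: IH1|exact: IH2].
elim=> [t' c'|g1 g2 _ IH1 _ IH2|a g1 _ IH1]; last first.
- by under eq_fun do rewrite mulrCA; exact/trig_scale/IH1.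
- by under eq_fun do rewrite mulrDr; exact: trig_add.
suff -> : (fun x => cos (pairing t x + c) * cos (pairing t' x + c')) =
   (fun x => 2^-1 * (cos (pairing (fun k => t k + t' k) x + (c + c'))
      + cos (pairing (fun k => t k - t' k) x + (c - c')))).
  by apply/trig_scale/trig_add; exact: trig_cos.
apply/funext => x.
have -> : pairing (fun k => t k + t' k) x + (c + c') =
    (pairing t x + c) + (pairing t' x + c').
  by rewrite /pairing addrACA -big_split; congr (_ + _); apply: eq_bigr => k _; rewrite mulrDl.
have -> : pairing (fun k => t k - t' k) x + (c - c') =
    (pairing t x + c) - (pairing t' x + c').
  rewrite /pairing opprD addrACA -sumrB; congr (_ + _).
  by apply: eq_bigr => k _; rewrite mulrBl.
move: (pairing t x + c) (pairing t' x + c') => A B.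
by rewrite cosD cosB; field.
Qed.

Lemma trig_prod (I : Type) (r : seq I) (F : I -> 'rV[R]_N -> R) :
  (forall i, trig (F i)) -> trig (fun x => \prod_(i <- r) F i x).
Proof.
move=> tF; elim: r => [|i r IHr].
  by under eq_fun do rewrite big_nil; exact: trig_cst.
by under eq_fun do rewrite big_cons; exact: trig_mul.
Qed.

Lemma trig_bern m j f : trig f -> trig (fun x => bern m j (f x)).
Proof.
move=> tf; have t1f : trig (fun x => 1 - f x).
  under eq_fun do rewrite -mulN1r.
  by apply: trig_add; [exact: trig_cst|exact: trig_scale].
elim: m j => [|m IHm] [|j] /=; [exact: trig_cst..|exact: trig_mul|].
by apply: trig_add; exact: trig_mul.
Qed.

Lemma trig_sin_coord k a : trig (fun x => sin (a * x 0 k)).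
Proof.
suff -> : (fun x : 'rV[R]_N => sin (a * x 0 k)) =
    (fun x => cos (pairing (fun l => if l == k then a else 0) x + - (pi / 2))).
  exact: trig_cos.
apply/funext => x; rewrite cosBpihalf; congr sin; rewrite /pairing.
rewrite (bigD1 k) //= eqxx big1 ?addr0 // => l lk.
by rewrite (negbTE lk) mul0r.
Qed.

(** Only [x] is confined to the box. The interpolation nodes of [trig_approx] have coordinates up to
    pi L and may lie outside. *)
Lemma unif_continuous_box f (L e : R) : continuous f -> 0 < e ->
  exists2 dl : R, 0 < dl & forall x y : 'rV[R]_N, (forall k, `|x 0 k| <= L) ->
    (forall k, `|x 0 k - y 0 k| < dl) -> `|f x - f y| < e.
Proof.
move=> cf e0; pose K := [set x : 'rV[R]_N | forall k, `[- L, L]%classic (x 0 k)].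
have /compact_near_coveringP : compact K.
  by apply: (@rV_compact R N (fun=> `[- L, L]%classic)) => k; exact: segment_compact.
move=> /(_ _ (0^'+) (fun dl x => forall y : 'rV[R]_N,
   (forall k, `|x 0 k - y 0 k| < dl) -> `|f x - f y| < e) _).
case.
  have e2 : 0 < e / 2 by rewrite divr_gt0.
  move=> x Kx; have /cvgrPdist_lt/(_ _ e2) := cf x.
  move=> /nbhs_ballP[r /= r0 fr].
  have r2 : 0 < r / 2 by rewrite divr_gt0.
  exists (ball x (r / 2), [set dl | dl < r / 2]) => /=.
    split; first exact: nbhsx_ballx.
    exact: nbhs_right_lt.
  move=> [x' dl] /= [bx' dlr] y xy.
  have fx' : `|f x - f x'| < e / 2.
    apply: fr; apply: le_ball bx'; lra.
  have fy : `|f x - f y| < e / 2.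
    apply: fr; case: bx' => _ bx'; split => // i j; rewrite ord1.
    have := bx' 0 j; rewrite /ball /= => bj.
    rewrite -(subrK (x' 0 j) (x 0 j)) -addrA.
    by rewrite (le_lt_trans (ler_normD _ _)) // [ltRHS](splitr r) ltrD // (lt_trans (xy j)).
  rewrite -(subrK (f x) (f x')) -addrA (le_lt_trans (ler_normD _ _)) //.
  by rewrite [ltRHS]splitr ltrD // distrC.
move=> dl /= dl0 H; exists (dl / 2); first by rewrite divr_gt0.
move=> x y Kx xy; apply: (H (dl / 2)) => //=.
- by rewrite sub0r normrN gtr0_norm ?divr_gt0 // ltr_pdivrMr // ltr_pMr // ltr1n.
- by rewrite divr_gt0.
- by move=> k /=; rewrite in_itv /= -ler_norml.
Qed.

Lemma bern_prod_sum1 m (p : 'I_N -> R) :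
  \sum_(J : {ffun 'I_N -> 'I_m.+1}) \prod_k bern m (J k) (p k) = 1.
Proof.
rewrite -(bigA_distr_bigA (fun k (j : 'I_m.+1) => bern m j (p k))).
by rewrite big1 // => k _; exact: bern_sum1.
Qed.

(** Marginalization: under the product weights a function of coordinate [i] alone is averaged by the
    weights of that coordinate. *)
Lemma bern_prod_sum m (p : 'I_N -> R) (i : 'I_N) (phi : nat -> R) :
  \sum_(J : {ffun 'I_N -> 'I_m.+1}) (\prod_k bern m (J k) (p k)) * phi (J i) =
  \sum_(j < m.+1) bern m j (p i) * phi j.
Proof.
pose F k (j : 'I_m.+1) := bern m j (p k) * (if k == i then phi j else 1).
transitivity (\sum_(J : {ffun 'I_N -> 'I_m.+1}) \prod_k F k (J k)).
  apply: eq_bigr => J _; rewrite /F big_split /=; congr (_ * _).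
  by rewrite (bigD1 i) //= eqxx big1 ?mulr1 // => k /negbTE->.
rewrite -(bigA_distr_bigA F) (bigD1 i) //= [X in _ * X]big1 ?mulr1.
  by rewrite /F eqxx.
move=> k /negbTE ki; rewrite /F ki -[RHS](bern_sum1 m (p k)).
by apply: eq_bigr => j _; rewrite mulr1.
Qed.

(* Bernstein polynomials in the variables (1 + sin (x_k / 2L)) / 2, which range
   over [0, 1] for all x and separate the points of the box. *)
Lemma trig_approx f (M L e : R) : continuous f -> (forall x, `|f x| <= M) ->
  0 < L -> 0 < e ->
  exists g, [/\ trig g, forall x, `|g x| <= M &
    forall x : 'rV[R]_N, (forall k, `|x 0 k| <= L) -> `|f x - g x| <= e].
Proof.
move=> cf fM L0 e0.
have M0 : 0 <= M by apply: le_trans (fM 0).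
have [dl dl0 fdl] := unif_continuous_box L cf (divr_gt0 e0 (ltr0Sn R 1)).
have [ka ka0 sinka] := @sin_separated R (dl / (2 * L)) (divr_gt0 dl0 (mulr_gt0 (ltr0Sn R 1) L0)).
pose C := 2 * M * (4 / ka ^+ 2) * N%:R.
have C0 : 0 <= C by rewrite /C !mulr_ge0 ?ler0n ?invr_ge0 ?sqr_ge0.
(* Makes the deviation term [C / m.+1%:R] at most [e / 2]. *)
pose m := Num.truncn (C * (2 / e)).
pose pp (x : 'rV[R]_N) k := (1 + sin ((2 * L)^-1 * x 0 k)) / 2.
have pp01 x k : 0 <= pp x k <= 1.
  have := sin_geN1 ((2 * L)^-1 * x 0 k); have := sin_le1 ((2 * L)^-1 * x 0 k).
  by rewrite /pp; lra.
(* The node whose image under the change of variables is the grid point [(J k)%:R / m.+1%:R] in each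
   coordinate: it inverts q = (1 + sin (y / 2L)) / 2. *)
pose y (J : {ffun 'I_N -> 'I_m.+2}) : 'rV[R]_N :=
  \row_k (2 * L * asin (2 * ((J k)%:R / m.+1%:R) - 1)).
pose wt (J : {ffun 'I_N -> 'I_m.+2}) (x : 'rV[R]_N) := \prod_k bern m.+1 (J k) (pp x k).
have wt0 J x : 0 <= wt J x.
  by apply: prodr_ge0 => k _; exact: bern_ge0.
have wt1 x : \sum_J wt J x = 1 by exact: bern_prod_sum1.
exists (fun x => \sum_(J : {ffun 'I_N -> 'I_m.+2}) wt J x * f (y J)); split.
- apply: trig_sum => J; under eq_fun do rewrite mulrC; apply: trig_scale.
  apply: trig_prod => k; apply: trig_bern; rewrite /pp.
  under eq_fun do rewrite mulrC; apply/trig_scale/trig_add; first exact: trig_cst.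
  exact: trig_sin_coord.
- move=> x; rewrite (le_trans (ler_norm_sum _ _ _)) //.
  rewrite -[leRHS]mul1r -(wt1 x) mulr_suml; apply: ler_sum => J _.
  by rewrite normrM ger0_norm // ler_wpM2l.
move=> x xL.
(* As in Chebyshev's inequality. If every coordinate of the grid point is within [ka / 2], the node
   is within [dl] of [x]. Otherwise one squared deviation is at least (ka / 2)^2, and the second
   term already exceeds the trivial bound [2 * M]. *)
have key J : `|f x - f (y J)| <=
    e / 2 + 2 * M * (4 / ka ^+ 2) * \sum_k ((J k)%:R / m.+1%:R - pp x k) ^+ 2.
  have S0 : 0 <= \sum_k ((J k)%:R / m.+1%:R - pp x k) ^+ 2.
    by apply: sumr_ge0 => k _; exact: sqr_ge0.
  have [/forallP near|] := boolP [forall k, `|(J k)%:R / m.+1%:R - pp x k| < ka / 2].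
    apply: ler_wpDr; first by rewrite !mulr_ge0 ?invr_ge0 ?sqr_ge0.
    apply/ltW/fdl => // k.
    set q := (J k)%:R / m.+1%:R : R.
    have q01 : 0 <= q <= 1.
      by rewrite /q divr_ge0 //= ler_pdivrMr ?ltr0n // mul1r ler_nat -ltnS.
    have hq : -1 <= 2 * q - 1 <= 1 by lra.
    have sa : sin (asin (2 * q - 1)) = 2 * q - 1 by rewrite asinK // in_itv.
    rewrite mxE -/q.
    have -> : x 0 k - 2 * L * asin (2 * q - 1) =
       2 * L * ((2 * L)^-1 * x 0 k - asin (2 * q - 1)).
      by field; rewrite gt_eqF.
    rewrite normrM gtr0_norm ?mulr_gt0 // -ltr_pdivlMl ?mulr_gt0 //.
    rewrite [_ * dl]mulrC.
    apply: sinka.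
    + rewrite normrM gtr0_norm ?invr_gt0 ?mulr_gt0 // ler_pdivrMl ?mulr_gt0 //.
      by rewrite (le_trans (xL k)) //; lra.
    + by rewrite ler_norml asin_geNpi2 ?asin_lepi2.
    + rewrite sa; have := near k; rewrite -/q /pp distrC.
      rewrite (_ : (1 + _) / 2 - q = (sin ((2 * L)^-1 * x 0 k) - (2 * q - 1)) / 2); last by field.
      by rewrite normrM [ `|2^-1|]ger0_norm // ltr_pM2r.
  rewrite negb_forall => /existsP[k]; rewrite -leNgt => far.
  have : `|f x - f (y J)| <= 2 * M.
    by rewrite (le_trans (ler_normB _ _)) // mulr_natl mulr2n lerD.
  move=> /le_trans; apply; rewrite ler_wpDl ?divr_ge0 ?(ltW e0) //.
  rewrite -mulrA ler_peMr ?mulr_ge0 //.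
  rewrite (bigD1 k) //= mulrDr ler_wpDr //.
    by rewrite mulr_ge0 ?divr_ge0 ?sqr_ge0 // sumr_ge0 // => l _; exact: sqr_ge0.
  rewrite mulrAC ler_pdivlMr ?exprn_gt0 // mul1r -[X in _ <= 4 * X]real_normK ?num_real //.
  have : (ka / 2) ^+ 2 <= `|(J k)%:R / m.+1%:R - pp x k| ^+ 2.
    by rewrite lerXn2r ?nnegrE ?divr_ge0 ?(ltW ka0).
  by rewrite expr_div_n; lra.
have -> : f x - \sum_J wt J x * f (y J) = \sum_J wt J x * (f x - f (y J)).
  rewrite -[in LHS](mul1r (f x)) -(wt1 x) mulr_suml -sumrB.
  by apply: eq_bigr => J _; rewrite mulrBr.
rewrite (le_trans (ler_norm_sum _ _ _)) //.
apply: (@le_trans _ _ (\sum_J wt J x * (e / 2 + 2 * M * (4 / ka ^+ 2) *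
   \sum_k ((J k)%:R / m.+1%:R - pp x k) ^+ 2))).
  by apply: ler_sum => J _; rewrite normrM ger0_norm // ler_wpM2l.
under eq_bigr do rewrite mulrDr.
rewrite big_split /= -mulr_suml wt1 mul1r [leRHS](splitr e) lerD2l.
under eq_bigr do rewrite mulrCA.
rewrite -mulr_sumr.
have : \sum_J wt J x * (\sum_k ((J k)%:R / m.+1%:R - pp x k) ^+ 2) <=
   N%:R * m.+1%:R^-1.
  under eq_bigr do rewrite mulr_sumr.
  rewrite exchange_big /= -[X in X%:R * _]card_ord -sum1_card natr_sum mulr_suml.
  apply: ler_sum => k _; rewrite mul1r.
  rewrite (bern_prod_sum m.+1 (pp x) k (fun j => (j%:R / m.+1%:R - pp x k) ^+ 2)).
  exact: bern_deviation.
move=> /(ler_wpM2l _) => /(_ (2 * M * (4 / ka ^+ 2))) H.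
apply: le_trans (H _) _; first by rewrite !mulr_ge0 ?invr_ge0 ?sqr_ge0.
rewrite mulrA -/C ler_pdivrMr ?ltr0n //.
have : C * (2 / e) <= m.+1%:R by apply/ltW/truncnS_gt.
by rewrite mulrA ler_pdivrMr // => H'; lra.
Qed.

End TrigPoly.

Definition rv_of d (T : measurableType d) (R : realType) (P : probability T R)
  (Y : T -> R) (mY : measurable_fun [set: T] Y) : {RV P >-> R} :=
  HB.pack Y (isMeasurableFun.Build _ _ _ _ Y mY).

Lemma pairing_stack (R : realType) a b (c : 'cV[R]_(a * b)) (Y : 'M[R]_(a, b)) :
  (c^T *m stack_rows Y) 0 0 = pairing (fun k => c k 0) (mxvec Y).
Proof. by rewrite mxE; apply: eq_bigr => k _; rewrite !mxE. Qed.

Lemma vec_mx_continuous (R : realType) a b :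
  continuous (@vec_mx R a b).
Proof.
move=> x A /nbhs_ballP[e /= e0 eA]; apply/nbhs_ballP; exists e => // y [_ xy].
by apply: eA; split => // i j; rewrite !mxE; exact: xy.
Qed.

(** * Random matrices and their trigonometric expectations *)

Section RandomMatrix.
Context {R : realType} d (T : measurableType d) (P : probability T R).
Variables (a b : nat).
Implicit Types (Y : T -> 'M[R]_(a, b)) (f : 'M[R]_(a, b) -> R)
  (g : 'rV[R]_(a * b) -> R).

Lemma measurable_mxvec Y k : random_mx Y ->
  measurable_fun [set: T] (fun w => mxvec (Y w) 0 k).
Proof.
move=> mY; case/mxvec_indexP: k => i j.
by under eq_fun do rewrite mxvecE; exact: mY.
Qed.

Lemma measurable_pairing t Y : random_mx Y ->
  measurable_fun [set: T] (fun w => pairing t (mxvec (Y w))).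
Proof.
move=> mY; apply: measurable_sum => k.
by apply: measurable_funM => //; exact: measurable_mxvec.
Qed.

Lemma measurable_cos_fun (Z : T -> R) : measurable_fun [set: T] Z ->
  measurable_fun [set: T] (fun w => cos (Z w)).
Proof.
move=> mZ; apply: measurableT_comp => //.
by apply: continuous_measurable_fun; exact: continuous_cos.
Qed.

Lemma L1_cos (Z : T -> R) : measurable_fun [set: T] Z ->
  L1 P (fun w => cos (Z w)).
Proof.
move=> mZ; apply: (@L1_bounded _ _ _ P _ 1); first exact: measurable_cos_fun.
by move=> w; exact: cos_max.
Qed.

Lemma measurable_trig g Y : trig g -> random_mx Y ->
  measurable_fun [set: T] (fun w => g (mxvec (Y w))).
Proof.
move=> + mY; elim=> [t c|f1 f2 _ m1 _ m2|u f1 _ m1].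
- by apply: measurable_cos_fun; apply: measurable_funD => //; exact: measurable_pairing.
- exact: measurable_funD.
- exact: measurable_funM.
Qed.

Lemma trig_bounded (g : 'rV[R]_(a * b) -> R) : trig g ->
  exists C, forall x, `|g x| <= C.
Proof.
elim=> [t c|f1 f2 _ [C1 h1] _ [C2 h2]|u f1 _ [C1 h1]].
- by exists 1 => x; exact: cos_max.
- by exists (C1 + C2) => x; rewrite (le_trans (ler_normD _ _)) // lerD.
- by exists (`|u| * C1) => x; rewrite normrM ler_wpM2l.
Qed.

Lemma L1_trig g Y : trig g -> random_mx Y -> L1 P (fun w => g (mxvec (Y w))).
Proof.
move=> tg mY; have [C gC] := trig_bounded tg.
by apply: (@L1_bounded _ _ _ P _ C) => //; exact: measurable_trig.
Qed.

Definition l1norm (x : 'M[R]_(a, b)) : R := \sum_k `|mxvec x 0 k|.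

Lemma measurable_l1norm Y : random_mx Y ->
  measurable_fun [set: T] (fun w => l1norm (Y w)).
Proof.
move=> mY; apply: measurable_sum => k.
by apply: measurableT_comp => //; exact: measurable_mxvec.
Qed.

Lemma l1norm_coord x k : `|mxvec x 0 k| <= l1norm x.
Proof. by rewrite /l1norm (bigD1 k) //= lerDl sumr_ge0. Qed.

Lemma measurable_gt_fun (Z : T -> R) (c : R) : measurable_fun [set: T] Z ->
  measurable [set w | c < Z w].
Proof.
move=> mZ; rewrite (_ : mkset _ = [set: T] `&` Z @^-1` `]c, +oo[); first exact: mZ.
by apply/seteqP; split => w /=; rewrite in_itv /= andbT // => -[].
Qed.

(** [random_mx] speaks of entries only, so measurability of [f (Y w)] comes from a pointwise limit
    of trigonometric polynomials, with error 1 / (n + 1) on the box of half-width n + 1. *)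
Lemma measurable_continuous_mx f Y (M : R) : continuous f ->
  (forall x, `|f x| <= M) -> random_mx Y ->
  measurable_fun [set: T] (fun w => f (Y w)).
Proof.
move=> cf fM mY; pose f' (x : 'rV[R]_(a * b)) := f (vec_mx x).
have cf' : continuous f'.
  by move=> x; apply: continuous_comp; [exact: vec_mx_continuous|exact: cf].
have : forall n : nat, exists g, [/\ trig g, forall x, `|g x| <= M &
    forall x : 'rV[R]_(a * b), (forall k, `|x 0 k| <= n.+1%:R) ->
      `|f' x - g x| <= n.+1%:R^-1].
  by move=> n; apply: trig_approx => // x; exact: fM.
move=> /choice[g hg].
apply: (@measurable_realfun.measurable_fun_cvg _ _ _ _ (fun n w => g n (mxvec (Y w)))).
  by move=> n; apply: measurable_trig => //; have [] := hg n.
move=> w _; apply/cvgrPdist_le => e e0.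
near=> n; have [_ _ /(_ (mxvec (Y w)))] := hg n.
rewrite /f' mxvecK => H; apply: le_trans (H _) _ => [k|].
  rewrite (le_trans (l1norm_coord _ _)) // ltW // (lt_trans (truncnS_gt _)) //.
  rewrite ltr_nat ltnS; near: n; exact: nbhs_infty_gt.
by apply/ltW; near: n; exact: (near_infty_natSinv_lt (PosNum e0)).
Unshelve. all: by end_near. Qed.

(** Off the box both functions are still bounded by [M], so they differ there by at most [2 * M].
    This is why the approximation must respect the bound of [f] globally. *)
Lemma E_approx f g Y (M L e : R) : continuous f -> (forall x, `|f x| <= M) ->
  trig g -> (forall x, `|g x| <= M) ->
  (forall x : 'rV[R]_(a * b), (forall k, `|x 0 k| <= L) ->
     `|f (vec_mx x) - g x| <= e) -> 0 <= e -> random_mx Y ->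
  `|\int[P]_w f (Y w) - \int[P]_w g (mxvec (Y w))| <=
    e + 2 * M * fine (P [set w | L < l1norm (Y w)]).
Proof.
move=> cf fM tg gM fg e0 mY.
have M0 : 0 <= M by apply: le_trans (fM 0).
have mf := measurable_continuous_mx cf fM mY.
have iF : L1 P (fun w => f (Y w)) by exact: (@L1_bounded _ _ _ P _ M).
have iG := L1_trig tg mY.
have mA := measurable_gt_fun L (measurable_l1norm mY).
rewrite -EB // -(E_indic P mA) -(Ecst P e) -EZ; last exact: L1_indic.
rewrite -ED; [|exact: L1_cst|exact/L1Z/L1_indic].
apply: E_norm_le.
- by apply: measurable_funB => //; exact: measurable_trig.
- by apply: L1D; [exact: L1_cst|exact/L1Z/L1_indic].
move=> w; rewrite indicE; case: (boolP (_ \in _)) => /= [_|].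
  rewrite mulr1 ler_wpDl // (le_trans (ler_normB _ _)) //.
  by rewrite mulr_natl mulr2n lerD.
rewrite notin_setE /= => /negP; rewrite -leNgt => hL.
rewrite mulr0 addr0 -{1}[Y w]mxvecK; apply: fg => k.
exact: le_trans (l1norm_coord _ _) hL.
Qed.

End RandomMatrix.

Lemma tight1 (R : realType) d (T : measurableType d) (P : probability T R)
  (Z : T -> R) (e : R) : measurable_fun [set: T] Z -> 0 < e ->
  exists L0, forall L, L0 < L -> (P [set w | (L < Z w)%R] <= e%:E)%E.
Proof.
move=> mZ e0; have := @cvg_ccdfy0 _ _ _ P (rv_of P mZ).
move=> /fine_cvgP[[L1 [_ h1]] /cvgrPdist_le/(_ _ e0)[L2 [_ h2]]].
exists (Num.max L1 L2) => L; rewrite gt_max => /andP[l1 l2].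
have := h2 _ l2; have := h1 _ l1; rewrite /= /ccdf /distribution /pushforward /=.
have -> : [set w | L < Z w] = Z @^-1` `]L, +oo[.
  by apply/seteqP; split => w /=; rewrite in_itv /= andbT.
move=> fz; rewrite sub0r normrN -lee_fin => H; apply: le_trans H.
by rewrite -[leLHS]fineK // lee_fin ler_norm.
Qed.

Definition tight (R : realType) d (T : measurableType d) (P : probability T R)
    a b (Y : nat -> T -> 'M[R]_(a, b)) :=
  forall e : R, 0 < e -> exists L0 : R, forall L, L0 < L ->
    \forall n \near \oo, (P [set w | (L < l1norm (Y n w))%R] <= e%:E)%E.

Section Levy.
Context {R : realType} d (T : measurableType d) (P : probability T R).
Context d' (T' : measurableType d') (P' : probability T' R).
Variables (a b : nat) (Y : nat -> T -> 'M[R]_(a, b)) (Y' : T' -> 'M[R]_(a, b)).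
Hypotheses (mY : forall n, random_mx (Y n)) (mY' : random_mx Y').
Hypothesis cosY : forall (t : 'cV[R]_(a * b)) (c : R),
  (\int[P]_w cos ((t^T *m stack_rows (Y n w)) 0 0 + c)) @[n --> \oo] -->
  \int[P']_w cos ((t^T *m stack_rows (Y' w)) 0 0 + c).
Hypothesis tY : tight P Y.

Lemma cvg_trig g : trig g ->
  (\int[P]_w g (mxvec (Y n w))) @[n --> \oo] --> \int[P']_w g (mxvec (Y' w)).
Proof.
elim=> [t c|f1 f2 t1 h1 t2 h2|u f1 t1 h1].
- have := @cosY (\col_k t k) c; rewrite (_ : (fun n => _) =
    (fun n => \int[P]_w cos (pairing t (mxvec (Y n w)) + c))); last first.
    apply/funext => n; apply: eq_Rintegral => w _; rewrite pairing_stack.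
    by congr (cos (pairing _ _ + _)); apply/funext => k; rewrite mxE.
  rewrite (_ : \int[P']_w _ = \int[P']_w cos (pairing t (mxvec (Y' w)) + c)) //.
  apply: eq_Rintegral => w _; rewrite pairing_stack.
  by congr (cos (pairing _ _ + _)); apply/funext => k; rewrite mxE.
- rewrite ED; [|exact: L1_trig..].
  rewrite (_ : (fun n => _) = (fun n => \int[P]_w f1 (mxvec (Y n w)) +
      \int[P]_w f2 (mxvec (Y n w)))); first exact: cvgD.
  by apply/funext => n; rewrite ED //; exact: L1_trig.
- rewrite EZ; last exact: L1_trig.
  rewrite (_ : (fun n => _) = (fun n => u * \int[P]_w f1 (mxvec (Y n w)))).
    by apply: cvgM => //; exact: cvg_cst.
  by apply/funext => n; rewrite EZ //; exact: L1_trig.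
Qed.

Lemma levy_continuity : cvg_in_distribution P P' Y Y'.
Proof.
split => // f cf [M fM].
have M0 : 0 <= M by apply: le_trans (fM 0).
pose f' (x : 'rV[R]_(a * b)) := f (vec_mx x).
have cf' : continuous f'.
  by move=> x; apply: continuous_comp; [exact: vec_mx_continuous|exact: cf].
have iY n : L1 P (fun w => f (Y n w)).
  apply: (@L1_bounded _ _ _ P _ M) => //.
  exact: measurable_continuous_mx fM (mY n).
have iY' : L1 P' (fun w => f (Y' w)).
  apply: (@L1_bounded _ _ _ P' _ M) => //.
  exact: measurable_continuous_mx fM mY'.
rewrite unlock (_ : (fun n => _) = (fun n => (\int[P]_w f (Y n w))%:E)); last first.
  by apply/funext => n; exact: (EFin_E (iY n)).
rewrite [X in _ --> X](EFin_E iY').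
apply: cvg_EFin; first exact: nearW.
apply/cvgrPdist_le => e e0.
(* Five shares: each of the two expectations spends one on the approximation inside the box and one
   on the mass outside; the last one goes to the convergence of the trigonometric expectation. The
   [+ 1] in [e'] covers [M = 0]. *)
have e6 : 0 < e / 5 by rewrite divr_gt0.
pose e' := e / 5 / (2 * M + 1).
have M1 : 0 < 2 * M + 1 by lra.
have e'0 : 0 < e' by rewrite divr_gt0.
have Me' : 2 * M * e' <= e / 5.
  rewrite /e' mulrA ler_pdivrMr // mulrC ler_pM2l //; lra.
have [L1 h1] := tY e'0.
have [L2 h2] := tight1 P' (measurable_l1norm mY') e'0.
pose L := Num.max 1 (Num.max (L1 + 1) (L2 + 1)).
have L0 : 0 < L by rewrite lt_max ltr01.
have LL1 : L1 < L by rewrite !lt_max ltrDl ltr01 orbT.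
have LL2 : L2 < L by rewrite !lt_max [L2 < L2 + 1]ltrDl ltr01 !orbT.
have [g [tg gM fg]] := trig_approx cf' (fun x => fM (vec_mx x)) L0 e6.
have hY' : `|\int[P']_w f (Y' w) - \int[P']_w g (mxvec (Y' w))| <= e / 5 + e / 5.
  apply: le_trans (E_approx P' cf fM tg gM fg (ltW e6) mY') _.
  rewrite lerD2l (le_trans _ Me') // ler_wpM2l ?mulr_ge0 //.
  rewrite -lee_fin fineK; first exact: h2.
  by apply: fin_num_measure; apply: measurable_gt_fun; exact: measurable_l1norm.
near=> n.
have hY : `|\int[P]_w f (Y n w) - \int[P]_w g (mxvec (Y n w))| <= e / 5 + e / 5.
  apply: le_trans (E_approx P cf fM tg gM fg (ltW e6) (mY n)) _.
  rewrite lerD2l (le_trans _ Me') // ler_wpM2l ?mulr_ge0 //.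
  rewrite -lee_fin fineK; first by near: n; exact: h1.
  by apply: fin_num_measure; apply: measurable_gt_fun; exact: measurable_l1norm.
have hg : `|\int[P']_w g (mxvec (Y' w)) - \int[P]_w g (mxvec (Y n w))| <= e / 5.
  by near: n; exact: (cvgrPdist_le _ _).1 (cvg_trig tg) _ e6.
rewrite /=; move: hY' hY hg.
move: (\int[P']_w f _) (\int[P']_w g _) (\int[P]_w f _) (\int[P]_w g _) => A B C D.
rewrite !ler_norml => /andP[? ?] /andP[? ?] /andP[? ?]; lra.
Unshelve. all: by end_near. Qed.

End Levy.

(** * Normal distributions *)

Section RealDerivatives.
Context {R : realType}.
Implicit Types (f g : R -> R) (x a b c u v : R).

Lemma is_deriveD_fun f g x a b : is_derive x (1 : R) f a ->
  is_derive x (1 : R) g b -> is_derive x (1 : R) (fun y => f y + g y) (a + b).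
Proof. exact: is_deriveD. Qed.

Lemma is_deriveM_fun f g x a b : is_derive x (1 : R) f a ->
  is_derive x (1 : R) g b ->
  is_derive x (1 : R) (fun y => f y * g y) (a * g x + f x * b).
Proof.
move=> df dg; apply: (is_derive_eq (is_deriveM df dg)).
by rewrite addrC [a * _]mulrC.
Qed.

Lemma is_derive_comp_fun f g x a b : is_derive (g x) (1 : R) f a ->
  is_derive x (1 : R) g b -> is_derive x (1 : R) (fun y => f (g y)) (a * b).
Proof. exact: is_derive1_comp. Qed.

Lemma is_derive_affine u c x : is_derive x (1 : R) (fun y => u * y + c) u.
Proof.
apply: (is_derive_eq (is_deriveD_fun
  (is_deriveM_fun (is_derive_cst u x 1) (is_derive_id x 1)) (is_derive_cst c x 1))).
by rewrite /cst; ring.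
Qed.

Lemma is_derive_cos_affine u c x :
  is_derive x (1 : R) (fun y => cos (u * y + c)) (- u * sin (u * x + c)).
Proof.
apply: (is_derive_eq (is_derive_comp_fun (is_derive_cos _) (is_derive_affine u c x))).
by ring.
Qed.

Lemma is_derive_sin_affine u c x :
  is_derive x (1 : R) (fun y => sin (u * y + c)) (u * cos (u * x + c)).
Proof.
apply: (is_derive_eq (is_derive_comp_fun (is_derive_sin _) (is_derive_affine u c x))).
by ring.
Qed.

Lemma is_derive_expR_quad u v x :
  is_derive x (1 : R) (fun y => expR (u * ((y - v) * (y - v))))
    (2 * u * (x - v) * expR (u * ((x - v) * (x - v)))).
Proof.
have d1 : is_derive x (1 : R) (fun y => y - v) 1.
  apply: (is_derive_eq (is_deriveD_fun (is_derive_id x 1) (is_derive_cst (- v) x 1))).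
  by rewrite addr0.
have d2 := is_deriveM_fun (is_derive_cst u x 1) (is_deriveM_fun d1 d1).
apply: (is_derive_eq (is_derive_comp_fun (is_derive_expR _) d2)).
by rewrite /cst; ring.
Qed.

Notation mu := (@lebesgue_measure R).

(** Integration by parts over the line will be this statement for a product: the boundary terms
    vanish at infinity, and dominated convergence lets the interval grow. *)
Lemma integral_derivative_line (F f : R -> R) :
  (forall x, is_derive x (1 : R) F (f x)) -> continuous f ->
  mu.-integrable [set: R] (EFin \o f) ->
  F n%:R @[n --> \oo] --> 0 -> F (- n%:R) @[n --> \oo] --> 0 ->
  \int[mu]_x f x = 0.
Proof.
move=> dF cf intf Fp Fn.
have cF : continuous F.
  by move=> x; apply/differentiable_continuous/derivable1_diffP; case: (dF x).
(* [n.+1] keeps the interval nondegenerate. *)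
have FTC (n : nat) : (\int[mu]_(x in `[(- n.+1%:R)%R, n.+1%:R%R]) (f x)%:E =
    (F n.+1%:R)%:E - (F (- n.+1%:R))%:E)%E.
  apply: continuous_FTC2.
  - by rewrite (lt_le_trans (_ : _ < 0)) // ltrNl oppr0 ltr0Sn.
  - by apply: continuous_subspaceT => x; exact: cf.
  - split.
    + by move=> x _; case: (dF x).
    + by apply: cvg_at_right_filter; exact: cF.
    + by apply: cvg_at_left_filter; exact: cF.
  - by move=> x _; rewrite derive1E; exact: (@derive_val _ _ _ _ _ _ _ (dF x)).
have mf : measurable_fun [set: R] f by apply: continuous_measurable_fun.
have H1 : (\int[mu]_(x in `[(- n.+1%:R)%R, n.+1%:R%R]) (f x)%:E)%E @[n --> \oo] -->
    (\int[mu]_x (f x)%:E)%E.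
  under eq_fun do rewrite integral_mkcond.
  apply: (@dominated_cvg _ _ _ mu _ _ _ _ (fun x => `|(f x)%:E|)%E) => //.
  - move=> n; apply/(measurable_restrictT _ _).1 => //.
    by apply/measurable_EFinP/measurable_funTS.
  - move=> x _; apply: cvg_near_cst; near=> n.
    rewrite patchE ifT // inE /= in_itv /= -ler_norml.
    rewrite (le_trans (ltW (truncnS_gt _))) // ler_nat ltnS.
    by near: n; exact: nbhs_infty_ge.
  - exact: integrable_abse.
  - move=> n x _; rewrite patchE; case: ifPn => _ //.
    by rewrite abse0.
have H2 : (\int[mu]_(x in `[(- n.+1%:R)%R, n.+1%:R%R]) (f x)%:E)%E @[n --> \oo] --> 0%E.
  under eq_fun do rewrite FTC -EFinB.
  apply: cvg_EFin; first exact: nearW.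
  rewrite -(subrr (0:R)); apply: cvgB.
    by rewrite -(cvg_shiftS (fun n => F n%:R)) in Fp.
  by rewrite -(cvg_shiftS (fun n => F (- n%:R))) in Fn.
by rewrite /Rintegral (cvg_unique _ H1 H2).
Unshelve. all: by end_near. Qed.

End RealDerivatives.

(** * The cosine transform of a normal law *)

Section NormalCos.
Context {R : realType}.
Notation mu := (@lebesgue_measure R).
Variables (m s : R).
Hypothesis s0 : s != 0.

Let s2 : 0 < s ^+ 2. Proof. by rewrite exprn_even_gt0. Qed.

Let pdfE x : normal_pdf m s x =
  normal_peak s * expR (- (2 * s ^+ 2)^-1 * ((x - m) * (x - m))).
Proof.
rewrite normal_pdfE // /normal_fun; congr (_ * expR _).
by rewrite -mulr_natl; field.
Qed.

Lemma is_derive_normal_pdf x :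
  is_derive x (1 : R) (normal_pdf m s) (- (x - m) / s ^+ 2 * normal_pdf m s x).
Proof.
have -> : normal_pdf m s = fun x =>
    normal_peak s * expR (- (2 * s ^+ 2)^-1 * ((x - m) * (x - m))).
  by apply/funext => y; rewrite pdfE.
apply: (is_derive_eq (is_deriveM_fun (is_derive_cst (normal_peak s) x 1)
  (is_derive_expR_quad (- (2 * s ^+ 2)^-1) m x))).
rewrite /cst; move: (normal_peak s) (expR _) => A B.
by field.
Qed.

(** Half of the exponent pays for the factor [|x - m|], and the other half is a normal density with
    deviation [s']. With z = (x - m)^2 / (4 s^2) the claim reduces to |x - m| <= 2 |s| (1 + z) <= 2
    |s| exp z. *)
Lemma integrable_norm_normal_pdf :
  mu.-integrable [set: R] (fun x => (`|x - m| * normal_pdf m s x)%:E).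
Proof.
pose s' := Num.sqrt 2 * s.
have s'0 : s' != 0 by rewrite mulf_neq0 // gt_eqF // sqrtr_gt0.
pose C := 2 * `|s| * normal_peak s / normal_peak s'.
have p0 := normal_peak_gt0 s0; have p'0 := normal_peak_gt0 s'0.
have iC : mu.-integrable [set: R] (fun x => (C * normal_pdf m s' x)%:E).
  under eq_fun do rewrite EFinM.
  by apply: integrableZl => //; exact: integrable_normal_pdf.
apply: le_integrable iC => //.
  apply/measurable_EFinP; apply: measurable_funM; last exact: measurable_normal_pdf.
  by apply: measurableT_comp => //; exact: measurable_funB.
move=> x _; rewrite /= lee_fin [leLHS]ger0_norm; last first.
  by rewrite mulr_ge0 // normal_pdf_ge0.
rewrite (le_trans _ (ler_norm _)) // pdfE.
have -> : normal_pdf m s' x =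
    normal_peak s' * expR (- (4 * s ^+ 2)^-1 * ((x - m) * (x - m))).
  rewrite normal_pdfE // /normal_fun; congr (_ * expR _).
  by rewrite /s' exprMn sqr_sqrtr // -mulr_natl; field.
have EC Z : C * (normal_peak s' * Z) = normal_peak s * (2 * `|s| * Z).
  by rewrite /C; field; rewrite gt_eqF.
rewrite mulrCA EC ler_pM2l //.
set z := (4 * s ^+ 2)^-1 * ((x - m) * (x - m)).
have z0 : 0 <= z.
  by rewrite /z -expr2 mulr_ge0 ?sqr_ge0 // invr_ge0 mulr_ge0 // ltW.
have -> : - (2 * s ^+ 2)^-1 * ((x - m) * (x - m)) = - z + - z.
  by rewrite /z; field.
have -> : - (4 * s ^+ 2)^-1 * ((x - m) * (x - m)) = - z by rewrite mulNr.
rewrite expRD mulrA ler_pM2r ?expR_gt0 //.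
rewrite -ler_pdivlMr ?expR_gt0 // expRN invrK.
apply: (@le_trans _ _ (2 * `|s| * (1 + z))); last first.
  by rewrite ler_wpM2l ?mulr_ge0 // expR_ge1Dx.
have zE : z * (4 * `|s| ^+ 2) = `|x - m| ^+ 2.
  by rewrite !real_normK ?num_real // /z expr2; field.
have sp : 0 < `|s| by rewrite normr_gt0.
move: zE (normr_ge0 (x - m)) sp z0; move: `|x - m| `|s| z => A B z' zE A0 B0 z'0.
rewrite -(ler_pXn2r (ltn0Sn 1)) ?nnegrE ?mulr_ge0 ?addr_ge0 ?(ltW B0) //.
rewrite -zE !exprMn; nra.
Qed.

Lemma normal_pdf_cvg0 (u : nat -> R) :
  (forall C : R, \forall n \near \oo, C <= `|u n - m|) ->
  normal_pdf m s (u n) @[n --> \oo] --> 0.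
Proof.
move=> uoo; have p0 := normal_peak_gt0 s0.
apply/cvgrPdist_le => e e0; near=> n.
rewrite sub0r normrN ger0_norm ?normal_pdf_ge0 // pdfE.
rewrite -ler_pdivlMl // mulNr expRN -[leRHS]invrK lef_pV2 ?posrE ?expR_gt0 //; last first.
  by rewrite invr_gt0 pmulr_rgt0 // invr_gt0.
apply: le_trans (expR_ge1Dx _); rewrite ler_wpDl //.
have s22 : 0 < 2 * s ^+ 2 by rewrite mulr_gt0.
rewrite -expr2 ler_pdivlMl // -(real_normK (num_real (u n - m))).
set B := _ * _.
have : Num.max 1 B <= `|u n - m| by near: n; exact: uoo.
by rewrite ge_max => /andP[h1 h2]; rewrite (le_trans h2) // ler_eXnr.
Unshelve. all: by end_near. Qed.

Lemma integrable_mul_normal_pdf (g : R -> R) (C : R) : continuous g ->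
  (forall x, `|g x| <= C) ->
  mu.-integrable [set: R] (fun x => (g x * normal_pdf m s x)%:E).
Proof.
move=> cg gC; have C0 : 0 <= C by apply: le_trans (gC 0).
have iC : mu.-integrable [set: R] (fun x => (C * normal_pdf m s x)%:E).
  under eq_fun do rewrite EFinM.
  by apply: integrableZl => //; exact: integrable_normal_pdf.
apply: le_integrable iC => //.
  apply/measurable_EFinP; apply: measurable_funM; last exact: measurable_normal_pdf.
  exact: continuous_measurable_fun.
move=> x _; rewrite /= lee_fin !normrM ler_wpM2r // [leRHS]ger0_norm //.
Qed.

Let trig_fun_continuous (h : R -> R) (t c : R) : continuous h ->
  continuous (fun x => h ((x - m) * t + c)).
Proof.
move=> ch x; apply: continuous_comp; last exact: ch.
apply: cvgD; last exact: cvg_cst.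
by apply: cvgM; [apply: cvgB; [exact: cvg_id|exact: cvg_cst]|exact: cvg_cst].
Qed.

Let G c t := \int[mu]_x (cos ((x - m) * t + c) * normal_pdf m s x).

Let intf c t : mu.-integrable [set: R]
  (fun x => (cos ((x - m) * t + c) * normal_pdf m s x)%:E).
Proof.
apply: (@integrable_mul_normal_pdf _ 1) => [|x]; last exact: cos_max.
exact/trig_fun_continuous/continuous_cos.
Qed.

Let ints c t : mu.-integrable [set: R]
  (fun x => ((x - m) * sin ((x - m) * t + c) * normal_pdf m s x)%:E).
Proof.
apply: le_integrable integrable_norm_normal_pdf => //.
  apply/measurable_EFinP; apply: measurable_funM; last exact: measurable_normal_pdf.
  apply: measurable_funM; first exact: measurable_funB.
  apply: continuous_measurable_fun; exact/trig_fun_continuous/continuous_sin.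
move=> x _; rewrite /= lee_fin !normrM normr_id ler_wpM2r //.
by rewrite ler_piMr // sin_max.
Qed.

(* [G c] satisfies G' = - s^2 t G: differentiate under the integral, then
   integrate by parts ([integral_sin]). *)
Let is_derive_G c t : is_derive t (1 : R) (G c)
  (\int[mu]_x (- (x - m) * sin ((x - m) * t + c) * normal_pdf m s x)).
Proof.
pose f t x := cos ((x - m) * t + c) * normal_pdf m s x.
have df t' x : is_derive t' (1 : R) (f ^~ x)
    (- (x - m) * sin ((x - m) * t' + c) * normal_pdf m s x).
  apply: (is_derive_eq (is_deriveM_fun (is_derive_cos_affine (x - m) c t')
    (is_derive_cst (normal_pdf m s x) t' 1))).
  by rewrite mulr0 addr0.
have d1f t' x : partial1of2 f t' x =
    - (x - m) * sin ((x - m) * t' + c) * normal_pdf m s x.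
  by rewrite /partial1of2 derive1E; exact: (@derive_val _ _ _ _ _ _ _ (df t' x)).
have It : `]t - 1, t + 1[%classic t.
  by rewrite /= in_itv /= ltrDl ltr01 ltrBlDr ltrDl ltr01.
have derf x y : `]t - 1, t + 1[%classic x -> [set: R] y -> derivable (f ^~ y) x 1.
  by move=> _ _; case: (df x y).
have G0 y : 0 <= `|y - m| * normal_pdf m s y by rewrite mulr_ge0 ?normal_pdf_ge0.
have Gub x y : `]t - 1, t + 1[%classic x -> [set: R] y ->
    `|partial1of2 f x y| <= `|y - m| * normal_pdf m s y.
  move=> _ _; rewrite d1f !normrM normrN [ `|normal_pdf _ _ _|]ger0_norm ?normal_pdf_ge0 //.
  by rewrite ler_wpM2r ?normal_pdf_ge0 // ler_piMr // sin_max.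
have intf' x : `]t - 1, t + 1[%classic x -> mu.-integrable [set: R] (EFin \o f x).
  by move=> _; exact: intf.
have D := @derivable_under_integral R _ _ mu f setT measurableT t (t - 1) (t + 1)
  It intf' derf _ G0 integrable_norm_normal_pdf Gub.
have D' := @differentiation_under_integral R _ _ mu f setT measurableT t (t - 1) (t + 1)
  It intf' derf _ G0 integrable_norm_normal_pdf Gub.
apply: DeriveDef; first exact: D.
rewrite -derive1E D'; apply: eq_Rintegral => x _; exact: d1f.
Qed.

Let integral_sin c t :
  \int[mu]_x ((x - m) * sin ((x - m) * t + c) * normal_pdf m s x) =
  s ^+ 2 * t * G c t.
Proof.
pose F x := sin ((x - m) * t + c) * normal_pdf m s x.
pose f x := t * (cos ((x - m) * t + c) * normal_pdf m s x) -
  (s ^+ 2)^-1 * ((x - m) * sin ((x - m) * t + c) * normal_pdf m s x).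
have dF x : is_derive x (1 : R) F (f x).
  have -> : F = (fun x => sin (t * x + (c - t * m)) * normal_pdf m s x).
    by apply/funext => y; rewrite /F; congr (sin _ * _); ring.
  apply: (is_derive_eq (is_deriveM_fun (is_derive_sin_affine t (c - t * m) x)
    (is_derive_normal_pdf x))).
  rewrite /f (_ : (x - m) * t + c = t * x + (c - t * m)); last by ring.
  by field.
have i1 : mu.-integrable [set: R]
    (fun x => (t * (cos ((x - m) * t + c) * normal_pdf m s x))%:E).
  by under eq_fun do rewrite EFinM; apply: integrableZl => //; exact: intf.
have i2 : mu.-integrable [set: R] (fun x => ((s ^+ 2)^-1 *
    ((x - m) * sin ((x - m) * t + c) * normal_pdf m s x))%:E).
  by under eq_fun do rewrite EFinM; apply: integrableZl => //; exact: ints.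
have iF : mu.-integrable [set: R] (EFin \o f).
  by rewrite /comp /f; under eq_fun do rewrite EFinB; exact: integrableB.
have cpdf := @continuous_normal_pdf R m s s0.
have cf : continuous f.
  move=> x; apply: cvgB; (apply: cvgM; first exact: cvg_cst);
    (apply: cvgM; last exact: cpdf).
    exact/trig_fun_continuous/continuous_cos.
  apply: cvgM; last exact/trig_fun_continuous/continuous_sin.
  by apply: cvgB; [exact: cvg_id|exact: cvg_cst].
have Fle x : `|F x| <= normal_pdf m s x.
  rewrite /F normrM [ `|normal_pdf _ _ _|]ger0_norm ?normal_pdf_ge0 //.
  by rewrite ler_piMl ?normal_pdf_ge0 // sin_max.
have far C : \forall n \near \oo, C <= `|n%:R - m|.
  near=> n; rewrite (le_trans _ (ler_norm _)) // lerBrDr (le_trans (ltW (truncnS_gt _))) //.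
  by rewrite ler_nat; near: n; exact: nbhs_infty_ge.
have farN C : \forall n \near \oo, C <= `|- n%:R - m|.
  near=> n; rewrite -opprD normrN (le_trans _ (ler_norm _)) // -lerBlDr.
  rewrite (le_trans (ltW (truncnS_gt _))) // ler_nat; near: n; exact: nbhs_infty_ge.
have F1 : F n%:R @[n --> \oo] --> 0.
  apply: norm_cvg0; apply: (squeeze_cvgr _ (cvg_cst 0) (normal_pdf_cvg0 far)).
  by apply: nearW => n; rewrite normr_ge0 Fle.
have F2 : F (- n%:R) @[n --> \oo] --> 0.
  apply: norm_cvg0; apply: (squeeze_cvgr _ (cvg_cst 0) (normal_pdf_cvg0 farN)).
  by apply: nearW => n; rewrite normr_ge0 Fle.
have := integral_derivative_line dF cf iF F1 F2.
rewrite RintegralB // RintegralZl //; last exact: intf.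
rewrite RintegralZl //; last exact: ints.
move=> /eqP; rewrite subr_eq0 => /eqP /(congr1 ( *%R (s ^+ 2))).
by rewrite mulrA mulVKf ?gt_eqF // => <-; rewrite mulrA.
Unshelve. all: by end_near. Qed.

Lemma cos_normal_pdf c t :
  \int[mu]_x (cos ((x - m) * t + c) * normal_pdf m s x) =
  expR (- (s ^+ 2 * t ^+ 2 / 2)) * cos c.
Proof.
(* Integrating factor of the differential equation: [h] has zero derivative, and [h 0 = cos c]. The
   form [t - 0] matches [is_derive_expR_quad]. *)
pose h t := G c t * expR (s ^+ 2 / 2 * ((t - 0) * (t - 0))).
have dh t' : is_derive t' (1 : R) h 0.
  apply: (is_derive_eq (is_deriveM_fun (is_derive_G c t')
    (is_derive_expR_quad (s ^+ 2 / 2) 0 t'))).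
  have -> : \int[mu]_x (- (x - m) * sin ((x - m) * t' + c) * normal_pdf m s x) =
     - (s ^+ 2 * t' * G c t').
    rewrite -integral_sin -[RHS]mulN1r -RintegralZl //; last exact: ints.
    by apply: eq_Rintegral => x _; rewrite mulN1r !mulNr.
  by rewrite subr0; field.
have := is_derive_0_is_cst t 0 dh.
rewrite /h !subr0 !mulr0 expR0 mulr1.
have -> : G c 0 = cos c.
  rewrite /G; under eq_Rintegral do rewrite mulr0 add0r.
  rewrite RintegralZl //; last exact: integrable_normal_pdf.
  by rewrite /Rintegral integral_normal_pdf mulr1.
move=> <-; rewrite -/(G c t) mulrCA -expRD.
rewrite (_ : _ + _ = 0) ?expR0 ?mulr1 //.
by rewrite -expr2 mulrAC addNr.
Qed.

(** The Radon-Nikodym derivative of [normal_prob m s] agrees almost everywhere with [normal_pdf],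
    since both have the same integral over every measurable set. *)
Lemma integral_normal_prob (f : R -> R) : measurable_fun [set: R] f ->
  (normal_prob m s).-integrable [set: R] (EFin \o f) ->
  \int[normal_prob m s]_x f x = \int[mu]_x (f x * normal_pdf m s x).
Proof.
move=> mf finf; rewrite /Rintegral; congr fine.
rewrite -(Radon_Nikodym_change_of_variables (normal_prob_dominates m s)) //=.
apply: ae_eq_integral => //.
- apply: emeasurable_funM; first exact/measurable_EFinP.
  apply: (measurable_int mu).
  by apply: Radon_Nikodym_integrable; exact: normal_prob_dominates.
- by apply/measurable_EFinP; apply: measurable_funM => //; exact: measurable_normal_pdf.
- under [X in ae_eq _ _ _ X]eq_fun do rewrite EFinM.
  apply: ae_eqe_mul2l => /=.
  rewrite Radon_NikodymE //=; first exact: normal_prob_dominates.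
  move=> dom; case: cid => /= h [h1 h2 h3].
  apply: integral_ae_eq => //=; first by apply/measurable_EFinP; exact: measurable_normal_pdf.
  by move=> E E01 mE; rewrite -h3.
Qed.

Lemma cos_normal c t : \int[normal_prob m s]_x cos (t * x + c) =
  expR (- (s ^+ 2 * t ^+ 2 / 2)) * cos (t * m + c).
Proof.
have mc : measurable_fun [set: R] (fun x => cos (t * x + c)).
  by apply: measurable_cos_fun; apply: measurable_funD => //; exact: measurable_funM.
rewrite integral_normal_prob //; last first.
  by apply: (@L1_bounded _ _ _ (normal_prob m s) _ 1) => // x; exact: cos_max.
rewrite -cos_normal_pdf; apply: eq_Rintegral => x _.
by congr (cos _ * _); ring.
Qed.

End NormalCos.

(** * Uniqueness of laws on the real line *)

Section LawUnique.
Context {R : realType} d (T : measurableType d) (P : probability T R).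
Context d' (T' : measurableType d') (P' : probability T' R).
Variables (Z : T -> R) (Z' : T' -> R).
Hypotheses (mZ : measurable_fun [set: T] Z) (mZ' : measurable_fun [set: T'] Z').
Hypothesis cosZ : forall t c : R,
  \int[P]_w cos (t * Z w + c) = \int[P']_w cos (t * Z' w + c).

(** Uniqueness is a case of continuity: the constant sequence [Z], viewed as 1 x 1 matrices, is
    tight and its transforms converge to those of [Z'], so it converges in distribution to [Z']. *)
Lemma continuous_expectation_unique (h : R -> R) (M : R) : continuous h ->
  (forall x, `|h x| <= M) -> \int[P]_w h (Z w) = \int[P']_w h (Z' w).
Proof.
move=> ch hM.
pose Y (_ : nat) w : 'M[R]_(1, 1) := const_mx (Z w).
pose Y' w : 'M[R]_(1, 1) := const_mx (Z' w).
pose f (x : 'M[R]_(1, 1)) := h (x 0 0).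
have mY n : random_mx (Y n).
  by move=> i j; under eq_fun do rewrite mxE.
have mY' : random_mx Y' by move=> i j; under eq_fun do rewrite mxE.
have pE (t : 'cV[R]_(1 * 1)) (z : R) :
    (t^T *m stack_rows (const_mx z : 'M[R]_(1, 1))) 0 0 =
    (\sum_k t k 0) * z.
  rewrite mxE mulr_suml; apply: eq_bigr => k _; rewrite !mxE.
  by congr (_ * _); case/mxvec_indexP: k => i j; rewrite mxvecE mxE.
have tY : tight P Y.
  move=> e e0; have [L0 h0] := tight1 P (measurable_l1norm (mY 0%N)) e0.
  by exists L0 => L LL0; apply: nearW => n; exact: h0.
have [] := @levy_continuity R _ T P _ T' P' 1 1 Y Y' mY mY' _ tY.
  move=> t c; rewrite (_ : (fun n => _) = (fun n => \int[P']_w cos ((t^T *m stack_rows (Y'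
    w)) 0 0 + c))).
    exact: cvg_cst.
  apply/funext => n; under eq_Rintegral do rewrite pE.
  by under [RHS]eq_Rintegral do rewrite pE.
move=> _ _ H.
have cf : continuous f.
  by move=> x; apply: continuous_comp; [exact: coord_continuous|exact: ch].
have := H f cf; rewrite unlock => {}H.
have bf : exists C : R, forall x : 'M[R]_(1, 1), `|f x| <= C.
  by exists M => x; exact: hM.
have {}H := H bf.
have mh : measurable_fun [set: R] h by exact: continuous_measurable_fun.
have iZ : L1 P (fun w => h (Z w)).
  by apply: (@L1_bounded _ _ _ P _ M) => //; exact: measurableT_comp.
have iZ' : L1 P' (fun w => h (Z' w)).
  by apply: (@L1_bounded _ _ _ P' _ M) => //; exact: measurableT_comp.
have e1 : (fun n => (\int[P]_x ((f \o Y n) x)%:E)%E) =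
    (fun _ : nat => (\int[P]_x h (Z x))%:E).
  apply/funext => n; rewrite -EFin_E //; apply: eq_integral => w _.
  by rewrite /= /f mxE.
have e2 : (\int[P']_x ((f \o Y') x)%:E)%E = (\int[P']_x h (Z' x))%:E.
  rewrite -EFin_E //; apply: eq_integral => w _.
  by rewrite /= /f mxE.
rewrite e1 e2 in H; apply: EFin_inj.
exact: (cvg_unique _ (cvg_cst _) H).
Qed.

Lemma law_ray_unique (r : R) : P (Z @^-1` `[r, +oo[) = P' (Z' @^-1` `[r, +oo[).
Proof.
(* Continuous ramps from 0 at r - 1/n to 1 at r. *)
pose h (n : nat) (x : R) :=
  2^-1 * (`|1 + n%:R * (x - r)| - `|n%:R * (x - r)| + 1).
have ch n : continuous (h n).
  have cl : continuous (fun x : R => n%:R * (x - r)).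
    by move=> x; apply: cvgM; [exact: cvg_cst|apply: cvgB; [exact: cvg_id|exact: cvg_cst]].
  move=> x; apply: cvgM; first exact: cvg_cst.
  apply: cvgD; last exact: cvg_cst.
  apply: cvgB; apply: cvg_norm; last exact: cl.
  by apply: cvgD; [exact: cvg_cst|exact: cl].
have h01 n x : 0 <= h n x <= 1.
  rewrite /h; set y := n%:R * _.
  have := ler_normD 1 y; have := ler_normB (1 + y) 1.
  rewrite normr1 addrAC subrr add0r; lra.
have h1 n x : `|h n x| <= 1 by have /andP[h0 h1] := h01 n x; rewrite ger0_norm.
have cvgh x : h n x @[n --> \oo] --> (\1_(`[r, +oo[%classic) x : R).
  apply: cvg_near_cst; rewrite indicE mem_setE in_itv /= andbT.
  have [rx|xr] := leP r x.
    apply: nearW => n; rewrite /h.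
    have y0 : 0 <= n%:R * (x - r) by rewrite mulr_ge0 ?subr_ge0.
    by rewrite !ger0_norm ?addr_ge0 // (_ : true%:R = 1) //; field.
  near=> n; rewrite /h.
  suff y1 : 1 + n%:R * (x - r) <= 0.
    have y0 : n%:R * (x - r) <= 0 by lra.
    by rewrite !ler0_norm // (_ : false%:R = 0) //; field.
  have rx : 0 < r - x by rewrite subr_gt0.
  have : (r - x)^-1 <= n%:R.
    rewrite (le_trans (ltW (truncnS_gt _))) // ler_nat; near: n; exact: nbhs_infty_ge.
  rewrite -[_^-1]mul1r ler_pdivrMr // => hn.
  by rewrite -(opprB r x) mulrN subr_le0.
have lim d1 (T1 : measurableType d1) (P1 : probability T1 R) (Z1 : T1 -> R) :
    measurable_fun [set: T1] Z1 ->
    (\int[P1]_w (h n (Z1 w))%:E)%E @[n --> \oo] --> P1 (Z1 @^-1` `[r, +oo[).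
  move=> mZ1.
  have mA : measurable (Z1 @^-1` `[r, +oo[).
    by rewrite -[X in measurable X]setTI; exact: mZ1.
  have -> : P1 (Z1 @^-1` `[r, +oo[) =
      (\int[P1]_w ((\1_(`[r, +oo[%classic) (Z1 w) : R)%:E))%E.
    transitivity (\int[P1]_w ((\1_(Z1 @^-1` `[r, +oo[) w : R)%:E))%E.
      by rewrite integral_indic // setIT.
    by apply: eq_integral => w _; rewrite !indicE; congr (_%:R%:E); apply/idP/idP; rewrite !inE.
  apply: (@dominated_cvg _ _ _ P1 _ _ _ _ (fun=> 1%E)) => //.
  - move=> n; apply/measurable_EFinP; apply: measurableT_comp => //.
    exact: continuous_measurable_fun.
  - by move=> x _; apply: cvg_EFin; [exact: nearW|exact: cvgh].
  - exact: (L1_cst P1 1).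
  - by move=> n x _; rewrite lee_fin.
have L := lim _ _ P _ mZ; have L' := lim _ _ P' _ mZ'.
have E : (fun n => (\int[P]_w (h n (Z w))%:E)%E) =
    (fun n => (\int[P']_w (h n (Z' w))%:E)%E).
  apply/funext => n.
  have mh : measurable_fun [set: R] (h n) by exact: continuous_measurable_fun.
  rewrite [LHS]EFin_E ?[RHS]EFin_E.
  - by congr EFin; exact: (continuous_expectation_unique (ch n) (h1 n)).
  - by apply: (@L1_bounded _ _ _ P' _ 1) => //; exact: measurableT_comp.
  - by apply: (@L1_bounded _ _ _ P _ 1) => //; exact: measurableT_comp.
by rewrite E in L; exact: (cvg_unique _ L L').
Unshelve. all: by end_near. Qed.

Lemma law_unique (A : set R) : measurable A -> P (Z @^-1` A) = P' (Z' @^-1` A).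
Proof.
move=> mA.
pose m1 := distribution P (rv_of P mZ); pose m2 := distribution P' (rv_of P' mZ').
suff : m1 A = m2 A by [].
apply: (measure_unique (@RGenCInfty.G R) (fun n => `[- n%:R, +oo[%classic)) => //.
- exact: RGenCInfty.measurableE.
- move=> _ _ [x ->] [y ->]; exists (Num.max x y).
  by apply/seteqP; split => z /=; rewrite !in_itv /= !andbT ge_max;
    [case=> -> ->|case/andP].
- by move=> n; exists (- n%:R).
- rewrite -subTset => x _; exists (Num.truncn `|x|).+1 => //=.
  rewrite in_itv /= andbT lerNl (le_trans _ (ltW (truncnS_gt _))) //.
  by rewrite -normrN ler_norm.
- by move=> _ [x ->]; exact: law_ray_unique.
- by move=> n; rewrite (le_lt_trans (probability_le1 _ _)) ?ltry.
Qed.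

End LawUnique.

(** * Gaussian vectors with a given covariance *)

Section Gaussian.
Context {R : realType}.

(** Independence enters only through the product form of the transform. A coordinate is added by a
    product measure and integrated out by Fubini: given the others, their sum is part of the phase
    in [cos_normal]. *)
Lemma gaussian_iid N : exists d (T : measurableType d) (P : probability T R)
    (g : 'I_N -> T -> R), (forall i, measurable_fun [set: T] (g i)) /\
  forall (t : 'I_N -> R) c, \int[P]_w cos (\sum_i t i * g i w + c) =
    expR (- ((\sum_i t i ^+ 2) / 2)) * cos c.
Proof.
elim: N => [|N [d [T [P [g [mg Eg]]]]]].
  (* Any probability space would do here, as there is no coordinate to define. *)
  exists _, _, (normal_prob 0 1 : probability _ R), (fun _ => id).
  split=> [i|t c]; first exact: measurable_id.
  under eq_Rintegral do rewrite big_ord0 add0r.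
  by rewrite Ecst big_ord0 mul0r oppr0 expR0 mul1r.
pose Q : probability (measurableTypeR R) R := normal_prob 0 1.
exists _, _, ((P \x Q)%E : probability _ R),
  (fun i w => if unlift ord0 i is Some j then g j w.1 else w.2).
have mg' i : measurable_fun [set: T * measurableTypeR R]
    (fun w => if unlift ord0 i is Some j then g j w.1 else w.2 : R).
  case: (unlift ord0 i) => [j|]; last exact: measurable_snd.
  by apply: measurableT_comp => //; exact: measurable_fst.
split => // t c.
pose S (w : T) := \sum_(i < N) t (lift ord0 i) * g i w.
have mS : measurable_fun [set: T] S.
  by apply: measurable_sum => i; exact: measurable_funM.
pose f (w : T * measurableTypeR R) : R := cos (t ord0 * w.2 + (S w.1 + c)).
rewrite (@eq_Rintegral _ _ _ _ _ f); last first.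
  move=> w _; rewrite /f big_ord_recl unlift_none -addrA; congr (cos (_ + (_ + _))).
  by apply: eq_bigr => i _; rewrite liftK.
have mf : measurable_fun [set: T * measurableTypeR R] f.
  apply: measurable_cos_fun; apply: measurable_funD.
    by apply: measurable_funM => //; exact: measurable_snd.
  apply: measurable_funD => //.
  by apply: (measurableT_comp mS); exact: measurable_fst.
have if1 : L1 (P \x Q)%E f.
  by apply: (@L1_bounded _ _ _ (P \x Q)%E _ 1) => // w; exact: cos_max.
have mSc : measurable_fun [set: T] (fun w => S w + c) by exact: measurable_funD.
have iS : L1 P (fun w => cos (S w + c)) by exact: L1_cos.
rewrite /Rintegral -(integral12_prod_meas1 if1).
have -> : (\int[P]_x fubini_F Q (fun z => (f z)%:E) x)%E =
    (\int[P]_x (expR (- (t ord0 ^+ 2 / 2)) * cos (S x + c))%:E)%E.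
  apply: eq_integral => w _; rewrite /fubini_F /f /=.
  rewrite EFin_E; last first.
    apply: (L1_cos Q); apply: measurable_funD => //; exact: measurable_funM.
  by rewrite cos_normal ?oner_neq0 // mulr0 add0r expr1n mul1r.
rewrite -/(Rintegral _ _ _) EZ // Eg mulrA -expRD big_ord_recl.
by congr (expR _ * _); field.
Qed.

(** Cholesky's factorization, allowing singular [S]. If the pivot [a] is 0, semidefiniteness forces
    the column [b] below it to vanish; otherwise the Schur complement of [a] is again
    semidefinite. *)
Lemma psd_factor N (S : 'M[R]_N) : S^T = S ->
  (forall c : 'cV[R]_N, 0 <= (c^T *m S *m c) 0 0) -> exists L : 'M[R]_N, S = L *m L^T.
Proof.
elim: N S => [|N IHN] S; first by exists 0; apply/matrixP => -[].
rewrite -[N.+1]/(1 + N)%N in S *.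
move=> sS pS; pose a : R := S 0 0; pose b : 'cV[R]_N := dlsubmx S; pose C : 'M[R]_N := drsubmx S.
have SE : S = block_mx a%:M b^T b C.
  rewrite -[LHS]submxK; congr block_mx.
    by apply/matrixP => i j; rewrite !ord1 !mxE eqxx mulr1n /a; congr (S _ _); exact: val_inj.
  by rewrite /b trmx_dlsub sS.
have sC : C^T = C by rewrite /C trmx_drsub sS.
clearbody a b C.
have quad x (v : 'cV[R]_N) : 0 <= x ^+ 2 * a + 2 * x * (b^T *m v) 0 0 + (v^T *m C *m v) 0 0.
  have := pS (col_mx x%:M v); rewrite SE tr_col_mx mul_row_block mul_row_col.
  rewrite tr_scalar_mx mulmxDl !mul_scalar_mx mxE; congr (0 <= _).
  have vb : (v^T *m b) 0 0 = (b^T *m v) 0 0.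
    by rewrite -[b in LHS]trmxK -trmx_mul mxE.
  have mD (A B : 'M[R]_1) : (A + B) 0 0 = A 0 0 + B 0 0 by rewrite mxE.
  have mZ y (A : 'M[R]_1) : (y *: A) 0 0 = y * A 0 0 by rewrite mxE.
  rewrite !mul_mx_scalar mulmxDl -scalemxAl !(mD, mZ) vb !mxE eqxx !mulr1n.
  by ring.
have [a0|a0] := eqVneq a 0.
  have bb : (b^T *m b) 0 0 = 0.
    apply/eqP/negP => /negP bb0; set be := (b^T *m b) 0 0 in bb0 *.
    (* With [a = 0] the form is affine in its first coordinate; this value solves 2 x be + ka =
       -1. *)
    have := quad (- ((b^T *m C *m b) 0 0 + 1) / (2 * be)) b.
    set ka := (b^T *m C *m b) 0 0; rewrite a0 mulr0 add0r.
    have -> : 2 * (- (ka + 1) / (2 * be)) * (b^T *m b) 0 0 + ka = -1.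
      by rewrite -/be; field.
    by rewrite oppr_ge0 ler10.
  have b0 : b = 0.
    apply/colP => i; rewrite mxE; apply/eqP; rewrite -sqrf_eq0.
    move: bb; rewrite mxE => /eqP; rewrite psumr_eq0 => [/allP/(_ i)|j _].
      by rewrite mem_index_enum mxE -expr2 => /(_ isT).
    by rewrite mxE -expr2 sqr_ge0.
  have [L' CE] : exists L : 'M[R]_N, C = L *m L^T.
    apply: IHN => [//|v]; have := quad 0 v; rewrite expr0n /= mul0r mulr0 mul0r !add0r //.
  exists (block_mx 0 0 0 L').
  by rewrite SE a0 b0 tr_block_mx mulmx_block !trmx0 !mul0mx !mulmx0 !addr0 add0r -CE raddf0.
have ap : 0 < a.
  rewrite lt_def a0 /=; have := quad 1 0; rewrite !mulmx0 !mxE expr1n mul1r mulr0 !addr0 //.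
have [L' CE] : exists L : 'M[R]_N, C - a^-1 *: (b *m b^T) = L *m L^T.
  apply: IHN => [|v]; first by rewrite linearB linearZ /= sC trmx_mul trmxK.
  (* The minimizer of the form in its first coordinate; the minimum is the Schur complement
     evaluated at [v]. *)
  have := quad (- a^-1 * (b^T *m v) 0 0) v.
  have vb : (v^T *m b) 0 0 = (b^T *m v) 0 0.
    by rewrite -[b in LHS]trmxK -trmx_mul mxE.
  have -> : (v^T *m (C - a^-1 *: (b *m b^T)) *m v) 0 0 =
      (v^T *m C *m v) 0 0 - a^-1 * (b^T *m v) 0 0 ^+ 2.
    have -> : v^T *m (C - a^-1 *: (b *m b^T)) *m v =
        v^T *m C *m v - a^-1 *: ((v^T *m b) *m (b^T *m v)).
      by rewrite mulmxBr mulmxBl -scalemxAr -scalemxAl !mulmxA.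
    rewrite mxE; congr (_ + _); rewrite mxE; congr (- _); rewrite mxE; congr (_ * _).
    by rewrite mxE big_ord1 vb expr2.
  set X := (b^T *m v) 0 0; set Y := (v^T *m C *m v) 0 0.
  by congr (0 <= _); field.
pose r := Num.sqrt a; have r0 : r != 0 by rewrite gt_eqF // sqrtr_gt0.
have r2 : r * r = a by rewrite -expr2 sqr_sqrtr // ltW.
exists (block_mx r%:M 0 (r^-1 *: b) L').
rewrite SE tr_block_mx mulmx_block !trmx0 !mulmx0 !mul0mx !addr0 tr_scalar_mx -CE.
congr block_mx.
- by rewrite -scalar_mxM r2.
- by rewrite linearZ /= mul_scalar_mx scalerA divff // scale1r.
- by rewrite mul_mx_scalar scalerA divff // scale1r.
- rewrite linearZ /= -scalemxAr -scalemxAl scalerA -invfM r2.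
  by rewrite addrC subrK.
Qed.

Lemma gaussian_vector N (S : 'M[R]_N) : S^T = S ->
  (forall c : 'cV[R]_N, 0 <= (c^T *m S *m c) 0 0) ->
  exists d (T : measurableType d) (P : probability T R) (xi : T -> 'cV[R]_N),
    random_mx xi /\ forall (t : 'cV[R]_N) c,
    \int[P]_w cos ((t^T *m xi w) 0 0 + c) =
      expR (- ((t^T *m S *m t) 0 0 / 2)) * cos c.
Proof.
move=> sS pS; have [L ->] := psd_factor sS pS.
have [d [T [P [g [mg Eg]]]]] := gaussian_iid N.
exists d, T, P, (fun w => L *m (\col_i g i w)); split.
  move=> i j; under eq_fun do rewrite mxE.
  by apply: measurable_sum => k; under eq_fun do rewrite mxE; exact: measurable_funM.
move=> t c; pose s : 'rV[R]_N := t^T *m L.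
rewrite (_ : (t^T *m (L *m L^T) *m t) 0 0 = \sum_i s 0 i ^+ 2); last first.
  rewrite mulmxA -mulmxA -/s (_ : L^T *m t = s^T) ?mxE.
    by apply: eq_bigr => i _; rewrite [s^T _ _]mxE expr2.
  by rewrite trmx_mul trmxK.
rewrite -(Eg (fun i => s 0 i) c); apply: eq_Rintegral => w _; congr (cos (_ + c)).
by rewrite mulmxA -/s [LHS]mxE; apply: eq_bigr => i _; rewrite [(\col__ _) _ _]mxE.
Qed.

End Gaussian.

(** * Independence *)

Lemma bigsetI_seqP (T : Type) (I : choiceType) (s : seq I) (A : I -> set T) w :
  (\big[setI/[set: T]]_(i <- s) A i) w <-> forall i, i \in s -> A i w.
Proof. by rewrite -bigcap_seq; split => H i; exact: H. Qed.

Section PiSystems.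
Context d (T : measurableType d) (R : realType) (P : probability T R).
Implicit Types (F G : set_system T).

Definition indep_sets F G := forall A B, F A -> G B -> P (A `&` B) = (P A * P B)%E.

(** For fixed [B], both A |-> P (A [&] B) and A |-> P A * P B are finite measures; they agree on the
    pi-system [F], hence on what it generates. *)
Lemma indep_generated1 F (B : set T) : F `<=` measurable -> setI_closed F ->
  F setT -> measurable B -> (forall A, F A -> P (A `&` B) = (P A * P B)%E) ->
  forall A, <<s F >> A -> P (A `&` B) = (P A * P B)%E.
Proof.
move=> Fm FI FT mB FB A FA.
have PB0 : 0 <= fine (P B) by rewrite fine_ge0.
have : mrestr P mB A = mscale (NngNum PB0) P A.
  apply: (g_sigma_algebra_measure_unique F Fm (fun=> setT)) => //.
  - by apply/seteqP; split => // w _; exists 0%N.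
  - move=> C FC; change (P (C `&` B) = (fine (P B))%:E * P C)%E.
    by rewrite FB // fineK ?fin_num_measure // muleC.
  - move=> _; change (P ([set: T] `&` B) < +oo)%E.
    by rewrite setTI (le_lt_trans (probability_le1 P mB)) ?ltry.
by rewrite /mrestr /mscale /= => ->; rewrite fineK ?fin_num_measure // muleC.
Qed.

Lemma indep_generated F G : F `<=` measurable -> setI_closed F -> F setT ->
  G `<=` measurable -> setI_closed G -> G setT ->
  indep_sets F G -> indep_sets <<s F >> <<s G >>.
Proof.
move=> Fm FI FT Gm GI GT FG A B FA GB.
have sGm := smallest_sub (@sigma_algebra_measurable _ T) Gm.
apply: (indep_generated1 Fm FI FT (sGm _ GB) _ FA) => C FC.
rewrite setIC muleC; apply: (indep_generated1 Gm GI GT (Fm _ FC) _ GB) => D GD.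
by rewrite setIC muleC; exact: FG.
Qed.

Variables (I : choiceType) (F : I -> set_system T).
Hypothesis Fm : forall i, F i `<=` measurable.
Hypothesis Fs : forall i, sigma_algebra [set: T] (F i).

(** A pi-system generating the join of the [F i] with [i] in [J]. [undup] matches the duplicate-free
    lists of [mutually_independent]; [B] is total, which costs nothing as each [F i] contains the
    full set. *)
Definition cylinders (J : set I) : set_system T := [set A | exists s B,
  [/\ forall i, i \in s -> J i, forall i, F i (B i) &
      A = \big[setI/[set: T]]_(i <- undup s) B i]].

Let FT i : F i setT.
Proof. by have [] := Fs i => H1 H2 _; rewrite -(setD0 [set: T]); exact: H2. Qed.

Let FI i A B : F i A -> F i B -> F i (A `&` B).
Proof.
have -> : F i = <<s F i >> by rewrite sigma_algebra_id.
exact: (@measurableI _ (g_sigma_algebraType (F i))).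
Qed.

Lemma cylinders_measurable J : cylinders J `<=` measurable.
Proof.
by move=> _ [s [B [_ FB ->]]]; apply: bigsetI_measurable => i _; exact: Fm.
Qed.

Lemma cylinders_setI J : setI_closed (cylinders J).
Proof.
move=> _ _ [s [B [sJ FB ->]]] [s' [B' [sJ' FB' ->]]].
exists (s ++ s'), (fun i => (if i \in s then B i else setT) `&`
  (if i \in s' then B' i else setT)); split.
- by move=> i; rewrite mem_cat => /orP[/sJ|/sJ'].
- by move=> i; apply: FI; case: ifP => _.
- apply/seteqP; split => w.
  + move=> [/bigsetI_seqP H /bigsetI_seqP H']; apply/bigsetI_seqP => i.
    rewrite mem_undup => _; split; case: ifPn => // i_s.
      by apply: H; rewrite mem_undup.
    by apply: H'; rewrite mem_undup.
  + move=> /bigsetI_seqP H; split; apply/bigsetI_seqP => i; rewrite mem_undup => i_s.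
      by have := H i; rewrite mem_undup mem_cat i_s => /(_ isT)[].
    by have := H i; rewrite mem_undup mem_cat i_s orbT => /(_ isT)[].
Qed.

Lemma cylinders_setT J : cylinders J setT.
Proof. by exists [::], (fun=> setT); split => //; rewrite big_nil. Qed.

Lemma cylinders1 (J : set I) i A : J i -> F i A -> cylinders J A.
Proof.
move=> Ji FA; exists [:: i], (fun j => if j == i then A else setT); split.
- by move=> j; rewrite inE => /eqP->.
- by move=> j; case: eqP => [->|_].
- by rewrite /= big_seq1 eqxx.
Qed.

(** As [J] and [J'] are disjoint, [B] and [B'] merge into one choice [C] of events and the two lists
    concatenate without repetition, so the product rule can be split between them. *)
Lemma indep_cylinders (J J' : set I) : mutually_independent P F ->
  J `&` J' = set0 -> indep_sets (cylinders J) (cylinders J').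
Proof.
move=> mF JJ' _ _ [s [B [sJ FB ->]]] [s' [B' [sJ' FB' ->]]].
have disj i : i \in s -> i \in s' -> False.
  move=> /sJ Ji /sJ' J'i; have : (J `&` J') i by [].
  by rewrite JJ'.
pose C i := if i \in s then B i else B' i.
have FC i : F i (C i) by rewrite /C; case: ifP.
have EC : \big[setI/[set: T]]_(i <- undup s) B i = \big[setI/[set: T]]_(i <- undup s) C i.
  by apply: eq_big_seq => i; rewrite mem_undup /C => ->.
have EC' : \big[setI/[set: T]]_(i <- undup s') B' i = \big[setI/[set: T]]_(i <- undup s') C i.
  apply: eq_big_seq => i; rewrite mem_undup /C => i_s'; case: ifPn => // i_s.
  by case: (disj i).
rewrite EC EC' -big_cat /= mF //; first by rewrite big_cat /= -!mF ?undup_uniq.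
rewrite cat_uniq !undup_uniq /= andbT; apply/hasPn => i; rewrite !mem_undup => i_s'.
by apply/negP => i_s; case: (disj i).
Qed.

End PiSystems.

(** * Expectations of products of independent variables *)

Section IndependentFunctions.
Context d (T : measurableType d) (R : realType) (P : probability T R).
Implicit Types (X Y : T -> R).

Definition indep_fun X Y := forall A B, measurable A -> measurable B ->
  P (X @^-1` A `&` Y @^-1` B) = (P (X @^-1` A) * P (Y @^-1` B))%E.

Lemma indep_fun_comp X Y (f g : R -> R) : measurable_fun [set: R] f ->
  measurable_fun [set: R] g -> indep_fun X Y ->
  indep_fun (fun w => f (X w)) (fun w => g (Y w)).
Proof.
move=> mf mg XY A B mA mB; apply: (XY (f @^-1` A) (g @^-1` B)).
  by rewrite -[X in measurable X]setTI; exact: mf.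
by rewrite -[X in measurable X]setTI; exact: mg.
Qed.

Variables (X Y : T -> R).
Hypotheses (iX : L1 P X) (iY : L1 P Y) (XY : indep_fun X Y).

Let mX := L1_measurable iX.
Let mY := L1_measurable iY.
Let mXY : measurable_fun [set: T] (fun w => (X w, Y w)).
Proof. exact: measurable_fun_pair. Qed.
Let RX := rv_of P mX.
Let RY := rv_of P mY.
Let RXY : {RV P >-> (R * R)%type} :=
  HB.pack (fun w => (X w, Y w)) (isMeasurableFun.Build _ _ _ _ (fun w => (X w, Y w)) mXY).

(** On rectangles this is [XY], and a product measure is determined by its values on rectangles.
    Fubini's theorem then yields both integrability and expectation of the product. *)
Let lawE (S : set (R * R)) : measurable S ->
  (distribution P RX \x distribution P RY)%E S = distribution P RXY S.
Proof.
move=> mS; apply: product_measure_unique => //.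
Qed.

Let mf : measurable_fun [set: R * R] (fun z : R * R => (z.1 * z.2)%:E).
Proof.
apply/measurable_EFinP; apply: measurable_funM; [exact: measurable_fst|exact: measurable_snd].
Qed.

Let integrable_prod :
  ((distribution P RX \x distribution P RY)%E).-integrable [set: R * R]
    (fun z => (z.1 * z.2)%:E).
Proof.
apply: (proj2 (@integrable12ltyP _ _ _ _ _ (distribution P RX) (distribution P RY) _ mf)) => /=.
have nY : (\int[distribution P RY]_y `|y%:E| = (\int[P]_w `|Y w|)%:E)%E.
  rewrite (ge0_integral_distribution RY (f := fun y => `|y%:E|%E)) //; last first.
    exact/measurableT_comp.
  by rewrite -EFin_E; [|exact: L1_norm].
under eq_integral => x _.
  under eq_integral => y _ do rewrite normrM EFinM.
  rewrite ge0_integralZl //=; last first.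
    by apply/measurable_EFinP; exact: normr_measurable.
  rewrite nY -EFinM; over.
rewrite (ge0_integral_distribution RX (f := fun x => (`|x| * \int[P]_w `|Y w|)%:E)); first last.
- by move=> x; rewrite lee_fin mulr_ge0 // E_ge0.
- by apply/measurable_EFinP; apply: measurable_funM => //; exact: measurableT_comp.
have := L1Z (\int[P]_w `|Y w|) (L1_norm iX).
under eq_fun do rewrite mulrC.
by move=> /EFin_E /= ->; rewrite ltry.
Qed.

Lemma indep_L1M : L1 P (fun w => X w * Y w).
Proof.
apply/integrableP; split.
  by apply/measurable_EFinP; exact: measurable_funM.
have /integrableP[_] := integrable_prod.
rewrite (eq_measure_integral (distribution P RXY)); last first.
  by move=> S mS _; exact: lawE.
rewrite (ge0_integral_distribution RXY) //.
by apply: measurableT_comp => //; exact: mf.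
Qed.

Lemma indep_EM : \int[P]_w (X w * Y w) = (\int[P]_w X w) * \int[P]_w Y w.
Proof.
apply: EFin_inj; rewrite -EFin_E; last exact: indep_L1M.
rewrite -(integral_distribution (X := RXY) (f := fun z => (z.1 * z.2)%:E)) //; last first.
  exact: indep_L1M.
rewrite -(eq_measure_integral (distribution P RXY) (fun S mS _ => lawE mS)).
rewrite -(integral12_prod_meas1 integrable_prod).
have EY : (\int[distribution P RY]_y y%:E = (\int[P]_w Y w)%:E)%E.
  rewrite -EFin_E //.
  exact: (integral_distribution (X := RY) (f := EFin) (@EFin_measurable _ _) iY).
have EX : (\int[distribution P RX]_x x%:E = (\int[P]_w X w)%:E)%E.
  rewrite -EFin_E //.
  exact: (integral_distribution (X := RX) (f := EFin) (@EFin_measurable _ _) iX).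
have iRY : (distribution P RY).-integrable [set: R] EFin.
  apply/integrableP; split => //.
  rewrite (ge0_integral_distribution RY (f := fun y => `|y%:E|%E)) //; last first.
    exact/measurableT_comp.
  by have /integrableP[] := iY.
have iRX : (distribution P RX).-integrable [set: R] EFin.
  apply/integrableP; split => //.
  rewrite (ge0_integral_distribution RX (f := fun y => `|y%:E|%E)) //; last first.
    exact/measurableT_comp.
  by have /integrableP[] := iX.
under eq_integral => x _.
  rewrite /fubini_F /=; under eq_integral => y _ do rewrite EFinM.
  rewrite integralZl // EY muleC; over.
by rewrite integralZl // EX -EFinM mulrC.
Qed.

End IndependentFunctions.

Section GeneratedFunctions.
Context d (T : measurableType d) (R : realType) (P : probability T R).
Variables (I : choiceType) (F : I -> set_system T).
Hypothesis Fm : forall i, F i `<=` measurable.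
Hypothesis Fs : forall i, sigma_algebra [set: T] (F i).

(** Measurability for the generated sigma-algebra is phrased through its [measurableType], so that
    closure under sums and products comes from the general lemmas on measurable functions. *)
Definition fun_of_family (J : set I) (X : T -> R) :=
  measurable_fun [set: g_sigma_algebraType (cylinders F J)] X.

Lemma fun_of_family_indep (J J' : set I) X Y : mutually_independent P F ->
  J `&` J' = set0 -> fun_of_family J X -> fun_of_family J' Y -> indep_fun P X Y.
Proof.
move=> mF JJ' mX mY A B mA mB.
have H : indep_sets P <<s cylinders F J >> <<s cylinders F J' >>.
  by apply: indep_generated; [exact: cylinders_measurable|exact: cylinders_setI|
    exact: cylinders_setT|exact: cylinders_measurable|exact: cylinders_setI|
    exact: cylinders_setT|exact: indep_cylinders].
apply: H.
- by have := mX measurableT A mA; rewrite setTI.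
- by have := mY measurableT B mB; rewrite setTI.
Qed.

Lemma fun_of_family1 (J : set I) i X : J i ->
  (forall A, measurable A -> F i (X @^-1` A)) -> fun_of_family J X.
Proof.
move=> Ji FX _ A mA; rewrite setTI; apply: sub_sigma_algebra.
by apply: (cylinders1 Fs Ji); exact: FX.
Qed.

Lemma fun_of_familyW (J J' : set I) X : J `<=` J' -> fun_of_family J X ->
  fun_of_family J' X.
Proof.
move=> JJ' mX _ A mA.
have sub : cylinders F J `<=` cylinders F J'.
  by move=> C [s [B [sJ FB ->]]]; exists s, B; split => // i /sJ /JJ'.
exact: (sub_sigma_algebra2 sub (mX measurableT A mA)).
Qed.

End GeneratedFunctions.

Section SigmaOf.
Context d (T : measurableType d) (R : realType).

Lemma sigma_of_algebra (I : Type) (Y : I -> T -> R) :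
  sigma_algebra [set: T] (sigma_of Y).
Proof. exact: smallest_sigma_algebra. Qed.

Lemma sigma_of_measurable (I : Type) (Y : I -> T -> R) :
  (forall i, measurable_fun [set: T] (Y i)) -> sigma_of Y `<=` measurable.
Proof.
move=> mY; apply: smallest_sub; first exact: sigma_algebra_measurable.
by move=> _ [i _ [A mA <-]]; exact: mY.
Qed.

Lemma sigma_of_preimage (I : Type) (Y : I -> T -> R) i A : measurable A ->
  sigma_of Y (Y i @^-1` A).
Proof.
move=> mA; apply: sub_sigma_algebra; exists i => //; exists A => //.
by rewrite setTI.
Qed.

Lemma sigma_of_sub (I I' : Type) (Y : I -> T -> R) (f : I' -> I) :
  sigma_of (fun i => Y (f i)) `<=` sigma_of Y.
Proof.
apply: sub_sigma_algebra2 => _ [i _ [A mA <-]].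
by exists (f i) => //; exists A.
Qed.

Lemma sigma_of_bigsetI (I : Type) (Y : I -> T -> R) (J : eqType) (s : seq J)
  (A : J -> set T) : (forall j, j \in s -> sigma_of Y (A j)) ->
  sigma_of Y (\big[setI/[set: T]]_(j <- s) A j).
Proof.
move=> YA; rewrite big_seq.
exact: (@bigsetI_measurable _ (g_sigma_algebraType (\bigcup_i preimage_set_system [set: T]
  (Y i) measurable))).
Qed.

End SigmaOf.

(** * The central limit theorem under Lindeberg's condition *)

Section TaylorBounds.
Context {R : realType}.
Implicit Types (x y z : R).

(* Bounds the Taylor remainders of sin z and cos z for all z, so Lindeberg's
   condition can be stated without truncation, as sum_k E lind (z_nk) -> 0. *)
Definition lind z : R := Num.min (z ^+ 2) (`|z| ^+ 3).

(** Turns an inequality between derivatives into one between functions. Starting from cos <= 1, the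
    bounds [sin_le], [cos_ge], [sin_ge] and [cos_le] each integrate the preceding one. *)
Lemma derive_ge0_le (F f : R -> R) : (forall x, is_derive x (1 : R) F (f x)) ->
  (forall x, 0 <= x -> 0 <= f x) -> forall x, 0 <= x -> F 0 <= F x.
Proof.
move=> dF f0 x; rewrite le_eqVlt => /predU1P[<-//|x0].
have cF : {within `[0, x], continuous F}.
  apply: continuous_subspaceT => y; apply/differentiable_continuous/derivable1_diffP.
  by case: (dF y).
have [c] := @MVT _ F f _ _ x0 (fun y _ => dF y) cF.
rewrite in_itv /= => /andP[c0 _]; rewrite subr0 => FE.
rewrite -subr_ge0 FE; apply: mulr_ge0; last exact: ltW.
by apply: f0; exact: ltW.
Qed.

Lemma sin_le x : 0 <= x -> sin x <= x.
Proof.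
move=> x0; have := @derive_ge0_le (fun y => y + - 1 * sin y) (fun y => 1 - cos y) _ _ _ x0.
rewrite sin0 mulr0 addr0 mulN1r subr_ge0; apply => [y|y _].
  apply: (is_derive_eq (is_deriveD_fun (is_derive_id y 1)
    (is_deriveM_fun (is_derive_cst (- 1 : R) y 1) (is_derive_sin y)))).
  by rewrite /cst; ring.
by rewrite subr_ge0 cos_le1.
Qed.

Let dpow2 y : is_derive y (1 : R) (fun y => y * y) (2 * y).
Proof.
apply: (is_derive_eq (is_deriveM_fun (is_derive_id y 1) (is_derive_id y 1))).
by ring.
Qed.

Let dpow3 y : is_derive y (1 : R) (fun y => y * y * y) (3 * (y * y)).
Proof.
apply: (is_derive_eq (is_deriveM_fun (dpow2 y) (is_derive_id y 1))).
by ring.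
Qed.

Let dpow4 y : is_derive y (1 : R) (fun y => y * y * y * y) (4 * (y * y * y)).
Proof.
apply: (is_derive_eq (is_deriveM_fun (dpow3 y) (is_derive_id y 1))).
by ring.
Qed.

Lemma cos_ge x : 0 <= x -> 1 - x * x / 2 <= cos x.
Proof.
move=> x0; have := @derive_ge0_le (fun y => cos y + 2^-1 * (y * y)) (fun y => y - sin y) _ _ _ x0.
rewrite cos0 mulr0 mulr0 addr0 -lerBlDr [2^-1 * _]mulrC; apply => [y|y y0].
  apply: (is_derive_eq (is_deriveD_fun (is_derive_cos y)
    (is_deriveM_fun (is_derive_cst (2^-1 : R) y 1) (dpow2 y)))).
  by rewrite /cst; field.
by rewrite subr_ge0 sin_le.
Qed.

Lemma sin_ge x : 0 <= x -> x - x * x * x / 6 <= sin x.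
Proof.
move=> x0; have := @derive_ge0_le (fun y => sin y + (6^-1 * (y * y * y) + - 1 * y))
  (fun y => cos y - (1 - y * y / 2)) _ _ _ x0.
rewrite sin0 !mulr0 !addr0 => H.
suff : 0 <= sin x + (6^-1 * (x * x * x) + - 1 * x) by lra.
apply: H => [y|y y0].
  apply: (is_derive_eq (is_deriveD_fun (is_derive_sin y) (is_deriveD_fun
    (is_deriveM_fun (is_derive_cst (6^-1 : R) y 1) (dpow3 y))
    (is_deriveM_fun (is_derive_cst (- 1 : R) y 1) (is_derive_id y 1))))).
  by rewrite /cst; field.
by rewrite subr_ge0 cos_ge.
Qed.

Lemma cos_le x : 0 <= x -> cos x <= 1 - x * x / 2 + x * x * x * x / 24.
Proof.
move=> x0; have := @derive_ge0_le
  (fun y => - 1 * cos y + (- 2^-1 * (y * y) + 24^-1 * (y * y * y * y)))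
  (fun y => sin y - (y - y * y * y / 6)) _ _ _ x0.
rewrite cos0 !mulr0 !addr0 mulr1 => H.
suff : -1 <= - 1 * cos x + (- 2^-1 * (x * x) + 24^-1 * (x * x * x * x)) by lra.
apply: H => [y|y y0].
  apply: (is_derive_eq (is_deriveD_fun
    (is_deriveM_fun (is_derive_cst (- 1 : R) y 1) (is_derive_cos y)) (is_deriveD_fun
    (is_deriveM_fun (is_derive_cst (- 2^-1 : R) y 1) (dpow2 y))
    (is_deriveM_fun (is_derive_cst (24^-1 : R) y 1) (dpow4 y))))).
  by rewrite /cst; field.
by rewrite subr_ge0 sin_ge.
Qed.

Lemma lind_ge0 z : 0 <= lind z.
Proof. by rewrite /lind le_min sqr_ge0 exprn_ge0. Qed.

Lemma lind_norm z : lind `|z| = lind z.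
Proof. by rewrite /lind normr_id -normrX ger0_norm ?sqr_ge0. Qed.

Lemma lind_le1 z : `|z| <= 1 -> lind z = `|z| ^+ 3.
Proof.
move=> z1; rewrite /lind min_r // -(real_normK (num_real z)).
by rewrite exprSr ler_piMr ?exprn_ge0.
Qed.

Lemma lind_ge1 z : 1 <= `|z| -> lind z = z ^+ 2.
Proof.
move=> z1; rewrite /lind min_l // -(real_normK (num_real z)).
by rewrite [leRHS]exprSr ler_peMr ?exprn_ge0.
Qed.

Lemma lind_le_sqr z : lind z <= z ^+ 2.
Proof. by rewrite /lind ge_min lexx. Qed.

Lemma lind_le_cube z : lind z <= `|z| ^+ 3.
Proof. by rewrite /lind ge_min lexx orbT. Qed.

Lemma lind_mono y z : `|y| <= `|z| -> lind y <= lind z.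
Proof.
move=> yz; rewrite /lind le_min !ge_min -(real_normK (num_real y)) -(real_normK (num_real z)).
by rewrite !lerXn2r ?nnegrE ?orbT.
Qed.

Lemma lindM (c : R) z : 1 <= c -> lind (c * z) <= c ^+ 3 * lind z.
Proof.
move=> c1; have c0 : 0 <= c by lra.
rewrite /lind minr_pMr ?exprn_ge0 // le_min !ge_min.
rewrite exprMn normrM (ger0_norm c0) exprMn lexx orbT andbT.
by rewrite ler_wpM2r ?sqr_ge0 // [leRHS]exprS ler_peMl // exprn_ge0.
Qed.

(** |y + z| is at most twice the larger of |y| and |z|, and a factor 2 costs 2^3 = 8 by [lindM]. *)
Lemma lindD y z : lind (y + z) <= 8 * (lind y + lind z).
Proof.
have h (a b : R) : `|a| <= `|b| -> lind (a + b) <= 8 * (lind a + lind b).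
  move=> ab; apply: (@le_trans _ _ (lind (2 * b))).
    apply: lind_mono; rewrite normrM [ `|2|]ger0_norm // mulr_natl mulr2n.
    by rewrite (le_trans (ler_normD _ _)) // lerD2r.
  rewrite (le_trans (lindM _ _)) ?ler1n // (_ : 2 ^+ 3 = 8 :> R); last by ring.
  by rewrite ler_pM2l // lerDr lind_ge0.
have [yz|zy] := leP `|y| `|z|; first exact: h.
by rewrite addrC [lind y + _]addrC; apply: h; exact: ltW.
Qed.

Lemma cos_taylor z : `|cos z - 1 + z ^+ 2 / 2| <= lind z.
Proof.
wlog z0 : z / 0 <= z => [H|].
  by rewrite -lind_norm -(cos_norm z) -(real_normK (num_real z)); exact: H.
have h1 := cos_ge z0; have h2 := cos_le z0; have h3 := cos_le1 z.
rewrite ger0_norm; last by rewrite expr2; lra.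
have [z1|z1] := leP z 1.
  rewrite lind_le1 ?ger0_norm //.
  have : z * z * z * z <= z ^+ 3.
    by rewrite (_ : z ^+ 3 = z * z * z); [rewrite ler_piMr // !mulr_ge0|ring].
  have : 0 <= z ^+ 3 by exact: exprn_ge0.
  by rewrite expr2; lra.
by rewrite lind_ge1 ?ger0_norm ?(ltW z1) //; have := sqr_ge0 z; lra.
Qed.

(** The factor 2 is spent beyond 1, where only z - sin z <= z + 1 <= 2 z^2 is used. *)
Lemma sin_taylor z : `|sin z - z| <= 2 * lind z.
Proof.
wlog z0 : z / 0 <= z => [H|].
  have [|z0] := leP 0 z; first exact: H.
  have := H (- z); rewrite oppr_ge0 (ltW z0) => /(_ isT).
  by rewrite sinN opprK addrC distrC -lind_norm normrN lind_norm.
have h1 := sin_le z0; have h2 := sin_ge z0; have h3 := sin_geN1 z.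
rewrite ler0_norm; last by lra.
have [z1|z1] := leP z 1.
  rewrite lind_le1 ?ger0_norm //.
  have : 0 <= z ^+ 3 by exact: exprn_ge0.
  by rewrite (_ : z ^+ 3 = z * z * z); [lra|ring].
rewrite lind_ge1 ?ger0_norm ?(ltW z1) //; nra.
Qed.

Lemma expRN_taylor y : 0 <= y -> `|expR (- y) - 1 + y| <= y ^+ 2.
Proof.
move=> y0; have h1 := expR_ge1Dx (- y); have h2 := expR_ge1Dx y.
rewrite ger0_norm; last by lra.
suff : expR (- y) <= 1 - y + y ^+ 2 by lra.
rewrite expRN -[leLHS]mul1r ler_pdivrMr ?expR_gt0 //.
have h3 : 0 <= 1 - y + y ^+ 2 by nra.
(* exp (- y) <= 1 / (1 + y), and (1 - y + y^2) (1 + y) = 1 + y^3 >= 1. *)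
apply: (@le_trans _ _ ((1 - y + y ^+ 2) * (1 + y))); last by rewrite ler_wpM2l.
have := mulr_ge0 (mulr_ge0 y0 y0) y0; rewrite expr2; nra.
Qed.

(** Split at |z| = e: above it, e z^2 <= lind z. Integrated, this shows that under Lindeberg's
    condition the individual variances are uniformly small. *)
Lemma sqr_le_lind (e z : R) : 0 < e -> e <= 1 -> z ^+ 2 <= e ^+ 2 + e^-1 * lind z.
Proof.
move=> e0 e1; rewrite -lind_norm -(real_normK (num_real z)).
move: (normr_ge0 z); move: `|z| => {}z z0.
have [ze|ez] := leP z e.
  by rewrite ler_wpDr ?mulr_ge0 ?invr_ge0 ?lind_ge0 ?(ltW e0) // lerXn2r ?nnegrE // ltW.
rewrite ler_wpDl ?sqr_ge0 // mulrC ler_pdivlMr //.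
have [z1|z1] := leP z 1.
  by rewrite lind_le1 ?ger0_norm // [leRHS]exprSr ler_wpM2l ?sqr_ge0 // ltW.
by rewrite lind_ge1 ?ger0_norm ?(ltW z1) // ler_piMr ?sqr_ge0.
Qed.

Lemma measurable_lind : measurable_fun [set: R] lind.
Proof.
apply: measurable_minr; first exact: measurable_funX.
by apply: measurable_funX; exact: normr_measurable.
Qed.

End TaylorBounds.

(** * Lindeberg's replacement argument for one row of the array *)

Section RowSum.
Context d (T : measurableType d) (R : realType) (P : probability T R).
Variable z : nat -> T -> R.
Hypotheses (mz : forall k, measurable_fun [set: T] (z k))
  (iz2 : forall k, L1 P (fun w => z k w ^+ 2))
  (Ez : forall k, \int[P]_w z k w = 0)
  (ind : forall k, indep_fun P (fun w => \sum_(j < k) z j w) (z k)).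

Lemma L1_of_sqr (Y : T -> R) : measurable_fun [set: T] Y ->
  L1 P (fun w => Y w ^+ 2) -> L1 P Y.
Proof.
move=> mY iY; apply: (L1_le mY (L1D (L1_cst P 1) iY)) => w.
rewrite -(real_normK (num_real (Y w))); have := normr_ge0 (Y w).
by move: `|Y w| => y y0; nra.
Qed.

Lemma L1_lind (Y : T -> R) : measurable_fun [set: T] Y ->
  L1 P (fun w => Y w ^+ 2) -> L1 P (fun w => lind (Y w)).
Proof.
move=> mY iY; apply: (L1_le _ iY).
  by apply: measurableT_comp => //; exact: measurable_lind.
by move=> w; rewrite ger0_norm ?lind_ge0 // lind_le_sqr.
Qed.

Lemma L1_lindZ (Y : T -> R) r : measurable_fun [set: T] Y ->
  L1 P (fun w => Y w ^+ 2) -> L1 P (fun w => lind (r * Y w)).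
Proof.
move=> mY iY; apply: L1_lind; first exact: measurable_funM.
by under eq_fun do rewrite exprMn; exact: L1Z.
Qed.

Let S k w := \sum_(j < k) z j w.
Let v k := \int[P]_w (z k w ^+ 2).

Let mS k : measurable_fun [set: T] (S k).
Proof. by apply: measurable_sum => j; exact: mz. Qed.

Lemma sum_sqr_L1 n : L1 P (fun w => S n w ^+ 2).
Proof.
elim: n => [|n IHn].
  under eq_fun do rewrite /S big_ord0 expr0n /=; exact: L1_cst.
apply: (L1_le _ (L1D (L1Z 2 IHn) (L1Z 2 (iz2 n)))).
  exact: measurable_funX.
move=> w; rewrite ger0_norm ?sqr_ge0 // /S big_ord_recr /=.
move: (\sum_(j < n) _) (z n w) => a b.
by have := sqr_ge0 (a - b); rewrite sqrrB sqrrD; lra.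
Qed.

Lemma E_sum_sqr n : \int[P]_w (S n w ^+ 2) = \sum_(k < n) v k.
Proof.
elim: n => [|n IHn].
  by under eq_Rintegral do rewrite /S big_ord0 expr0n /=; rewrite Ecst big_ord0.
have iS := L1_of_sqr (mS n) (sum_sqr_L1 n).
have iz := L1_of_sqr (mz n) (iz2 n).
have iSz := indep_L1M iS iz (@ind n).
rewrite big_ord_recr /= -IHn.
transitivity (\int[P]_w ((S n w ^+ 2 + 2 * (S n w * z n w)) + z n w ^+ 2)).
  by apply: eq_Rintegral => w _; rewrite /S big_ord_recr /=; ring.
rewrite ED //; last by apply: L1D; [exact: sum_sqr_L1|exact: L1Z].
rewrite ED //; [|exact: sum_sqr_L1|exact: L1Z].
by rewrite EZ // (indep_EM iS iz (@ind n)) Ez mulr0 mulr0 addr0.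
Qed.

Let v_ge0 k : 0 <= v k.
Proof. by apply: E_ge0 => w; exact: sqr_ge0. Qed.

(* Replacing z_k by its Gaussian counterpart only multiplies the transform of
   the partial sum by expR (- v_k / 2), so the telescoping of [E_cos_sum] needs
   no auxiliary normal variables. *)
Lemma E_cos_step k c :
  `|\int[P]_w cos (S k w + z k w + c) - expR (- (v k / 2)) * \int[P]_w cos (S k w + c)|
  <= 3 * (\int[P]_w lind (z k w)) + v k ^+ 2 / 4.
Proof.
have iz := L1_of_sqr (mz k) (iz2 k).
have il := L1_lind (mz k) (iz2 k).
have msin (Y : T -> R) : measurable_fun [set: T] Y -> measurable_fun [set: T] (fun w => sin (Y w)).
  move=> mY; apply: measurableT_comp => //.
  by apply: continuous_measurable_fun; exact: continuous_sin.
have isin (Y : T -> R) : measurable_fun [set: T] Y -> L1 P (fun w => sin (Y w)).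
  by move=> mY; apply: (@L1_bounded _ _ _ P _ 1) => [|w]; [exact: msin|exact: sin_max].
have mSc : measurable_fun [set: T] (fun w => S k w + c) by exact: measurable_funD.
have mR (f : R -> R) : continuous f -> measurable_fun [set: R] (fun x : R => f (x + c)).
  move=> cf; apply: measurableT_comp; first exact: continuous_measurable_fun.
  exact: measurable_funD.
have mR0 (f : R -> R) : continuous f -> measurable_fun [set: R] f.
  exact: continuous_measurable_fun.
have icc := indep_fun_comp (mR _ (@continuous_cos R)) (mR0 _ (@continuous_cos R)) (@ind k).
have iss := indep_fun_comp (mR _ (@continuous_sin R)) (mR0 _ (@continuous_sin R)) (@ind k).
have icS := L1_cos P mSc; have icz := L1_cos P (mz k).
have isS := isin _ mSc; have isz := isin _ (mz k).
have -> : \int[P]_w cos (S k w + z k w + c) =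
    (\int[P]_w cos (S k w + c)) * (\int[P]_w cos (z k w)) -
    (\int[P]_w sin (S k w + c)) * (\int[P]_w sin (z k w)).
  rewrite -(indep_EM icS icz icc) -(indep_EM isS isz iss) -EB.
  - by apply: eq_Rintegral => w _; rewrite addrAC cosD.
  - exact: (indep_L1M icS icz icc).
  - exact: (indep_L1M isS isz iss).
have bc : `|\int[P]_w cos (S k w + c)| <= 1.
  rewrite -[leRHS](Ecst P 1); apply: E_norm_le; [exact: measurable_cos_fun|exact: L1_cst|].
  by move=> w; exact: cos_max.
have bs : `|\int[P]_w sin (S k w + c)| <= 1.
  rewrite -[leRHS](Ecst P 1); apply: E_norm_le; [exact: msin|exact: L1_cst|].
  by move=> w; exact: sin_max.
have hc : `|\int[P]_w cos (z k w) - 1 + v k / 2| <= \int[P]_w lind (z k w).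
  have -> : \int[P]_w cos (z k w) - 1 + v k / 2 =
      \int[P]_w (cos (z k w) - 1 + 2^-1 * z k w ^+ 2).
    rewrite ED; [|by apply: L1B => //; exact: L1_cst|exact: L1Z].
    rewrite EB //; last exact: L1_cst.
    by rewrite Ecst EZ // [2^-1 * _]mulrC.
  apply: E_norm_le => //.
    apply: measurable_funD; first by apply: measurable_funB => //; exact: measurable_cos_fun.
    by apply: measurable_funM => //; exact: measurable_funX.
  by move=> w; rewrite [2^-1 * _]mulrC; exact: cos_taylor.
have hs : `|\int[P]_w sin (z k w)| <= 2 * \int[P]_w lind (z k w).
  have -> : \int[P]_w sin (z k w) = \int[P]_w (sin (z k w) - z k w).
    by rewrite EB // Ez subr0.
  rewrite -EZ //; apply: E_norm_le.
  - by apply: measurable_funB => //; exact: msin.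
  - exact: L1Z.
  - by move=> w; exact: sin_taylor.
have he := @expRN_taylor R (v k / 2) (divr_ge0 (v_ge0 k) (ler0n _ 2)).
move: bc bs hc hs he.
move: (\int[P]_w cos (S k w + c)) (\int[P]_w sin (S k w + c)) => a b.
move: (\int[P]_w cos (z k w)) (\int[P]_w sin (z k w)) (\int[P]_w lind (z k w)) => x y l.
move: (expR _) => e ha hb hx hy he.
(* The Taylor errors of the cosine, of the exponential and of the sine. The first and last give 1 +
   2 = 3 times [l], the second gives (v k / 2)^2. *)
have -> : a * x - b * y - e * a = a * (x - 1 + v k / 2) - a * (e - 1 + v k / 2) - b * y by ring.
rewrite (le_trans (ler_normB _ _)) // (le_trans (lerD (ler_normB _ _) (lexx _))) // !normrM.
have h1 : `|a| * `|x - 1 + v k / 2| <= l by rewrite -[leRHS]mul1r ler_pM.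
have h2 : `|a| * `|e - 1 + v k / 2| <= (v k / 2) ^+ 2 by rewrite -[leRHS]mul1r ler_pM.
have h3 : `|b| * `|y| <= 2 * l by rewrite -[leRHS]mul1r ler_pM.
have -> : v k ^+ 2 / 4 = (v k / 2) ^+ 2 by field.
by lra.
Qed.

(** The errors of [E_cos_step] simply add up: passing from [n] to [n.+1] multiplies the accumulated
    error by expR (- v_n / 2) <= 1. *)
Lemma E_cos_sum n c :
  `|\int[P]_w cos (S n w + c) - expR (- ((\sum_(k < n) v k) / 2)) * cos c| <=
  \sum_(k < n) (3 * (\int[P]_w lind (z k w)) + v k ^+ 2 / 4).
Proof.
elim: n => [|n IHn].
  under eq_Rintegral do rewrite /S big_ord0 add0r.
  by rewrite Ecst !big_ord0 mul0r oppr0 expR0 mul1r subrr normr0.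
rewrite !big_ord_recr /= mulrDl opprD expRD.
under eq_Rintegral do rewrite /S big_ord_recr /= -/(S n _).
have H := E_cos_step n c.
set A := expR (- ((\sum_(k < n) v k) / 2)) in IHn *; set e := expR (- (v n / 2)) in H *.
set x := \int[P]_w _ in H *; set y := \int[P]_w _ in H IHn.
have -> : x - A * e * cos c = (x - e * y) + e * (y - A * cos c) by ring.
rewrite (le_trans (ler_normD _ _)) // addrC lerD // normrM.
rewrite -[leRHS]mul1r ler_pM // ger0_norm ?expR_ge0 // -expR0 ler_expR.
by rewrite oppr_le0 divr_ge0.
Qed.

End RowSum.

Section TriangularArray.
Context d (T : measurableType d) (R : realType) (P : probability T R).
Variables (z : nat -> nat -> T -> R) (s : R).
Hypotheses (mz : forall n k, measurable_fun [set: T] (z n k))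
  (iz2 : forall n k, L1 P (fun w => z n k w ^+ 2))
  (Ez : forall n k, \int[P]_w z n k w = 0)
  (ind : forall n k, indep_fun P (fun w => \sum_(j < k) z n j w) (z n k)).
Let v n k := \int[P]_w (z n k w ^+ 2).
Hypothesis cvg_var : \sum_(k < n) v n k @[n --> \oo] --> s.
Hypothesis lindeberg : \sum_(k < n) \int[P]_w lind (z n k w) @[n --> \oo] --> 0.

Lemma lindeberg_clt c :
  (\int[P]_w cos (\sum_(k < n) z n k w + c)) @[n --> \oo] -->
  expR (- (s / 2)) * cos c.
Proof.
have v0 n k : 0 <= v n k by apply: E_ge0 => w; exact: sqr_ge0.
have s0 : 0 <= s.
  rewrite -(cvg_lim _ cvg_var) //; apply: limr_ge; first exact: cvgP cvg_var.
  by apply: nearW => n; exact: sumr_ge0.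
apply/cvgrPdist_le => e e0.
(* Eventually each variance is at most ep^2 + ep^-1 L <= 2 ep, so the sum of v^2 / 4 is at most (ep
   / 2) (s + 1) <= e / 2. The term 3 L and the error in the total variance take e / 4 each. *)
pose ep := Num.min 1 (e / (s + 1)).
have s1 : 0 < s + 1 by lra.
have ep0 : 0 < ep by rewrite lt_min ltr01 divr_gt0.
have ep1 : ep <= 1 by rewrite ge_min lexx.
have eps : (s + 1) * ep <= e by rewrite mulrC -ler_pdivlMr // ge_min lexx orbT.
have cexp : expR (- ((\sum_(k < n) v n k) / 2)) * cos c @[n --> \oo] -->
    expR (- (s / 2)) * cos c.
  apply: cvgM; last exact: cvg_cst.
  apply: (cvg_comp _ expR); last exact: continuous_expR.
  by apply: cvgN; apply: cvgM => //; exact: cvg_cst.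
have e4 : 0 < e / 4 by rewrite divr_gt0.
have e12 : 0 < e / 12 by rewrite divr_gt0.
have epp : 0 < ep ^+ 2 by rewrite exprn_gt0.
near=> n.
have h1 : `|expR (- (s / 2)) * cos c - expR (- ((\sum_(k < n) v n k) / 2)) * cos c| <= e / 4.
  by near: n; exact: (cvgrPdist_le _ _).1 cexp _ e4.
have h2 : `|0 - \sum_(k < n) \int[P]_w lind (z n k w)| <= e / 12.
  by near: n; exact: (cvgrPdist_le _ _).1 lindeberg _ e12.
have h3 : `|0 - \sum_(k < n) \int[P]_w lind (z n k w)| <= ep ^+ 2.
  by near: n; exact: (cvgrPdist_le _ _).1 lindeberg _ epp.
have h4 : `|s - \sum_(k < n) v n k| <= 1.
  by near: n; exact: (cvgrPdist_le _ _).1 cvg_var _ ltr01.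
have h5 := E_cos_sum (mz n) (iz2 n) (Ez n) (@ind n) n c.
set L := \sum_(k < n) \int[P]_w lind (z n k w) in h2 h3.
have l0 k : 0 <= \int[P]_w lind (z n k w) by apply: E_ge0 => w; exact: lind_ge0.
have L0 : 0 <= L by exact: sumr_ge0.
rewrite sub0r normrN ger0_norm // in h2 h3.
have vle (k : 'I_n) : v n k <= ep ^+ 2 + ep^-1 * L.
  have il := L1_lind (mz n k) (iz2 n k).
  apply: (@le_trans _ _ (\int[P]_w (ep ^+ 2 + ep^-1 * lind (z n k w)))).
    apply: E_le => //; first by apply: L1D; [exact: L1_cst|exact: L1Z].
    by move=> w; exact: sqr_le_lind.
  rewrite ED; [|exact: L1_cst|exact: L1Z].
  rewrite Ecst EZ // lerD2l ler_pM2l ?invr_gt0 // /L (bigD1 k) //=.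
  by rewrite lerDl sumr_ge0.
have hL : ep^-1 * L <= ep by rewrite ler_pdivrMl // -expr2.
have hep : ep ^+ 2 <= ep by rewrite expr2 ler_piMr // ltW.
have h6 : \sum_(k < n) (3 * (\int[P]_w lind (z n k w)) + v n k ^+ 2 / 4) <= 3 * L + e / 2.
  rewrite big_split /= -mulr_sumr lerD2l.
  apply: (@le_trans _ _ (\sum_(k < n) v n k * (ep / 2))).
    apply: ler_sum => k _; have := vle k; have := v0 n k.
    move: (v n k) => x x0 xle; have : x <= 2 * ep by lra.
    by nra.
  rewrite -mulr_suml; move: h4; rewrite ler_norml => /andP[h4 _].
  have : \sum_(k < n) v n k <= s + 1 by lra.
  move=> /(ler_wpM2r (ltW ep0)) H; lra.
move: h1 h5; rewrite -/(v n) => h1 h5.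
have := le_trans h5 h6; move: h1.
rewrite !ler_norml => /andP[? ?] /andP[? ?]; lra.
Unshelve. all: by end_near. Qed.

End TriangularArray.

Lemma cvg_scale0 (R : realType) (U : Type) (F : set_system U) {FF : Filter F}
  (c : R) (u : U -> R) : u x @[x --> F] --> 0 -> c * u x @[x --> F] --> 0.
Proof.
by move=> u0; rewrite -(mulr0 c); apply: cvgM => //; exact: cvg_cst.
Qed.

Lemma cvg_invsqrt0 (R : realType) : ((Num.sqrt n%:R)^-1 : R) @[n --> \oo] --> 0.
Proof.
apply/cvgrPdist_le => e e0; near=> n.
rewrite sub0r normrN ger0_norm ?invr_ge0 ?sqrtr_ge0 // -[leRHS]invrK.
have n0 : (0 < n)%N by near: n; exact: nbhs_infty_gt.
rewrite lef_pV2 ?posrE ?invr_gt0 ?sqrtr_gt0 ?ltr0n //.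
rewrite -(ger0_norm (_ : 0 <= e^-1)) ?invr_ge0 ?(ltW e0) // -sqrtr_sqr.
rewrite ler_wsqrtr // (le_trans (ltW (truncnS_gt _))) // ler_nat.
by near: n; exact: nbhs_infty_ge.
Unshelve. all: by end_near. Qed.

Lemma cvg_add0 (R : realType) (u v : nat -> R) :
  u n @[n --> \oo] --> 0 -> v n @[n --> \oo] --> 0 ->
  u n + v n @[n --> \oo] --> 0.
Proof. by move=> u0 v0; rewrite -(addr0 0); exact: cvgD. Qed.

(** * Sequences satisfying Lindeberg's condition *)

Section LindebergSequences.
Context d (T : measurableType d) (R : realType) (P : probability T R).
Implicit Types (a b : nat -> T -> R).

(* The sequences with bounded second moments to which Lindeberg's condition
   applies after scaling by 1 / sqrt n. *)
Definition lindeberg_seq a := [/\ forall k, measurable_fun [set: T] (a k),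
  forall k, L1 P (fun w => a k w ^+ 2),
  exists C, forall k, \int[P]_w (a k w ^+ 2) <= C &
  \sum_(k < n) \int[P]_w lind ((Num.sqrt n%:R)^-1 * a k w) @[n --> \oo] --> 0].

Lemma L1_lind_scale a k r : lindeberg_seq a -> L1 P (fun w => lind (r * a k w)).
Proof.
by move=> [ma ia _ _]; exact: L1_lindZ.
Qed.

Lemma squeeze_lind a b (C : R) : lindeberg_seq a ->
  (forall n k, \int[P]_w lind ((Num.sqrt n%:R)^-1 * b k w) <=
    C * \int[P]_w lind ((Num.sqrt n%:R)^-1 * a k w)) ->
  \sum_(k < n) \int[P]_w lind ((Num.sqrt n%:R)^-1 * b k w) @[n --> \oo] --> 0.
Proof.
move=> [_ _ _ la] ba.
have l0 : C * (\sum_(k < n) \int[P]_w lind ((Num.sqrt n%:R)^-1 * a k w)) @[n --> \oo] --> 0.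
  exact: cvg_scale0.
apply: (squeeze_cvgr _ (cvg_cst 0) l0); apply: nearW => n.
rewrite sumr_ge0 ?mulr_sumr ?ler_sum // => k _.
by apply: E_ge0 => w; exact: lind_ge0.
Qed.

Lemma lindeberg_le a b : lindeberg_seq a -> (forall k, measurable_fun [set: T] (b k)) ->
  (forall k w, `|b k w| <= `|a k w|) -> lindeberg_seq b.
Proof.
move=> la mb ba; have [ma ia [C aC] _] := la.
have ba2 k w : b k w ^+ 2 <= a k w ^+ 2.
  by rewrite -(real_normK (num_real (b k w))) -(real_normK (num_real (a k w))) lerXn2r ?nnegrE.
have ib k : L1 P (fun w => b k w ^+ 2).
  apply: (L1_le _ (ia k)); first exact: measurable_funX.
  by move=> w; rewrite ger0_norm ?sqr_ge0.
split => //.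
- by exists C => k; apply: le_trans (aC k); apply: E_le.
- apply: (squeeze_lind (C := 1) la) => n k; rewrite mul1r; apply: E_le.
  + exact: L1_lindZ.
  + exact: L1_lind_scale.
  + by move=> w; apply: lind_mono; rewrite !normrM ler_wpM2l.
Qed.

Lemma lindeberg_add a b : lindeberg_seq a -> lindeberg_seq b ->
  lindeberg_seq (fun k w => a k w + b k w).
Proof.
move=> la lb; have [ma ia [A aA] ca] := la; have [mb ib [B bB] cb] := lb.
have ab2 k w : (a k w + b k w) ^+ 2 <= 2 * a k w ^+ 2 + 2 * b k w ^+ 2.
  by have := sqr_ge0 (a k w - b k w); rewrite sqrrB sqrrD; lra.
have mab k : measurable_fun [set: T] (fun w => a k w + b k w) by exact: measurable_funD.
have iab k : L1 P (fun w => (a k w + b k w) ^+ 2).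
  apply: (L1_le _ (L1D (L1Z 2 (ia k)) (L1Z 2 (ib k)))); first exact: measurable_funX.
  by move=> w; rewrite ger0_norm ?sqr_ge0.
split => //.
- exists (2 * A + 2 * B) => k.
  apply: (le_trans (E_le (iab k) (L1D (L1Z 2 (ia k)) (L1Z 2 (ib k))) (ab2 k))).
  by rewrite ED ?EZ //; [rewrite lerD // ler_wpM2l|exact: L1Z|exact: L1Z].
- have l0 : 8 * (\sum_(k < n) \int[P]_w lind ((Num.sqrt n%:R)^-1 * a k w) +
      \sum_(k < n) \int[P]_w lind ((Num.sqrt n%:R)^-1 * b k w)) @[n --> \oo] --> 0.
    by apply: cvg_scale0; exact: cvg_add0.
  apply: (squeeze_cvgr _ (cvg_cst 0) l0); apply: nearW => n.
  rewrite sumr_ge0 /=; last by move=> k _; apply: E_ge0 => w; exact: lind_ge0.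
  rewrite -big_split mulr_sumr; apply: ler_sum => k _ /=.
  have i1 := L1_lind_scale k (Num.sqrt n%:R)^-1 la.
  have i2 := L1_lind_scale k (Num.sqrt n%:R)^-1 lb.
  rewrite -ED // -EZ; last exact: L1D.
  apply: E_le; [|exact/L1Z/L1D|].
    exact: L1_lindZ.
  by move=> w; rewrite mulrDr; exact: lindD.
Qed.

Lemma lindeberg_scale c a : lindeberg_seq a -> lindeberg_seq (fun k w => c * a k w).
Proof.
move=> la; have [ma ia [A aA] ca] := la.
have A0 : 0 <= A by apply: le_trans (aA 0%N); apply: E_ge0 => w; exact: sqr_ge0.
pose C := Num.max 1 `|c|.
have C1 : 1 <= C by rewrite le_max lexx.
have cC : `|c| <= C by rewrite le_max lexx orbT.
have mca k : measurable_fun [set: T] (fun w => c * a k w) by exact: measurable_funM.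
have ica k : L1 P (fun w => (c * a k w) ^+ 2).
  by under eq_fun do rewrite exprMn; exact: L1Z.
split => //.
- exists (c ^+ 2 * A) => k; under eq_Rintegral do rewrite exprMn.
  by rewrite EZ // ler_wpM2l // sqr_ge0.
- apply: (squeeze_lind (b := fun k w => c * a k w) (C := C ^+ 3) la) => n k; rewrite -EZ;
  last exact: L1_lind_scale.
  apply: E_le.
  + exact: L1_lindZ.
  + by apply: L1Z; exact: L1_lind_scale.
  + move=> w; apply: le_trans (lindM _ C1); apply: lind_mono.
    by rewrite mulrCA !normrM ler_wpM2r ?mulr_ge0 // (le_trans cC) // ler_norm.
Qed.

Lemma lindeberg_norm a : lindeberg_seq a -> lindeberg_seq (fun k w => `|a k w|).
Proof.
move=> la; have [ma _ _ _] := la; apply: (lindeberg_le la) => [k|k w].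
  by apply: measurableT_comp => //; exact: ma.
by rewrite normr_id.
Qed.

(** Lyapunov's condition with exponent 3: the Lindeberg sum is at most n n^(-3/2) C. *)
Lemma lindeberg_third a C : (forall k, measurable_fun [set: T] (a k)) ->
  (forall k, L1 P (fun w => `|a k w| ^+ 3)) ->
  (forall k, \int[P]_w (`|a k w| ^+ 3) <= C) -> lindeberg_seq a.
Proof.
move=> ma ia aC.
have C0 : 0 <= C by apply: le_trans (aC 0%N); apply: E_ge0 => w; exact: exprn_ge0.
have a2 k w : a k w ^+ 2 <= 1 + `|a k w| ^+ 3.
  rewrite -(real_normK (num_real (a k w))).
  have [h|/ltW h] := leP `|a k w| 1.
    by rewrite ler_wpDr ?exprn_ge0 // exprn_ile1.
  by rewrite ler_wpDl // [leRHS]exprSr ler_peMr ?exprn_ge0.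
have i2 k : L1 P (fun w => a k w ^+ 2).
  apply: (L1_le _ (L1D (L1_cst P 1) (ia k))); first exact: measurable_funX.
  by move=> w; rewrite ger0_norm ?sqr_ge0.
split => //.
  exists (1 + C) => k.
  apply: (le_trans (E_le (i2 k) (L1D (L1_cst P 1) (ia k)) (a2 k))).
  by rewrite ED ?Ecst ?lerD2l //; exact: L1_cst.
have l0 : C * (Num.sqrt n%:R)^-1 @[n --> \oo] --> 0.
  by apply: cvg_scale0; exact: cvg_invsqrt0.
apply: (squeeze_cvgr _ (cvg_cst 0) l0); near=> n.
have n0 : (0 < n)%N by near: n; exact: nbhs_infty_gt.
rewrite sumr_ge0 /=; last by move=> k _; apply: E_ge0 => w; exact: lind_ge0.
have r0 : 0 <= (Num.sqrt n%:R)^-1 :> R by rewrite invr_ge0 sqrtr_ge0.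
apply: (@le_trans _ _ (\sum_(k < n) ((Num.sqrt n%:R)^-1 ^+ 3 * C))).
  apply: ler_sum => k _.
  apply: (@le_trans _ _ (\int[P]_w ((Num.sqrt n%:R)^-1 ^+ 3 * `|a k w| ^+ 3))).
    apply: E_le; last 2 first.
    - exact: L1Z.
    - by move=> w; rewrite (le_trans (lind_le_cube _)) // normrM exprMn (ger0_norm r0).
    exact: L1_lindZ.
  by rewrite EZ // ler_wpM2l // exprn_ge0.
rewrite sumr_const card_ord -[X in X <= _]mulr_natr.
have rE : n%:R = Num.sqrt n%:R ^+ 2 :> R by rewrite sqr_sqrtr.
have rn0 : Num.sqrt n%:R != 0 :> R by rewrite gt_eqF // sqrtr_gt0 ltr0n.
rewrite [X in _ * X]rE le_eqVlt; apply/orP; left; apply/eqP.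
by field.
Unshelve. all: by end_near. Qed.

Lemma lindeberg_cst c : lindeberg_seq (fun _ _ => c).
Proof.
apply: (@lindeberg_third _ (`|c| ^+ 3)) => // k; first exact: L1_cst.
by rewrite Ecst.
Qed.

Lemma lindeberg_sum (I : Type) (r : seq I) (a : I -> nat -> T -> R) :
  (forall i, lindeberg_seq (a i)) ->
  lindeberg_seq (fun k w => \sum_(i <- r) a i k w).
Proof.
move=> la; elim: r => [|i r IHr].
  by under eq_fun do under eq_fun do rewrite big_nil; exact: lindeberg_cst.
under eq_fun do under eq_fun do rewrite big_cons.
exact: lindeberg_add.
Qed.

Lemma E_ident (Y Y' : {RV P >-> R}) (f : R -> R) :
  (forall A, measurable A -> distribution P Y A = distribution P Y' A) ->
  measurable_fun [set: R] f -> (forall x, 0 <= f x) ->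
  \int[P]_w f (Y w) = \int[P]_w f (Y' w).
Proof.
move=> YY' mf f0; rewrite /Rintegral; congr fine.
have mf' : measurable_fun [set: R] (fun x => (f x)%:E) by exact/measurable_EFinP.
have f0' x : (0 <= (f x)%:E)%E by rewrite lee_fin.
rewrite -(ge0_integral_distribution Y mf' f0') -(ge0_integral_distribution Y' mf' f0').
by apply: eq_measure_integral => A mA _; exact: YY'.
Qed.

(** The sum equals E [n lind (f (Y_0) / sqrt n)]. The integrand is dominated by f (Y_0)^2 and
    bounded by |f (Y_0)|^3 / sqrt n, which tends to 0 pointwise, so second moments of f (Y_0) are
    enough. *)
Lemma lindeberg_ident (Y : nat -> {RV P >-> R}) (f : R -> R) :
  (forall k k' A, measurable A -> distribution P (Y k) A = distribution P (Y k') A) ->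
  measurable_fun [set: R] f -> (forall k, L1 P (fun w => f (Y k w) ^+ 2)) ->
  lindeberg_seq (fun k w => f (Y k w)).
Proof.
move=> idY mf ifY; have mfY k : measurable_fun [set: T] (fun w => f (Y k w)).
  by apply: measurableT_comp => //; exact: measurable_funPT.
split => //.
  exists (\int[P]_w (f (Y 0%N w) ^+ 2)) => k.
  rewrite (E_ident (f := fun x => f x ^+ 2) (idY k 0%N)) //.
    exact: measurable_funX.
  by move=> x; exact: sqr_ge0.
have ml n : measurable_fun [set: R] (fun x => lind ((Num.sqrt n%:R)^-1 * f x)).
  by apply: measurableT_comp; [exact: measurable_lind|exact: measurable_funM].
have E n : \sum_(k < n) \int[P]_w lind ((Num.sqrt n%:R)^-1 * f (Y k w)) =
    \int[P]_w (n%:R * lind ((Num.sqrt n%:R)^-1 * f (Y 0%N w))).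
  rewrite EZ; last first.
    exact: L1_lindZ.
  rewrite (eq_bigr (fun=> \int[P]_w lind ((Num.sqrt n%:R)^-1 * f (Y 0%N w)))).
    by rewrite sumr_const card_ord mulr_natl.
  move=> k _; apply: (E_ident (f := fun x => lind ((Num.sqrt n%:R)^-1 * f x)) (idY k 0%N)) => //.
  by move=> x; exact: lind_ge0.
rewrite (eq_cvg _ _ E); rewrite /Rintegral.
apply: (@fine_cvg _ _ _ _ _ 0).
have -> : 0%:E = (\int[P]_w 0%:E)%E :> \bar R by rewrite integral0.
have bound n w : n%:R * lind ((Num.sqrt n%:R)^-1 * f (Y 0%N w)) <= f (Y 0%N w) ^+ 2.
  case: n => [|n]; first by rewrite mul0r sqr_ge0.
  apply: (@le_trans _ _ (n.+1%:R * ((Num.sqrt n.+1%:R)^-1 * f (Y 0%N w)) ^+ 2)).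
    by rewrite ler_wpM2l // lind_le_sqr.
  by rewrite exprMn exprVn sqr_sqrtr // mulrA divff ?mul1r // pnatr_eq0.
apply: (@dominated_cvg _ _ _ P _ _ _ _ (fun w => (f (Y 0%N w) ^+ 2)%:E)) => //.
- move=> n; apply/measurable_EFinP; apply: measurable_funM => //.
  apply: measurableT_comp; [exact: measurable_lind|exact: measurable_funM].
- move=> w _; apply: cvg_EFin; first exact: nearW.
  rewrite /comp /=.
  have l0 : (Num.sqrt n%:R)^-1 * `|f (Y 0%N w)| ^+ 3 @[n --> \oo] --> 0.
    rewrite -(mul0r (`|f (Y 0%N w)| ^+ 3)); apply: cvgM; last exact: cvg_cst.
    exact: cvg_invsqrt0.
  apply: (squeeze_cvgr _ (cvg_cst 0) l0); near=> n.
  have n0 : (0 < n)%N by near: n; exact: nbhs_infty_gt.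
  rewrite mulr_ge0 ?lind_ge0 //=.
  apply: (@le_trans _ _ (n%:R * `|(Num.sqrt n%:R)^-1 * f (Y 0%N w)| ^+ 3)).
    by rewrite ler_wpM2l // lind_le_cube.
  have r0 : 0 <= (Num.sqrt n%:R)^-1 :> R by rewrite invr_ge0 sqrtr_ge0.
  rewrite normrM exprMn (ger0_norm r0) mulrA ler_wpM2r ?exprn_ge0 //.
  have rn0 : Num.sqrt n%:R != 0 :> R by rewrite gt_eqF // sqrtr_gt0 ltr0n.
  rewrite -[X in X * _ <= _](@sqr_sqrtr R n%:R) // le_eqVlt; apply/orP; left; apply/eqP.
  by field.
- move=> n w _; rewrite /= lee_fin ger0_norm ?mulr_ge0 ?lind_ge0 //.
Unshelve. all: by end_near. Qed.

End LindebergSequences.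

(** * Independence of the rows of the model *)

Section Moments.
Context d (T : measurableType d) (R : realType) (P : probability T R).
Implicit Types (X Y : T -> R).

Lemma L1_of_fourth Y n : measurable_fun [set: T] Y -> L1 P (fun w => Y w ^+ 4) ->
  (n <= 4)%N -> L1 P (fun w => `|Y w| ^+ n).
Proof.
move=> mY i4 n4; apply: (L1_le _ (L1D (L1_cst P 1) i4)).
  by apply: measurable_funX; exact: measurableT_comp.
move=> w; rewrite ger0_norm ?exprn_ge0 //.
have -> : Y w ^+ 4 = `|Y w| ^+ 4.
  by rewrite -normrX ger0_norm // (exprM (Y w) 2 2) sqr_ge0.
have [h|/ltW h] := leP `|Y w| 1.
  by rewrite ler_wpDr ?exprn_ge0 // exprn_ile1.
by rewrite ler_wpDl // ler_weXn2l.
Qed.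

Lemma L1M_of_sqr X Y : measurable_fun [set: T] X -> measurable_fun [set: T] Y ->
  L1 P (fun w => X w ^+ 2) -> L1 P (fun w => Y w ^+ 2) -> L1 P (fun w => X w * Y w).
Proof.
move=> mX mY iX iY; apply: (L1_le (measurable_funM mX mY) (L1D iX iY)) => w.
rewrite normrM -(real_normK (num_real (X w))) -(real_normK (num_real (Y w))).
move: `|X w| `|Y w| (normr_ge0 (X w)) (normr_ge0 (Y w)) => x y x0 y0.
have := sqr_ge0 (x - y); have := mulr_ge0 x0 y0; rewrite sqrrB; lra.
Qed.

Section HasMoments.
Variables (Y : {RV P >-> R}) (s g1 g2 : R).
Hypothesis hY : has_moments Y s g1 g2.

Let mY : measurable_fun [set: T] (Y : T -> R).
Proof. exact: measurable_funPT. Qed.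

Lemma moment4_L1 : L1 P (fun w => Y w ^+ 4).
Proof.
have [_ _ _ h] := hY; apply: L1_of_ge0; first exact: measurable_funX.
  by move=> w; rewrite (exprM (Y w) 2 2) sqr_ge0.
by move: h; rewrite unlock => ->; rewrite ltry.
Qed.

Lemma moment2_L1 : L1 P (fun w => Y w ^+ 2).
Proof.
have := L1_of_fourth (n := 2) mY moment4_L1 isT.
rewrite (_ : (fun w => (`|Y w| ^+ 2)%:E) = (fun w => (Y w ^+ 2)%:E)) //.
by apply/funext => w; rewrite real_normK ?num_real.
Qed.

Lemma moment1_L1 : L1 P Y.
Proof. exact: L1_of_sqr moment2_L1. Qed.

Lemma moment1 : \int[P]_w Y w = 0.
Proof. by have [h _ _ _] := hY; rewrite /Rintegral; move: h; rewrite unlock => ->. Qed.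

Lemma moment2 : \int[P]_w (Y w ^+ 2) = s ^+ 2.
Proof.
have [h1 h2 _ _] := hY; rewrite /Rintegral.
have -> : (\int[P]_w (Y w ^+ 2)%:E = (s ^+ 2)%:E)%E.
  rewrite -h2 /variance covariance.unlock h1 expectation.unlock.
  by apply: eq_integral => w _; congr EFin; transitivity ((Y w - 0) * (Y w - 0));
    [rewrite subr0 expr2 | by []].
by [].
Qed.

Lemma moment4 : \int[P]_w (Y w ^+ 4) = (g2 + 3) * s ^+ 4.
Proof. by have [_ _ _ h] := hY; rewrite /Rintegral; move: h; rewrite unlock => ->. Qed.

Lemma moment3_le : \int[P]_w (`|Y w| ^+ 3) <= 1 + (g2 + 3) * s ^+ 4.
Proof.
have i3 := L1_of_fourth (n := 3) mY moment4_L1 isT.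
have i4 := moment4_L1.
rewrite -moment4 -[X in X + _](Ecst P) -ED //; last exact: L1_cst.
apply: E_le => //; first by apply: L1D => //; exact: L1_cst.
move=> w; have -> : Y w ^+ 4 = `|Y w| ^+ 4.
  by rewrite -normrX ger0_norm // (exprM (Y w) 2 2) sqr_ge0.
have [h|/ltW h] := leP `|Y w| 1.
  by rewrite ler_wpDr ?exprn_ge0 // exprn_ile1.
by rewrite ler_wpDl // ler_weXn2l.
Qed.

End HasMoments.
End Moments.

Lemma big_sum_type (R : Type) (idx : R) (op : Monoid.com_law idx) (A B : Type)
    (s : seq (A + B)) (F : A + B -> R) :
  \big[op/idx]_(i <- s) F i =
  op (\big[op/idx]_(a <- pmap (fun i => if i is inl a then Some a else None) s) F (inl a))
     (\big[op/idx]_(b <- pmap (fun i => if i is inr b then Some b else None) s) F (inr b)).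
Proof.
elim: s => [|[a|b] s IHs] /=; first by rewrite !big_nil Monoid.mul1m.
  by rewrite !big_cons IHs Monoid.mulmA.
by rewrite !big_cons IHs Monoid.mulmCA.
Qed.

Section RowFamily.
Context d (T : measurableType d) (R : realType) (P : probability T R).
Variables (p q : nat) (mo : ultrastructural P p q).
Hypotheses (hi : assumption_i mo) (hii : assumption_ii mo)
  (hiii : assumption_iii mo) (hiv : assumption_iv mo).

(* The sigma-algebras assumed independent by (i)-(iv) jointly: one for each
   delta_kj, one for each psi_kj and one for each whole row of E. *)
Definition row_index : Type := (nat * 'I_p + nat * 'I_p + nat)%type.

Definition row_of (i : row_index) : nat :=
  match i with inl (inl kj) => kj.1 | inl (inr kj) => kj.1 | inr k => k end.

Definition model_family (i : row_index) : set_system T :=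
  match i with
  | inl (inl kj) => sigma_of (fun _ : unit => delta mo kj.1 kj.2)
  | inl (inr kj) => sigma_of (fun _ : unit => psi mo kj.1 kj.2)
  | inr k => sigma_of (fun j => eps mo k j)
  end.

Lemma model_family_measurable i : model_family i `<=` measurable.
Proof.
by case: i => [[kj|kj]|k]; apply: sigma_of_measurable => j; exact: measurable_funPT.
Qed.

Lemma model_family_algebra i : sigma_algebra [set: T] (model_family i).
Proof. by case: i => [[kj|kj]|k]; exact: sigma_of_algebra. Qed.

(** The list of indices is regrouped by source: assumption (iv) separates the events of [delta],
    [psi] and [eps], and within each group the product rule of (ii), (iii) or (i) applies. The
    nesting of [row_index] follows the order of the three events in (iv). *)
Lemma model_family_indep : mutually_independent P model_family.
Proof.
move=> s A us FA.
have [[hd _] _] := hii; have [[hp _] _] := hiii; have [he _] := hi.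
pose getl (X Y : Type) (i : X + Y) := if i is inl a then Some a else None.
pose getr (X Y : Type) (i : X + Y) := if i is inr b then Some b else None.
have ul (X Y : eqType) (r : seq (X + Y)) : uniq r -> uniq (pmap (@getl X Y) r).
  by apply: (@pmap_uniq _ _ (@getl X Y) inl) => -[].
have ur (X Y : eqType) (r : seq (X + Y)) : uniq r -> uniq (pmap (@getr X Y) r).
  by apply: (@pmap_uniq _ _ (@getr X Y) inr) => -[].
have ml (X Y : eqType) (r : seq (X + Y)) a : a \in pmap (@getl X Y) r -> inl a \in r.
  by rewrite mem_pmap => /mapP[[b br [->]|//]].
have mr (X Y : eqType) (r : seq (X + Y)) a : a \in pmap (@getr X Y) r -> inr a \in r.
  by rewrite mem_pmap => /mapP[[//|b br [->]]].
rewrite !(big_sum_type _ s) !(big_sum_type _ (pmap _ s)) -/(@getl _ _) -/(@getr _ _) /=.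
set s1 := pmap _ (pmap _ s); set s2 := pmap _ (pmap _ s); set s3 := pmap _ s.
have u1 : uniq s1 by exact/ul/ul.
have u2 : uniq s2 by exact/ur/ul.
have u3 : uniq s3 by exact/ur.
have F1 a : a \in s1 -> model_family (inl (inl a)) (A (inl (inl a))) by move=> /ml /ml; exact: FA.
have F2 a : a \in s2 -> model_family (inl (inr a)) (A (inl (inr a))) by move=> /mr /ml; exact: FA.
have F3 a : a \in s3 -> model_family (inr a) (A (inr a)) by move=> /mr; exact: FA.
rewrite -(hd s1 (fun a => A (inl (inl a))) u1 F1).
rewrite -(hp s2 (fun a => A (inl (inr a))) u2 F2).
rewrite -(he s3 (fun a => A (inr a)) u3 F3).
apply: hiv; apply: sigma_of_bigsetI => a.
- move=> /F1; exact: (@sigma_of_sub _ _ _ _ _ (fun kj => (delta mo kj.1 kj.2 : T -> R))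
  (fun _ => a)).
- move=> /F2; exact: (@sigma_of_sub _ _ _ _ _ (fun kj => (psi mo kj.1 kj.2 : T -> R)) (fun _ => a)).
- move=> /F3; exact: (@sigma_of_sub _ _ _ _ _ (fun kj => (eps mo kj.1 kj.2 : T -> R)) (fun
  j => (a, j))).
Qed.

Definition row_set (k : nat) : set row_index := [set i | row_of i = k].
Definition past_set (k : nat) : set row_index := [set i | (row_of i < k)%N].

Lemma delta_family (J : set row_index) k j : J (inl (inl (k, j))) ->
  fun_of_family model_family J (delta mo k j).
Proof.
move=> Jk; apply: (fun_of_family1 model_family_algebra Jk) => A mA.
exact: (@sigma_of_preimage _ _ _ unit (fun _ => (delta mo k j : T -> R)) tt A mA).
Qed.

Lemma psi_family (J : set row_index) k j : J (inl (inr (k, j))) ->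
  fun_of_family model_family J (psi mo k j).
Proof.
move=> Jk; apply: (fun_of_family1 model_family_algebra Jk) => A mA.
exact: (@sigma_of_preimage _ _ _ unit (fun _ => (psi mo k j : T -> R)) tt A mA).
Qed.

Lemma eps_family (J : set row_index) k j : J (inr k) ->
  fun_of_family model_family J (eps mo k j).
Proof.
move=> Jk; apply: (fun_of_family1 model_family_algebra Jk) => A mA.
exact: (@sigma_of_preimage _ _ _ 'I_q (fun j => (eps mo k j : T -> R)) j A mA).
Qed.

Lemma family_indep_fun (J J' : set row_index) X Y : J `&` J' = set0 ->
  fun_of_family model_family J X -> fun_of_family model_family J' Y -> indep_fun P X Y.
Proof.
exact: (fun_of_family_indep model_family_measurable model_family_algebra model_family_indep).
Qed.

(** The earlier rows and row [k] involve disjoint sets of indices. This is the form of independence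
    that the telescoping argument uses. *)
Lemma past_row_indep k (z : nat -> T -> R) :
  (forall l, fun_of_family model_family (row_set l) (z l)) ->
  indep_fun P (fun w => \sum_(l < k) z l w) (z k).
Proof.
move=> zrow; apply: (@family_indep_fun (past_set k) (row_set k)); last exact: zrow.
  apply/seteqP; split => // i []; rewrite /past_set /row_set /= => ik ki.
  by rewrite ki ltnn in ik.
have zpast (l : 'I_k) : fun_of_family model_family (past_set k) (z l).
  apply: (@fun_of_familyW _ _ _ _ _ (row_set l)) => // i /= il.
  by rewrite /past_set /= il.
exact: (@measurable_sum _ (g_sigma_algebraType (cylinders model_family (past_set k))) R
  setT 'I_k _ (fun l => z l)).
Qed.

Lemma indep_pair (i j : row_index) X Y : i <> j ->
  fun_of_family model_family [set i] X -> fun_of_family model_family [set j] Y -> indep_fun P X Y.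
Proof.
move=> ij; apply: family_indep_fun; apply/seteqP; split => // a [/= -> ji].
exact: ij.
Qed.

End RowFamily.

(** * Centred products within a row *)

Section LindebergProducts.
Context d (T : measurableType d) (R : realType) (P : probability T R).
Implicit Types (a b : nat -> T -> R).

Lemma lindeberg_scale_bounded (c : nat -> R) C a : (forall k, `|c k| <= C) ->
  lindeberg_seq P a -> lindeberg_seq P (fun k w => c k * a k w).
Proof.
move=> cC la; have [ma _ _ _] := la.
apply: (lindeberg_le (lindeberg_scale C la)) => [k|k w].
  exact: measurable_funM.
by rewrite !normrM ler_wpM2r // (le_trans (cC k)) // ler_norm.
Qed.

Lemma lindeberg_bounded (c : nat -> R) C : (forall k, `|c k| <= C) ->
  lindeberg_seq P (fun k _ => c k).
Proof.
move=> cC; apply: (lindeberg_le (lindeberg_cst P C)) => // k _.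
by rewrite (le_trans (cC k)) // ler_norm.
Qed.

Lemma lindeberg_sqrD a b : (forall k, measurable_fun [set: T] (a k)) ->
  (forall k, measurable_fun [set: T] (b k)) ->
  lindeberg_seq P (fun k w => a k w ^+ 2) ->
  lindeberg_seq P (fun k w => b k w ^+ 2) ->
  lindeberg_seq P (fun k w => (a k w + b k w) ^+ 2).
Proof.
move=> ma mb la lb.
apply: (lindeberg_le (lindeberg_scale 2 (lindeberg_add la lb))) => [k|k w].
  by apply: measurable_funX; exact: measurable_funD.
have a2 := sqr_ge0 (a k w); have b2 := sqr_ge0 (b k w).
rewrite (ger0_norm (sqr_ge0 _)) ger0_norm; last by lra.
by have := sqr_ge0 (a k w - b k w); rewrite sqrrB sqrrD; lra.
Qed.

(** |a b| <= a^2 + b^2 reduces a product to squares. This treats products of dependent factors such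
    as x_i delta_i. *)
Lemma lindeberg_mul a b : (forall k, measurable_fun [set: T] (a k)) ->
  (forall k, measurable_fun [set: T] (b k)) ->
  lindeberg_seq P (fun k w => a k w ^+ 2) ->
  lindeberg_seq P (fun k w => b k w ^+ 2) ->
  lindeberg_seq P (fun k w => a k w * b k w).
Proof.
move=> ma mb la lb; apply: (lindeberg_le (lindeberg_add la lb)) => [k|k w].
  exact: measurable_funM.
rewrite normrM (@ger0_norm _ (_ + _)) ?addr_ge0 ?sqr_ge0 //.
rewrite -(real_normK (num_real (a k w))) -(real_normK (num_real (b k w))).
have := sqr_ge0 (`|a k w| - `|b k w|).
have : 0 <= `|a k w| * `|b k w| by rewrite mulr_ge0.
by rewrite sqrrB; lra.
Qed.

End LindebergProducts.

Section Features.
Context d (T : measurableType d) (R : realType) (P : probability T R).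
Variables (p q : nat) (mo : ultrastructural P p q).
Hypotheses (hi : assumption_i mo) (hii : assumption_ii mo)
  (hiii : assumption_iii mo) (hiv : assumption_iv mo).
Variable CM : R.
Hypothesis M_bounded : forall k i, `|M_row mo k 0 i| <= CM.

Definition x_entry k i w : R := M_row mo k 0 i + psi mo k i w + delta mo k i w.

Let mdelta k i : measurable_fun [set: T] (delta mo k i : T -> R).
Proof. exact: measurable_funPT. Qed.

Let mpsi k i : measurable_fun [set: T] (psi mo k i : T -> R).
Proof. exact: measurable_funPT. Qed.

Let meps k i : measurable_fun [set: T] (eps mo k i : T -> R).
Proof. exact: measurable_funPT. Qed.

Lemma measurable_x_entry k i : measurable_fun [set: T] (x_entry k i).
Proof. by do 2!apply: measurable_funD => //. Qed.

Let hdelta k j : has_moments (delta mo k j) _ _ _ := hii.2 k j.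
Let hpsi k j : has_moments (psi mo k j) _ _ _ := hiii.2 k j.
Let heps k j : has_moments (eps mo k j) _ _ _ := hi.2 k j.

Lemma lindeberg_delta_sqr i : lindeberg_seq P (fun k w => delta mo k i w ^+ 2).
Proof.
apply: (@lindeberg_ident _ _ _ P (fun k => delta mo k i) (fun x => x ^+ 2)) => //.
- by move=> k k'; exact: (hii.1.2 (k, i) (k', i)).
- by move=> k; under eq_fun do rewrite -exprM; exact: moment4_L1 (hdelta k i).
Qed.

Lemma lindeberg_psi_sqr i : lindeberg_seq P (fun k w => psi mo k i w ^+ 2).
Proof.
apply: (@lindeberg_ident _ _ _ P (fun k => psi mo k i) (fun x => x ^+ 2)) => //.
- by move=> k k'; exact: (hiii.1.2 (k, i) (k', i)).
- by move=> k; under eq_fun do rewrite -exprM; exact: moment4_L1 (hpsi k i).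
Qed.

Lemma lindeberg_eps j : lindeberg_seq P (fun k w => eps mo k j w).
Proof.
apply: (@lindeberg_third _ _ _ _ _ (1 + (g2_eps mo + 3) * s_eps mo ^+ 4)) => // k.
- exact: L1_of_fourth (moment4_L1 (heps k j)) _.
- exact: moment3_le (heps k j).
Qed.

(** By independence the third absolute moment of the product factorizes, and each factor is at most
    1 plus a fourth moment. It serves the products with [eps], whose entries need not be identically
    distributed. *)
Lemma lindeberg_indep_mul (Y Z : nat -> {RV P >-> R}) s g1 g2 s' g1' g2' :
  (forall k, has_moments (Y k) s g1 g2) -> (forall k, has_moments (Z k) s' g1' g2') ->
  (forall k, indep_fun P (Y k) (Z k)) ->
  lindeberg_seq P (fun k w => Y k w * Z k w).
Proof.
move=> hY hZ YZ.
have mc : measurable_fun [set: R] (fun x : R => `|x| ^+ 3).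
  by apply: measurable_funX; exact: normr_measurable.
have iY k := L1_of_fourth (n := 3) (measurable_funPT (Y k)) (moment4_L1 (hY k)) isT.
have iZ k := L1_of_fourth (n := 3) (measurable_funPT (Z k)) (moment4_L1 (hZ k)) isT.
have YZ3 k := indep_fun_comp mc mc (YZ k).
apply: (@lindeberg_third _ _ _ _ _ ((1 + (g2 + 3) * s ^+ 4) * (1 + (g2' + 3) * s' ^+ 4))).
- by move=> k; apply: measurable_funM; exact: measurable_funPT.
- by move=> k; under eq_fun do rewrite normrM exprMn; exact: indep_L1M.
- move=> k; under eq_Rintegral do rewrite normrM exprMn.
  rewrite indep_EM //; apply: ler_pM; [| |exact: moment3_le|exact: moment3_le].
    by apply: E_ge0 => w; exact: exprn_ge0.
  by apply: E_ge0 => w; exact: exprn_ge0.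
Qed.

Lemma x_entry_family (J : set (row_index p)) k i :
  J (inl (inl (k, i))) -> J (inl (inr (k, i))) ->
  fun_of_family (model_family mo) J (x_entry k i).
Proof.
move=> Jd Jp; apply: measurable_funD; last exact: delta_family.
by apply: measurable_funD => //; exact: psi_family.
Qed.

Lemma indep_delta k i j : i != j -> indep_fun P (delta mo k i) (delta mo k j).
Proof.
move=> ij; apply: (indep_pair hi hii hiii hiv (i := inl (inl (k, i))) (j := inl (inl (k, j)))).
- by case=> ijE; rewrite ijE eqxx in ij.
- exact: delta_family.
- exact: delta_family.
Qed.

Lemma indep_psi k i j : i != j -> indep_fun P (psi mo k i) (psi mo k j).
Proof.
move=> ij; apply: (indep_pair hi hii hiii hiv (i := inl (inr (k, i))) (j := inl (inr (k, j)))).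
- by case=> ijE; rewrite ijE eqxx in ij.
- exact: psi_family.
- exact: psi_family.
Qed.

Lemma indep_psi_delta k i j : indep_fun P (psi mo k i) (delta mo k j).
Proof.
apply: (indep_pair hi hii hiii hiv (i := inl (inr (k, i))) (j := inl (inl (k, j)))) => //.
- exact: psi_family.
- exact: delta_family.
Qed.

Lemma indep_psi_eps k i j : indep_fun P (psi mo k i) (eps mo k j).
Proof.
apply: (indep_pair hi hii hiii hiv (i := inl (inr (k, i))) (j := inr k)) => //.
- exact: psi_family.
- exact: eps_family.
Qed.

Lemma indep_delta_eps k i j : indep_fun P (delta mo k i) (eps mo k j).
Proof.
apply: (indep_pair hi hii hiii hiv (i := inl (inl (k, i))) (j := inr k)) => //.
- exact: delta_family.
- exact: eps_family.
Qed.

Lemma lindeberg_x_sqr i : lindeberg_seq P (fun k w => x_entry k i w ^+ 2).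
Proof.
apply: lindeberg_sqrD => //; last exact: lindeberg_delta_sqr.
  by move=> k; exact: measurable_funD.
apply: lindeberg_sqrD => //; last exact: lindeberg_psi_sqr.
apply: (@lindeberg_bounded _ _ _ _ _ (CM ^+ 2)) => k.
by rewrite normrX lerXn2r ?nnegrE // (le_trans _ (M_bounded k i)).
Qed.

Lemma L1_x_entry_sqr k i : L1 P (fun w => x_entry k i w ^+ 2).
Proof.
have [m2 i2 _ _] := lindeberg_x_sqr i.
by apply: L1_of_sqr => //; exact: m2.
Qed.

Lemma E_x_entry k i : \int[P]_w x_entry k i w = M_row mo k 0 i.
Proof.
have id := moment1_L1 (hdelta k i); have ip := moment1_L1 (hpsi k i).
rewrite !ED //; last by apply: L1D => //; exact: L1_cst.
  by rewrite Ecst (moment1 (hdelta k i)) (moment1 (hpsi k i)) !addr0.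
exact: L1_cst.
Qed.

Lemma E_x_delta k i j :
  \int[P]_w (x_entry k i w * delta mo k j w) = s_delta mo ^+ 2 *+ (i == j).
Proof.
have id l := moment1_L1 (hdelta k l); have ip l := moment1_L1 (hpsi k l).
have id2 l := moment2_L1 (hdelta k l); have ip2 l := moment2_L1 (hpsi k l).
under eq_Rintegral do rewrite !mulrDl.
have i1 : L1 P (fun w => M_row mo k 0 i * delta mo k j w) by exact: L1Z.
have i2 : L1 P (fun w => psi mo k i w * delta mo k j w) by exact: L1M_of_sqr.
have i3 : L1 P (fun w => delta mo k i w * delta mo k j w) by exact: L1M_of_sqr.
rewrite ED //; last exact: L1D.
rewrite ED // EZ // (moment1 (hdelta k j)) mulr0 add0r.
rewrite (indep_EM (ip i) (id j) (@indep_psi_delta k i j)) (moment1 (hpsi k i)) mul0r add0r.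
have [->|ij] := eqVneq i j.
  by under eq_Rintegral do rewrite -expr2; rewrite (moment2 (hdelta k j)) mulr1n.
by rewrite (indep_EM (id i) (id j) (@indep_delta k i j ij)) (moment1 (hdelta k i)) mul0r mulr0n.
Qed.

Lemma E_x_psi k i j :
  \int[P]_w (x_entry k i w * psi mo k j w) = s_psi mo ^+ 2 *+ (i == j).
Proof.
have id l := moment1_L1 (hdelta k l); have ip l := moment1_L1 (hpsi k l).
have id2 l := moment2_L1 (hdelta k l); have ip2 l := moment2_L1 (hpsi k l).
under eq_Rintegral do rewrite !mulrDl [delta _ _ _ _ * _]mulrC.
have i1 : L1 P (fun w => M_row mo k 0 i * psi mo k j w) by exact: L1Z.
have i2 : L1 P (fun w => psi mo k i w * psi mo k j w) by exact: L1M_of_sqr.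
have i3 : L1 P (fun w => psi mo k j w * delta mo k i w) by exact: L1M_of_sqr.
rewrite ED //; last exact: L1D.
rewrite ED // EZ // (moment1 (hpsi k j)) mulr0 add0r.
rewrite (indep_EM (ip j) (id i) (@indep_psi_delta k j i)) (moment1 (hpsi k j)) mul0r addr0.
have [->|ij] := eqVneq i j.
  by under eq_Rintegral do rewrite -expr2; rewrite (moment2 (hpsi k j)) mulr1n.
by rewrite (indep_EM (ip i) (ip j) (@indep_psi k i j ij)) (moment1 (hpsi k i)) mul0r mulr0n.
Qed.

Lemma E_x_x k i j : \int[P]_w (x_entry k i w * x_entry k j w) =
  M_row mo k 0 i * M_row mo k 0 j + (s_psi mo ^+ 2 + s_delta mo ^+ 2) *+ (i == j).
Proof.
have ix2 := L1_x_entry_sqr k i.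
have mx := @measurable_x_entry k i.
have ix := L1_of_sqr mx ix2.
have i1 : L1 P (fun w => x_entry k i w * psi mo k j w).
  by apply: L1M_of_sqr => //; exact: moment2_L1 (hpsi k j).
have i2 : L1 P (fun w => x_entry k i w * delta mo k j w).
  by apply: L1M_of_sqr => //; exact: moment2_L1 (hdelta k j).
have i3 : L1 P (fun w => M_row mo k 0 j * x_entry k i w) by exact: L1Z.
transitivity (\int[P]_w (M_row mo k 0 j * x_entry k i w + x_entry k i w * psi mo k j w +
    x_entry k i w * delta mo k j w)).
  by apply: eq_Rintegral => w _; rewrite [x_entry k j w]/x_entry; ring.
rewrite ED //; last exact: L1D.
rewrite ED // EZ // E_x_entry E_x_psi E_x_delta -addrA -mulrnDl.
by rewrite [M_row mo k 0 j * _]mulrC.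
Qed.

(** The row contributions to [H] and [h], each centred at its own mean; the mean of x_i x_j depends
    on the row through [M_row]. *)
Definition dev_xx k i j w : R := x_entry k i w * x_entry k j w -
  (M_row mo k 0 i * M_row mo k 0 j + (s_psi mo ^+ 2 + s_delta mo ^+ 2) *+ (i == j)).
Definition dev_xe k i j w : R := x_entry k i w * eps mo k j w.
Definition dev_xd k i j w : R :=
  x_entry k i w * delta mo k j w - s_delta mo ^+ 2 *+ (i == j).

Lemma lindeberg_xx i j : lindeberg_seq P (fun k => dev_xx k i j).
Proof.
apply: lindeberg_add.
  by apply: lindeberg_mul; [by move=> k; exact: measurable_x_entry|by move=> k;
    exact: measurable_x_entry|
    exact: lindeberg_x_sqr|exact: lindeberg_x_sqr].
apply: (@lindeberg_bounded _ _ _ _ _ (CM * CM + `|s_psi mo ^+ 2 + s_delta mo ^+ 2|)) => k.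
rewrite normrN (le_trans (ler_normD _ _)) // lerD //.
  by rewrite normrM ler_pM.
by case: eqP; rewrite ?mulr1n ?mulr0n ?normr0.
Qed.

Lemma lindeberg_xe i j : lindeberg_seq P (fun k => dev_xe k i j).
Proof.
rewrite /dev_xe /x_entry; under eq_fun do under eq_fun do rewrite !mulrDl.
apply: lindeberg_add.
  apply: lindeberg_add.
    by apply: (@lindeberg_scale_bounded _ _ _ _ _ CM) => //; exact: lindeberg_eps.
  exact: (lindeberg_indep_mul (hpsi ^~ i) (heps ^~ j) (fun k => @indep_psi_eps k i j)).
exact: (lindeberg_indep_mul (hdelta ^~ i) (heps ^~ j) (fun k => @indep_delta_eps k i j)).
Qed.

Lemma lindeberg_xd i j : lindeberg_seq P (fun k => dev_xd k i j).
Proof.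
apply: lindeberg_add; last exact: lindeberg_cst.
by apply: lindeberg_mul; [by move=> k; exact: measurable_x_entry|by []|
    exact: lindeberg_x_sqr|exact: lindeberg_delta_sqr].
Qed.

Lemma E_dev_xx k i j : \int[P]_w dev_xx k i j w = 0.
Proof.
rewrite EB ?Ecst ?E_x_x ?subrr //; last exact: L1_cst.
by apply: L1M_of_sqr; [exact: measurable_x_entry|exact: measurable_x_entry|
  exact: L1_x_entry_sqr|exact: L1_x_entry_sqr].
Qed.

Lemma E_dev_xd k i j : \int[P]_w dev_xd k i j w = 0.
Proof.
rewrite EB ?Ecst ?E_x_delta ?subrr //; last exact: L1_cst.
by apply: L1M_of_sqr; [exact: measurable_x_entry|by []|
  exact: L1_x_entry_sqr|exact: moment2_L1 (hdelta k j)].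
Qed.

Lemma E_dev_xe k i j : \int[P]_w dev_xe k i j w = 0.
Proof.
have mx := @measurable_x_entry k i.
rewrite /dev_xe (indep_EM (L1_of_sqr mx (L1_x_entry_sqr k i)) (moment1_L1 (heps k j))).
  by rewrite (moment1 (heps k j)) mulr0.
pose J : set (row_index p) := [set a | if a is inl _ then True else False].
pose J' : set (row_index p) := [set a | if a is inl _ then False else True].
apply: (family_indep_fun hi hii hiii hiv (J := J) (J' := J')).
- by apply/seteqP; split => // -[a|a] [].
- exact: x_entry_family.
- exact: eps_family.
Qed.

Lemma dev_xx_row k i j : fun_of_family (model_family mo) (row_set k) (dev_xx k i j).
Proof. by apply: measurable_funB => //; apply: measurable_funM; exact: x_entry_family. Qed.

Lemma dev_xe_row k i j : fun_of_family (model_family mo) (row_set k) (dev_xe k i j).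
Proof. by apply: measurable_funM; [exact: x_entry_family|exact: eps_family]. Qed.

Lemma dev_xd_row k i j : fun_of_family (model_family mo) (row_set k) (dev_xd k i j).
Proof.
by apply: measurable_funB => //; apply: measurable_funM;
  [exact: x_entry_family|exact: delta_family].
Qed.

End Features.

(** * Limits of matrices *)

Section EntrywiseConvergence.
Context {R : realType} {U : Type} (F : set_system U) {FF : Filter F}.

(** Stated for an arbitrary filter, so that one calculus serves deterministic limits along [\oo] and
    limits in probability along [whp]. *)
Definition cvg_entries a b (A : U -> 'M[R]_(a, b)) (L : 'M[R]_(a, b)) :=
  forall i j, A x i j @[x --> F] --> L i j.

Lemma cvg_sum_seq (I : Type) (r : seq I) (f : I -> U -> R) (l : I -> R) :
  (forall i, f i x @[x --> F] --> l i) ->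
  \sum_(i <- r) f i x @[x --> F] --> \sum_(i <- r) l i.
Proof.
move=> fl; elim: r => [|i r IHr].
  by rewrite big_nil; under eq_fun do rewrite big_nil; exact: cvg_cst.
by rewrite big_cons; under eq_fun do rewrite big_cons; exact: cvgD.
Qed.

Lemma cvg_prod_seq (I : Type) (r : seq I) (f : I -> U -> R) (l : I -> R) :
  (forall i, f i x @[x --> F] --> l i) ->
  \prod_(i <- r) f i x @[x --> F] --> \prod_(i <- r) l i.
Proof.
move=> fl; elim: r => [|i r IHr].
  by rewrite big_nil; under eq_fun do rewrite big_nil; exact: cvg_cst.
by rewrite big_cons; under eq_fun do rewrite big_cons; exact: cvgM.
Qed.

Lemma cvg_entries_cst a b (L : 'M[R]_(a, b)) : cvg_entries (fun=> L) L.
Proof. by move=> i j; exact: cvg_cst. Qed.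

Lemma cvg_entriesD a b (A A' : U -> 'M[R]_(a, b)) L L' :
  cvg_entries A L -> cvg_entries A' L' ->
  cvg_entries (fun x => A x + A' x) (L + L').
Proof.
move=> AL AL' i j; rewrite mxE; under eq_fun do rewrite mxE; exact: cvgD.
Qed.

Lemma cvg_entriesN a b (A : U -> 'M[R]_(a, b)) L :
  cvg_entries A L -> cvg_entries (fun x => - A x) (- L).
Proof.
by move=> AL i j; rewrite mxE; under eq_fun do rewrite mxE; exact: cvgN.
Qed.

Lemma cvg_entriesB a b (A A' : U -> 'M[R]_(a, b)) L L' :
  cvg_entries A L -> cvg_entries A' L' ->
  cvg_entries (fun x => A x - A' x) (L - L').
Proof. by move=> AL AL'; apply: cvg_entriesD => //; exact: cvg_entriesN. Qed.

Lemma cvg_entriesM a b c (A : U -> 'M[R]_(a, b)) (A' : U -> 'M[R]_(b, c)) L L' :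
  cvg_entries A L -> cvg_entries A' L' ->
  cvg_entries (fun x => A x *m A' x) (L *m L').
Proof.
move=> AL AL' i j; rewrite mxE; under eq_fun do rewrite mxE.
by apply: cvg_sum_seq => k; exact: cvgM.
Qed.

Lemma cvg_det a (A : U -> 'M[R]_a) L : cvg_entries A L ->
  \det (A x) @[x --> F] --> \det L.
Proof.
move=> AL; apply: cvg_sum_seq => s; apply: cvgM; first exact: cvg_cst.
by apply: cvg_prod_seq => i; exact: AL.
Qed.

Lemma cvg_entries_near_unit a (A : U -> 'M[R]_a) L : cvg_entries A L ->
  L \in unitmx -> \forall x \near F, A x \in unitmx.
Proof.
move=> AL Lu; under eq_near do rewrite unitmxE unitfE.
by apply: (cvgr_neq0 _ (cvg_det AL)); rewrite -unitfE -unitmxE.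
Qed.

Lemma cvg_entries_inv a (A : U -> 'M[R]_a) L : cvg_entries A L ->
  L \in unitmx -> cvg_entries (fun x => invmx (A x)) (invmx L).
Proof.
move=> AL Lu i j.
have -> : invmx L i j = (\det L)^-1 * cofactor L j i by rewrite /invmx Lu !mxE.
(* The adjugate formula for [invmx] is valid only where [A x] is invertible, which is eventually the
   case. *)
apply: (@cvg_trans _ (((\det (A x))^-1 * cofactor (A x) j i) @[x --> F])).
  apply: near_eq_cvg; have := cvg_entries_near_unit AL Lu; apply: filterS => x Au.
  by rewrite /invmx Au !mxE.
apply: cvgM.
  by apply: cvgV; [rewrite -unitfE -unitmxE|exact: cvg_det].
apply: cvgM; first exact: cvg_cst.
by apply: cvg_det => k l; rewrite !mxE; under eq_fun do rewrite !mxE; exact: AL.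
Qed.

End EntrywiseConvergence.

Lemma cvg_mx_entries (R : realType) (U : Type) (F : set_system U) {FF : Filter F}
  a b (A : U -> 'M[R]_(a, b)) L :
  A x @[x --> F] --> L -> cvg_entries F A L.
Proof.
move=> AL i j; apply: (cvg_comp A (fun M : 'M[R]_(a, b) => M i j)); first exact: AL.
exact: coord_continuous.
Qed.

Lemma cvg_entries_bounded (R : realType) a b (A : nat -> 'M[R]_(a, b)) L :
  cvg_entries \oo A L -> exists C : R, forall n i j, `|A n i j| <= C.
Proof.
move=> AL.
have bnd (ij : 'I_a * 'I_b) : exists C : R, forall n, `|A n ij.1 ij.2| <= C.
  have [C [_ hC]] := cvg_seq_bounded (cvgP _ (@AL ij.1 ij.2)).
  by exists (C + 1) => n; apply: hC => //; rewrite ltrDl.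
have [C hC] := choice bnd.
exists (\sum_ij `|C ij|) => n i j.
rewrite (le_trans (hC (i, j) n)) // (le_trans (ler_norm _)) //.
by rewrite (bigD1 (i, j)) //= lerDl sumr_ge0.
Qed.

Lemma cvg_mean (R : realType) (f : nat -> R) (l : R) : f n @[n --> \oo] --> l ->
  n%:R^-1 * (\sum_(k < n) f k) @[n --> \oo] --> l.
Proof.
move=> fl; rewrite -cvg_shiftS /=.
have := cesaro fl; rewrite /arithmetic_mean /series /=.
by under eq_fun do rewrite big_mkord.
Qed.

(** * Limits of the matrices of the model *)

Section ModelMatrices.
Context d (T : measurableType d) (R : realType) (P : probability T R).
Variables (p q : nat) (mo : ultrastructural P p q) (sM : 'cV[R]_p).
Hypothesis hv : assumption_v mo sM.

Lemma M_row_cvg i : M_row mo n 0 i @[n --> \oo] --> sM i 0.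
Proof.
have : (M_row mo n)^T i 0 @[n --> \oo] --> sM i 0 by exact: cvg_mx_entries hv _ _.
by under eq_fun do rewrite mxE.
Qed.

Lemma M_row_bounded : exists C : R, forall k i, `|M_row mo k 0 i| <= C.
Proof.
have [C hC] := cvg_entries_bounded (@cvg_mx_entries _ _ _ _ _ _ _ _ hv).
by exists C => k i; have := hC k i 0; rewrite mxE.
Qed.

(** n^-1 M'M is the arithmetic mean of the products of the entries of the rows of M, which converge
    by assumption (v); Cesaro's theorem gives the same limit. *)
Lemma Sigma_D_cvg : cvg_entries \oo (Sigma_D mo) (Sigma mo sM - (s_delta mo ^+ 2)%:M).
Proof.
rewrite /Sigma addrK; apply: cvg_entriesD; last exact: cvg_entries_cst.
move=> i j; rewrite mxE big_ord1 mxE.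
under eq_fun do rewrite mxE mxE.
under eq_fun do under eq_bigr do rewrite !mxE.
apply: (@cvg_mean _ (fun k => M_row mo k 0 i * M_row mo k 0 j)).
by apply: cvgM; exact: M_row_cvg.
Qed.

Lemma Sigma_X_cvg : cvg_entries \oo (Sigma_X mo) (Sigma mo sM).
Proof.
rewrite -[X in cvg_entries _ _ X](subrK (s_delta mo ^+ 2)%:M).
apply: cvg_entriesD; [exact: Sigma_D_cvg|exact: cvg_entries_cst].
Qed.

Hypothesis SigmaK_unit : Sigma mo sM *m K mo sM \in unitmx.

Lemma Sigma_unit : Sigma mo sM \in unitmx.
Proof. by move: SigmaK_unit; rewrite unitmx_mul => /andP[]. Qed.

Lemma K_unit : K mo sM \in unitmx.
Proof. by move: SigmaK_unit; rewrite unitmx_mul => /andP[]. Qed.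

Lemma K_X_cvg : cvg_entries \oo (K_X mo) (K mo sM).
Proof.
apply: cvg_entriesM; last exact: Sigma_D_cvg.
by apply: cvg_entries_inv; [exact: Sigma_X_cvg|exact: Sigma_unit].
Qed.

Lemma Kbar_X_cvg : cvg_entries \oo (Kbar_X mo)
  ((s_delta mo ^+ 2)%:M *m invmx (Sigma mo sM)).
Proof.
apply: cvg_entriesM; last by apply: cvg_entries_inv; [exact: Sigma_X_cvg|exact: Sigma_unit].
under eq_fun do rewrite /Sigma_X addrC addKr.
exact: cvg_entries_cst.
Qed.

Lemma Kbar_X_bounded : exists C : R, forall n i j, `|Kbar_X mo n i j| <= C.
Proof. exact: cvg_entries_bounded Kbar_X_cvg. Qed.

End ModelMatrices.

(** * Asymptotic normality of the score *)

Section DominatedArray.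
Context d (T : measurableType d) (R : realType) (P : probability T R).
Variables (D : nat -> T -> R) (z : nat -> nat -> T -> R).
Hypotheses (lD : lindeberg_seq P D)
  (mz : forall n k, measurable_fun [set: T] (z n k))
  (zD : forall n k w, `|z n k w| <= `|D k w|)
  (Ez : forall n k, \int[P]_w z n k w = 0)
  (indz : forall n k, indep_fun P (fun w => \sum_(l < k) z n l w) (z n k)).

Let s n : R := (Num.sqrt n%:R)^-1.
Let mean n w := s n * \sum_(k < n) z n k w.
Let y n k w := s n * z n k w.

Let meanE n w : mean n w = \sum_(k < n) y n k w.
Proof. by rewrite /mean mulr_sumr. Qed.

Let my n k : measurable_fun [set: T] (y n k).
Proof. exact: measurable_funM. Qed.

Let z2D n k w : z n k w ^+ 2 <= D k w ^+ 2.
Proof.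
by rewrite -(real_normK (num_real (z n k w))) -(real_normK (num_real (D k w)))
  lerXn2r ?nnegrE.
Qed.

Lemma array_L1_sqr n k : L1 P (fun w => z n k w ^+ 2).
Proof.
have [_ iD _ _] := lD; apply: (L1_le _ (iD k)); first exact: measurable_funX.
by move=> w; rewrite ger0_norm ?sqr_ge0.
Qed.

Let iy2 n k : L1 P (fun w => y n k w ^+ 2).
Proof.
by under eq_fun do rewrite /y exprMn; apply: L1Z; exact: array_L1_sqr.
Qed.

Let Ey n k : \int[P]_w y n k w = 0.
Proof. by rewrite EZ ?Ez ?mulr0 //; apply: L1_of_sqr => //; exact: array_L1_sqr. Qed.

Let indy n k : indep_fun P (fun w => \sum_(l < k) y n l w) (y n k).
Proof.
have mr (r : R) : measurable_fun [set: R] (fun x => r * x) by exact: measurable_funM.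
have := indep_fun_comp (mr (s n)) (mr (s n)) (@indz n k).
by under eq_fun do rewrite mulr_sumr.
Qed.

Lemma array_mean_L1_sqr n : L1 P (fun w => mean n w ^+ 2).
Proof. by under eq_fun do rewrite meanE; exact: sum_sqr_L1. Qed.

Lemma array_mean_sqr n :
  \int[P]_w (mean n w ^+ 2) = \sum_(k < n) \int[P]_w (y n k w ^+ 2).
Proof. by under eq_Rintegral do rewrite meanE; exact: E_sum_sqr. Qed.

Lemma array_mean_sqr_bounded :
  exists2 C : R, 0 <= C & forall n, \int[P]_w (mean n w ^+ 2) <= C.
Proof.
have [_ iD [C DC] _] := lD.
have C0 : 0 <= C by apply: le_trans (DC 0%N); apply: E_ge0 => w; exact: sqr_ge0.
exists C => // n; rewrite array_mean_sqr; case: n => [|n]; first by rewrite big_ord0.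
apply: (@le_trans _ _ (\sum_(k < n.+1) n.+1%:R^-1 * C)).
  apply: ler_sum => k _; under eq_Rintegral do rewrite /y exprMn.
  rewrite EZ; last exact: array_L1_sqr.
  rewrite /s exprVn sqr_sqrtr // ler_wpM2l ?invr_ge0 //.
  by apply: le_trans (DC k); apply: E_le => //; exact: array_L1_sqr.
by rewrite sumr_const card_ord -[leLHS]mulr_natl mulrA divff ?mul1r // pnatr_eq0.
Qed.

(** [lind] is monotone in the absolute value, so Lindeberg's condition passes from [D] to every row
    of the array at once. What remains to be supplied is the limit of the variance. *)
Lemma array_clt (v c : R) : \int[P]_w (mean n w ^+ 2) @[n --> \oo] --> v ->
  \int[P]_w cos (mean n w + c) @[n --> \oo] --> expR (- (v / 2)) * cos c.
Proof.
move=> mv; under eq_fun do under eq_Rintegral do rewrite meanE.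
apply: lindeberg_clt => //.
  by under eq_fun do rewrite -array_mean_sqr.
have [_ _ _ l0] := lD.
apply: (squeeze_cvgr _ (cvg_cst 0) l0); apply: nearW => n.
rewrite sumr_ge0 /=; last by move=> k _; apply: E_ge0 => w; exact: lind_ge0.
apply: ler_sum => k _; apply: E_le.
- exact: L1_lind.
- exact: L1_lind_scale.
- by move=> w; apply: lind_mono; rewrite !normrM ler_wpM2l.
Qed.

End DominatedArray.

Lemma fun_of_family_measurable d (T : measurableType d) (R : realType)
  (I : choiceType) (F : I -> set_system T) (J : set I) (f : T -> R) :
  (forall i, F i `<=` measurable) -> fun_of_family F J f -> measurable_fun [set: T] f.
Proof.
move=> Fm mf _ A mA; have := mf measurableT A mA.
by apply: smallest_sub; [exact: sigma_algebra_measurable|exact: cylinders_measurable].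
Qed.

Section Score.
Context d (T : measurableType d) (R : realType) (P : probability T R).
Variables (p q : nat) (mo : ultrastructural P p q) (sM : 'cV[R]_p).
Hypotheses (hi : assumption_i mo) (hii : assumption_ii mo)
  (hiii : assumption_iii mo) (hiv : assumption_iv mo) (hv : assumption_v mo sM).
Hypothesis SigmaK_unit : Sigma mo sM *m K mo sM \in unitmx.
Hypothesis B_bounded : exists C : R, forall n i j, `|Bcoef mo n i j| <= C.

(** The transpose makes [u] the vector [stack_rows] of this matrix, the ordering in which the normal
    law and the Kronecker products are stated. *)
Definition score n w : 'M[R]_(p, q) :=
  ((h mo n w)^T + (Bcoef mo n)^T *m Kbar_X mo n *m H mo n w)^T.

Lemma uE n w : u mo n w = stack_rows (score n w).
Proof. by []. Qed.

Definition dev_score n k i j w : R := dev_xe mo k i j w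
  - \sum_l dev_xd mo k i l w * Bcoef mo n l j
  + \sum_a ((Bcoef mo n)^T *m Kbar_X mo n) j a * dev_xx mo k a i w.

Lemma X_entry n w k i : X mo n w k i = x_entry mo k i w.
Proof. by rewrite !mxE. Qed.

(** True at [n = 0] too, by [0^-1 = 0], so that the row formulas for [H] and [h] carry no side
    condition. *)
Lemma sqrt_mulVn n : Num.sqrt n%:R * n%:R^-1 = (Num.sqrt n%:R)^-1 :> R.
Proof.
case: n => [|n]; first by rewrite sqrtr0 mul0r invr0.
rewrite -[X in _ * X^-1](@sqr_sqrtr R n.+1%:R) // expr2 invfM mulrA divff ?mul1r //.
Qed.

Lemma sqrtVn_mul n : (Num.sqrt n%:R)^-1 * n%:R = Num.sqrt n%:R :> R.
Proof.
by rewrite -[RHS]invrK -[in RHS]sqrt_mulVn invfM invrK.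
Qed.

(** Since sqrt n = n^(-1/2) n, the centring by [Sigma_X] is n^(-1/2) times a sum of n row means and
    can be distributed over the rows. *)
Lemma H_entry n w i j :
  H mo n w i j = (Num.sqrt n%:R)^-1 * \sum_(k < n) dev_xx mo k i j w.
Proof.
have -> : H mo n w i j = (Num.sqrt n%:R)^-1 * ((X mo n w)^T *m X mo n w) i j -
    Num.sqrt n%:R * (n%:R^-1 * ((M_mx mo n)^T *m M_mx mo n) i j +
      s_psi mo ^+ 2 *+ (i == j) + s_delta mo ^+ 2 *+ (i == j)).
  rewrite /H /Sigma_X /Sigma_D.
  by move: (_^T *m X _ _ _) (_^T *m M_mx _ _) => XX MM; rewrite !mxE.
rewrite [(_ *m X _ _ _) i j]mxE [(_ *m M_mx _ _) i j]mxE.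
rewrite -addrA -mulrnDl mulrDr mulrA sqrt_mulVn -[X in X * (_ *+ _)]sqrtVn_mul.
rewrite -mulrA -mulrDr -mulrBr; congr (_ * _).
rewrite mulr_natl -[n in _ *+ _ *+ n]card_ord -sumr_const -big_split /= -sumrB.
apply: eq_bigr => k _.
by rewrite [(X mo n w)^T i k]mxE !X_entry /dev_xx [(M_mx mo n)^T i k]mxE ![M_mx _ _ _ _]mxE.
Qed.

(** In the same way the term with s_delta^2 B offsets, row by row, the mean of x delta' B. *)
Lemma h_entry n w i j : h mo n w i j = (Num.sqrt n%:R)^-1 *
  \sum_(k < n) (dev_xe mo k i j w - \sum_l dev_xd mo k i l w * Bcoef mo n l j).
Proof.
have -> : h mo n w i j = (Num.sqrt n%:R)^-1 *
    ((X mo n w)^T *m (E_mx mo n w - Delta_mx mo n w *m Bcoef mo n)) i j +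
    Num.sqrt n%:R * s_delta mo ^+ 2 * Bcoef mo n i j.
  by rewrite /h; move: ((X mo n w)^T *m _) => XE; rewrite !mxE.
rewrite [(_ *m _) i j]mxE -[X in X * _ * _]sqrtVn_mul -2!(mulrA (Num.sqrt _)^-1) -mulrDr.
congr (_ * _); rewrite -mulrA mulr_natl -[n in _ *+ n]card_ord -sumr_const -big_split /=.
apply: eq_bigr => k _.
have -> : (E_mx mo n w - Delta_mx mo n w *m Bcoef mo n) k j =
    E_mx mo n w k j - (Delta_mx mo n w *m Bcoef mo n) k j.
  by move: (_ *m _) => V; rewrite !mxE.
rewrite [(X mo n w)^T i k]mxE X_entry.
rewrite [E_mx mo n w k j]mxE [(_ *m _) k j]mxE mulrBr -addrA /dev_xe; congr (_ + _).
under [in LHS]eq_bigr => l _ do rewrite [Delta_mx mo n w k l]mxE.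
under [in RHS]eq_bigr do rewrite mulrBl.
rewrite sumrB opprB addrC; congr (_ + _).
  rewrite (bigD1 i) //= eqxx mulr1n big1 ?addr0 // => l li.
  by rewrite eq_sym (negbTE li) mulr0n mul0r.
by rewrite mulr_sumr; congr (- _); apply: eq_bigr => l _; rewrite mulrA.
Qed.

Lemma score_entry n w i j :
  score n w i j = (Num.sqrt n%:R)^-1 * \sum_(k < n) dev_score n k i j w.
Proof.
have -> : score n w i j = h mo n w i j +
    ((Bcoef mo n)^T *m Kbar_X mo n *m H mo n w) j i.
  by rewrite /score; move: (_ *m H _ _ _) (h _ _ _) => G h'; rewrite !mxE.
rewrite h_entry [(_ *m H _ _ _) j i]mxE [in RHS]big_split /= mulrDr; congr (_ + _).
rewrite exchange_big /= mulr_sumr; apply: eq_bigr => a _.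
by rewrite H_entry mulrCA mulr_sumr.
Qed.

Lemma dev_score_row n k i j :
  fun_of_family (model_family mo) (row_set k) (dev_score n k i j).
Proof.
apply: measurable_funD; first apply: measurable_funB.
- exact: dev_xe_row.
- by apply: measurable_sum => l; apply: measurable_funM => //; exact: dev_xd_row.
- by apply: measurable_sum => l; apply: measurable_funM => //; exact: dev_xx_row.
Qed.

Definition combination (c : 'I_p * 'I_q -> R) n k w : R :=
  \sum_ij c ij * dev_score n k ij.1 ij.2 w.

Lemma combination_score c n w : \sum_ij c ij * score n w ij.1 ij.2 =
  (Num.sqrt n%:R)^-1 * \sum_(k < n) combination c n k w.
Proof.
rewrite exchange_big /= mulr_sumr; apply: eq_bigr => ij _.
by rewrite score_entry mulrCA mulr_sumr.
Qed.

(** [D] is free of [n] because [Bcoef mo n] and [Kbar_X mo n] are replaced by their uniform bounds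
    [CB] and [CK]. *)
Lemma score_lindeberg i j :
  exists2 D, lindeberg_seq P D & forall n k w, `|dev_score n k i j w| <= `|D k w|.
Proof.
have [CM hM] := M_row_bounded hv; have [CB hB] := B_bounded.
have [CK hK] := Kbar_X_bounded hv SigmaK_unit.
have CB0 : 0 <= CB by apply: le_trans (hB 0%N i j).
have CK0 : 0 <= CK by apply: le_trans (hK 0%N i i).
have hBK n a : `|((Bcoef mo n)^T *m Kbar_X mo n) j a| <= \sum_(l < p) CB * CK.
  rewrite mxE (le_trans (ler_norm_sum _ _ _)) //; apply: ler_sum => l _.
  by rewrite normrM mxE ler_pM.
set G := \sum_(l < p) _ in hBK.
have G0 : 0 <= G by apply: le_trans (hBK 0%N i).
pose D k w := `|dev_xe mo k i j w| + \sum_l CB * `|dev_xd mo k i l w|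
  + \sum_a G * `|dev_xx mo k a i w|.
have D0 k w : 0 <= D k w by rewrite !addr_ge0 ?sumr_ge0 // => l _; rewrite mulr_ge0.
exists D.
  apply: lindeberg_add; first apply: lindeberg_add.
  - by apply: lindeberg_norm; exact: lindeberg_xe.
  - apply: lindeberg_sum => l; apply: lindeberg_scale; apply: lindeberg_norm.
    exact: lindeberg_xd hM _ _.
  - apply: lindeberg_sum => l; apply: lindeberg_scale; apply: lindeberg_norm.
    exact: lindeberg_xx hM _ _.
move=> n k w; rewrite (ger0_norm (D0 k w)) (le_trans (ler_normD _ _)) // lerD //.
  rewrite (le_trans (ler_normB _ _)) // lerD2l (le_trans (ler_norm_sum _ _ _)) //.
  by apply: ler_sum => l _; rewrite normrM mulrC ler_wpM2r.
rewrite (le_trans (ler_norm_sum _ _ _)) //; apply: ler_sum => l _.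
by rewrite normrM ler_wpM2r.
Qed.

Lemma E_dev_score n k i j : \int[P]_w dev_score n k i j w = 0.
Proof.
have [CM hM] := M_row_bounded hv.
have lind_L1 f : lindeberg_seq P f -> L1 P (f k).
  by case=> mf if2 _ _; exact: L1_of_sqr.
have ixe := lind_L1 _ (lindeberg_xe hi hii hiii hiv hM i j).
have ixd l := lind_L1 _ (lindeberg_xd hii hiii hM i l).
have ixx a b := lind_L1 _ (lindeberg_xx hii hiii hM a b).
have i1 : L1 P (fun w => \sum_l dev_xd mo k i l w * Bcoef mo n l j).
  by apply: L1_sum => l; under eq_fun do rewrite mulrC; exact: L1Z.
rewrite ED; [|exact: L1B|by apply: L1_sum => a; exact: L1Z].
rewrite EB // (E_dev_xe hi hii hiii hiv hM) // !Esum; first last.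
- by move=> l; under eq_fun do rewrite mulrC; exact: L1Z.
- by move=> a; exact: L1Z.
rewrite big1 ?subr0 ?big1 ?addr0 // => l _.
  by rewrite EZ // (E_dev_xx hi hii hiii hiv hM) mulr0.
by under eq_Rintegral do rewrite mulrC; rewrite EZ // (E_dev_xd hi hii hiii hiv hM) mulr0.
Qed.

Section Combination.
Variable c : 'I_p * 'I_q -> R.

Lemma combination_lindeberg :
  exists2 D, lindeberg_seq P D & forall n k w, `|combination c n k w| <= `|D k w|.
Proof.
have bnd (ij : 'I_p * 'I_q) : exists D, lindeberg_seq P D /\
    forall n k w, `|dev_score n k ij.1 ij.2 w| <= `|D k w|.
  by have [D lD hD] := score_lindeberg ij.1 ij.2; exists D.
have [D hD] := choice bnd.
exists (fun k w => \sum_ij `|c ij| * `|D ij k w|).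
  by apply: lindeberg_sum => ij; apply/lindeberg_scale/lindeberg_norm; have [] := hD ij.
move=> n k w; rewrite [leRHS]ger0_norm; last by apply: sumr_ge0 => ij _; rewrite mulr_ge0.
rewrite (le_trans (ler_norm_sum _ _ _)) //; apply: ler_sum => ij _.
by rewrite normrM ler_wpM2l //; have [_] := hD ij; exact.
Qed.

Lemma combination_row n k :
  fun_of_family (model_family mo) (row_set k) (combination c n k).
Proof.
by apply: measurable_sum => ij; apply: measurable_funM => //; exact: dev_score_row.
Qed.

Lemma combination_measurable n k : measurable_fun [set: T] (combination c n k).
Proof. exact: fun_of_family_measurable (@model_family_measurable _ _ _ _ _ _ mo)
  (@combination_row n k). Qed.

Lemma dev_score_L1 n k i j : L1 P (dev_score n k i j).
Proof.
have [D lD hD] := score_lindeberg i j.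
have m : measurable_fun [set: T] (dev_score n k i j).
  exact: fun_of_family_measurable (@model_family_measurable _ _ _ _ _ _ mo) (@dev_score_row
    n k i j).
apply: L1_of_sqr => //; apply: (array_L1_sqr (z := fun n k => dev_score n k i j) lD) => //.
by move=> *; exact: fun_of_family_measurable (@model_family_measurable _ _ _ _ _ _ mo)
  (@dev_score_row _ _ i j).
Qed.

Lemma E_combination n k : \int[P]_w combination c n k w = 0.
Proof.
rewrite Esum; last by move=> ij; apply: L1Z; exact: dev_score_L1.
by rewrite big1 // => ij _; rewrite EZ ?E_dev_score ?mulr0 //; exact: dev_score_L1.
Qed.

Lemma combination_indep n k :
  indep_fun P (fun w => \sum_(l < k) combination c n l w) (combination c n k).
Proof. by apply: (past_row_indep hi hii hiii hiv) => // l; exact: combination_row. Qed.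

Definition linear_score n w : R := \sum_ij c ij * score n w ij.1 ij.2.

Lemma linear_score_L1_sqr n : L1 P (fun w => linear_score n w ^+ 2).
Proof.
have [D lD hD] := combination_lindeberg.
under eq_fun do rewrite /linear_score combination_score.
exact: (array_mean_L1_sqr lD combination_measurable hD).
Qed.

Lemma linear_score_bounded :
  exists2 C : R, 0 <= C & forall n, \int[P]_w (linear_score n w ^+ 2) <= C.
Proof.
have [D lD hD] := combination_lindeberg.
have [C C0 hC] := array_mean_sqr_bounded lD combination_measurable hD E_combination
  combination_indep.
by exists C => // n; under eq_Rintegral do rewrite /linear_score combination_score.
Qed.

Lemma linear_score_clt (v a : R) :
  \int[P]_w (linear_score n w ^+ 2) @[n --> \oo] --> v ->
  \int[P]_w cos (linear_score n w + a) @[n --> \oo] --> expR (- (v / 2)) * cos a.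
Proof.
have [D lD hD] := combination_lindeberg.
under eq_fun do under eq_Rintegral do rewrite /linear_score combination_score.
move=> hv'; under eq_fun do under eq_Rintegral do rewrite /linear_score combination_score.
exact: (array_clt lD combination_measurable hD E_combination combination_indep).
Qed.

End Combination.

End Score.

Lemma expectation_mxE d (T : measurableType d) (R : realType) (P : probability T R) a b
  (Y : T -> 'M[R]_(a, b)) i j : expectation_mx P Y i j = \int[P]_w Y w i j.
Proof. by rewrite mxE unlock. Qed.

Section ScoreLimit.
Context d (T : measurableType d) (R : realType) (P : probability T R).
Variables (p q : nat) (mo : ultrastructural P p q) (sM : 'cV[R]_p).
Variable Lambda : 'M[R]_(p * q).
Hypotheses (hi : assumption_i mo) (hii : assumption_ii mo)
  (hiii : assumption_iii mo) (hiv : assumption_iv mo) (hv : assumption_v mo sM).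
Hypothesis SigmaK_unit : Sigma mo sM *m K mo sM \in unitmx.
Hypothesis B_bounded : exists C : R, forall n i j, `|Bcoef mo n i j| <= C.
Hypothesis hLambda :
  expectation_mx P (fun w => u mo n w *m (u mo n w)^T) @[n --> \oo] --> Lambda.

Lemma pairing_linear_score (t : 'cV[R]_(p * q)) n w : (t^T *m u mo n w) 0 0 =
  linear_score mo (fun ij => t (mxvec_index ij.1 ij.2) 0) n w.
Proof.
rewrite uE mxE /linear_score (reindex _ (curry_mxvec_bij p q)) /=.
by apply: eq_bigr => -[i j] _; rewrite [t^T _ _]mxE [stack_rows _ _ _]mxE mxvecE.
Qed.

Lemma u_entry_linear_score a n w :
  u mo n w a 0 = linear_score mo (fun ij => (a == mxvec_index ij.1 ij.2)%:R) n w.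
Proof.
have := pairing_linear_score (delta_mx a 0) n w.
rewrite trmx_delta -rowE mxE => ->; apply: eq_bigr => ij _.
by rewrite mxE eqxx andbT eq_sym.
Qed.

Lemma score_measurable n : random_mx (score mo n).
Proof.
move=> i j; under eq_fun do rewrite score_entry.
apply: measurable_funM => //; apply: measurable_sum => k.
exact: fun_of_family_measurable (@model_family_measurable _ _ _ _ _ _ mo) (@dev_score_row _
  _ _ _ _ _ _ n k i j).
Qed.

Lemma u_entry_measurable n a : measurable_fun [set: T] (fun w => u mo n w a 0).
Proof.
under eq_fun do rewrite uE mxE.
by apply: measurable_mxvec; exact: score_measurable.
Qed.

Lemma u_entry_L1_sqr n a : L1 P (fun w => u mo n w a 0 ^+ 2).
Proof.
under eq_fun do rewrite u_entry_linear_score.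
exact: (linear_score_L1_sqr hi hii hiii hiv hv SigmaK_unit B_bounded).
Qed.

Lemma E_pairing_sqr (t : 'cV[R]_(p * q)) n :
  \int[P]_w ((t^T *m u mo n w) 0 0 ^+ 2) =
  (t^T *m expectation_mx P (fun w => u mo n w *m (u mo n w)^T) *m t) 0 0.
Proof.
have iuu a b : L1 P (fun w => u mo n w a 0 * u mo n w b 0).
  by apply: L1M_of_sqr; [exact: u_entry_measurable|exact: u_entry_measurable|
    exact: u_entry_L1_sqr|exact: u_entry_L1_sqr].
transitivity (\int[P]_w (\sum_b \sum_a (t a 0 * t b 0) * (u mo n w a 0 * u mo n w b 0))).
  apply: eq_Rintegral => w _; rewrite expr2 mxE big_distrr /=.
  apply: eq_bigr => b _; rewrite big_distrl /=; apply: eq_bigr => a _.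
  by rewrite [t^T 0 a]mxE [t^T 0 b]mxE; ring.
rewrite Esum; last by move=> b; apply: L1_sum => a; exact: L1Z.
rewrite mxE; apply: eq_bigr => b _; rewrite Esum; last by move=> a; exact: L1Z.
rewrite mxE big_distrl /=; apply: eq_bigr => a _.
rewrite EZ // expectation_mxE [t^T 0 a]mxE.
under [in RHS]eq_Rintegral => w _ do rewrite mxE big_ord1 [(u mo n w)^T _ _]mxE.
by ring.
Qed.

Lemma E_pairing_sqr_cvg (t : 'cV[R]_(p * q)) :
  \int[P]_w ((t^T *m u mo n w) 0 0 ^+ 2) @[n --> \oo] --> (t^T *m Lambda *m t) 0 0.
Proof.
under eq_fun do rewrite E_pairing_sqr.
apply: cvg_entriesM; last exact: cvg_entries_cst.
apply: cvg_entriesM; first exact: cvg_entries_cst.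
exact: cvg_mx_entries hLambda.
Qed.

Lemma Lambda_psd (t : 'cV[R]_(p * q)) : 0 <= (t^T *m Lambda *m t) 0 0.
Proof.
have h := @E_pairing_sqr_cvg t.
rewrite -(cvg_lim _ h) //; apply: limr_ge; first exact: cvgP h.
by apply: nearW => n; apply: E_ge0 => w; exact: sqr_ge0.
Qed.

Lemma Lambda_sym : Lambda^T = Lambda.
Proof.
apply/matrixP => i j; rewrite mxE.
have h a b : expectation_mx P (fun w => u mo n w *m (u mo n w)^T) a b @[n --> \oo] -->
    Lambda a b by exact: cvg_mx_entries hLambda _ _.
have E n : expectation_mx P (fun w => u mo n w *m (u mo n w)^T) j i =
    expectation_mx P (fun w => u mo n w *m (u mo n w)^T) i j.
  rewrite !expectation_mxE; apply: eq_Rintegral => w _.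
  by rewrite !mxE !big_ord1 !mxE mulrC.
have := h j i; under eq_fun do rewrite E; move=> hji.
exact: cvg_unique hji (h i j).
Qed.

(** The variance of each linear combination is a quadratic form in E [u_n u_n'], so the convergence
    required by [array_clt] is the existence of [Lambda]. *)
Lemma score_clt (t : 'cV[R]_(p * q)) (c : R) :
  \int[P]_w cos ((t^T *m u mo n w) 0 0 + c) @[n --> \oo] -->
  expR (- ((t^T *m Lambda *m t) 0 0 / 2)) * cos c.
Proof.
under eq_fun do under eq_Rintegral do rewrite pairing_linear_score.
apply: (linear_score_clt hi hii hiii hiv hv SigmaK_unit B_bounded).
have := @E_pairing_sqr_cvg t.
by under eq_fun do under eq_Rintegral do rewrite pairing_linear_score.
Qed.

Lemma u_entry_bounded : exists2 C : R, 0 <= C &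
  forall n a, \int[P]_w (u mo n w a 0 ^+ 2) <= C.
Proof.
have bnd a : exists C : R, 0 <= C /\ forall n, \int[P]_w (u mo n w a 0 ^+ 2) <= C.
  have [C C0 hC] := linear_score_bounded hi hii hiii hiv hv SigmaK_unit B_bounded
    (fun ij => (a == mxvec_index ij.1 ij.2)%:R).
  by exists C; split => // n; under eq_Rintegral do rewrite u_entry_linear_score.
have [C hC] := choice bnd.
exists (\sum_a C a); first by apply: sumr_ge0 => a _; have [] := hC a.
move=> n a; have [_ /(_ n) /le_trans] := hC a; apply.
by rewrite (bigD1 a) //= lerDl sumr_ge0 // => b _; have [] := hC b.
Qed.

Lemma H_entry_bounded : exists2 C : R, 0 <= C &
  forall n i j, L1 P (fun w => H mo n w i j ^+ 2) /\
    \int[P]_w (H mo n w i j ^+ 2) <= C.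
Proof.
have [CM hM] := M_row_bounded hv.
have mxx i j (n k : nat) : measurable_fun [set: T] (dev_xx mo k i j).
  exact: fun_of_family_measurable (@model_family_measurable _ _ _ _ _ _ mo) (@dev_xx_row _
    _ _ _ _ _ mo k i j).
have bnd (ij : 'I_p * 'I_p) : exists C : R, 0 <= C /\ forall n,
    L1 P (fun w => H mo n w ij.1 ij.2 ^+ 2) /\
    \int[P]_w (H mo n w ij.1 ij.2 ^+ 2) <= C.
  case: ij => i j /=.
  have lxx := lindeberg_xx hii hiii hM i j.
  have Exx (n k : nat) := E_dev_xx hi hii hiii hiv hM k i j.
  have indxx (n k : nat) : indep_fun P (fun w => \sum_(l < k) dev_xx mo l i j w) (dev_xx mo k i j).
    apply: (@past_row_indep _ _ _ _ _ _ _ hi hii hiii hiv k (fun k => dev_xx mo k i j)) => l.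
    exact: dev_xx_row.
  have bxx (n k : nat) w : `|dev_xx mo k i j w| <= `|dev_xx mo k i j w| by [].
  have [C C0 hC] := array_mean_sqr_bounded (z := fun _ k => dev_xx mo k i j) lxx (mxx i j)
    bxx Exx indxx.
  exists C; split => // n; under eq_fun do rewrite H_entry.
  under eq_Rintegral do rewrite H_entry; split => //.
  exact: (array_mean_L1_sqr (z := fun _ k => dev_xx mo k i j) lxx (mxx i j) bxx).
have [C hC] := choice bnd.
exists (\sum_ij C ij); first by apply: sumr_ge0 => a _; have [] := hC a.
move=> n i j; have [_ /(_ n) [? /le_trans h]] := hC (i, j); split => //; apply: h.
by rewrite (bigD1 (i, j)) //= lerDl sumr_ge0 // => b _; have [] := hC b.
Qed.

End ScoreLimit.

(** * Convergence in probability as a filter *)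

Section HighProbability.
Context d (T : measurableType d) (R : realType) (P : probability T R).

Lemma measureU_le (A B : set T) (e : R) : measurable A -> measurable B ->
  (P A <= (e / 2)%:E)%E -> (P B <= (e / 2)%:E)%E -> (P (A `|` B) <= e%:E)%E.
Proof.
move=> mA mB PA PB; rewrite (le_trans (measureU2 _ _ _)) // [X in X%:E](splitr e) EFinD.
exact: leeD.
Qed.

(* Convergence along [whp] of x |-> f x.1 x.2 is convergence in probability of
   f n, so that the calculus of limits along filters, in particular [cvgM] and
   [cvgV], applies to it. *)
Definition whp : set_system (nat * T) := [set A | forall e : R, 0 < e ->
  \forall n \near \oo, exists B, [/\ measurable B, (P B <= e%:E)%E &
    forall w, ~ B w -> A (n, w)]].

Global Instance whp_filter : Filter whp.
Proof.
split.
- move=> e e0; apply: nearW => n; exists set0; split => //.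
  by rewrite measure0 lee_fin ltW.
- move=> A A' hA hA' e e0; have e20 : 0 < e / 2 by lra.
  have := hA _ e20; have := hA' _ e20; apply: filterS2 => n [B' [mB' PB' h']] [B [mB PB h]].
  exists (B `|` B'); split.
  + exact: measurableU.
  + exact: measureU_le.
  + by move=> w nBB'; split; [apply: h|apply: h'] => ?; apply: nBB'; [left|right].
- move=> A A' AA' hA e e0; have := hA _ e0; apply: filterS => n [B [mB PB h]].
  by exists B; split => // w /h /AA'.
Qed.

Lemma whp_near (Q : nat -> Prop) : (\forall n \near \oo, Q n) ->
  \forall x \near whp, Q x.1.
Proof.
move=> hQ e e0; move: hQ; apply: filterS => n Qn; exists set0; split => //.
by rewrite measure0 lee_fin ltW.
Qed.

Lemma whp_cvg (f : nat -> R) (l : R) : f n @[n --> \oo] --> l -> f x.1 @[x --> whp] --> l.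
Proof.
move=> /cvgrPdist_le fl; apply/cvgrPdist_le => e e0.
exact: whp_near (fl e e0).
Qed.

Lemma whp_cvg_prob (f : nat -> T -> R) (l : R) :
  (forall n, measurable_fun [set: T] (f n)) ->
  (forall e : R, 0 < e -> P [set w | e <= `|f n w - l|] @[n --> \oo] --> 0%E) ->
  f x.1 x.2 @[x --> whp] --> l.
Proof.
move=> mf fl; apply/cvgrPdist_lt => e e0 k k0.
have : \forall n \near \oo, (P [set w | (e <= `|f n w - l|)%R] < k%:E)%E.
  apply: (fl e e0 [set x | (x < k%:E)%E]); apply: open_nbhs_nbhs.
  by split; [exact: open_ereal_lt_ereal|rewrite /= lte_fin].
apply: filterS => n Pn; exists [set w | e <= `|f n w - l|]; split.
- apply: measurable_ge; apply: measurableT_comp => //.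
  exact: measurable_funB.
- exact: ltW.
- by move=> w /negP; rewrite -ltNge distrC.
Qed.

Lemma whp_cvg0_L1 (f : nat -> T -> R) (c : nat -> R) : (forall n, L1 P (fun w => f n w ^+ 2)) ->
  (forall n, measurable_fun [set: T] (f n)) ->
  (\forall n \near \oo, \int[P]_w (f n w ^+ 2) <= c n) -> c n @[n --> \oo] --> 0 ->
  f x.1 x.2 @[x --> whp] --> 0.
Proof.
move=> f2 mf fc c0; apply: whp_cvg_prob => // e e0.
apply: (@squeeze_cvge _ _ _ _ (fun=> 0%E) _ (fun n => ((e ^+ 2)^-1 * c n)%:E)).
- move: fc; apply: filterS => n fcn.
  rewrite measure_ge0 /= (le_trans _ (_ : (((e ^+ 2)^-1 * \int[P]_w (f n w ^+ 2))%:E <= _)%E)) //.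
    apply: (le_trans _ (E_markov (f2 n) _ _)); last 2 first.
    + by move=> w; exact: sqr_ge0.
    + by rewrite exprn_gt0.
    rewrite (_ : [set w | e <= _] = [set w | e ^+ 2 <= f n w ^+ 2]) //.
    apply/seteqP; split => w /=; rewrite subr0 -(real_normK (num_real (f n w)));
      by rewrite ler_pXn2r ?nnegrE // ltW.
  by rewrite lee_fin ler_wpM2l // invr_ge0 exprn_ge0 // ltW.
- exact: cvg_cst.
- by apply: cvg_EFin; [exact: nearW|exact: cvg_scale0].
Qed.

(* f n = O_P(1). *)
Definition sbounded (f : nat -> T -> R) := forall e : R, 0 < e -> exists L : R,
  \forall n \near \oo, exists B, [/\ measurable B, (P B <= e%:E)%E &
    forall w, ~ B w -> `|f n w| <= L].

Lemma sbounded_cvg (f : nat -> T -> R) (l : R) : f x.1 x.2 @[x --> whp] --> l -> sbounded f.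
Proof.
move=> /cvgrPdist_le /(_ 1 ltr01) h e e0; exists (`|l| + 1).
have := h e e0; apply: filterS => n [B [mB PB hB]]; exists B; split => // w /hB /= lf.
rewrite -(subrK l (f n w)) addrC (le_trans (ler_normD _ _)) // lerD2l.
by rewrite distrC.
Qed.

Lemma sboundedD f g : sbounded f -> sbounded g -> sbounded (fun n w => f n w + g n w).
Proof.
move=> bf bg e e0; have e20 : 0 < e / 2 by lra.
have [L hL] := bf _ e20; have [L' hL'] := bg _ e20; exists (L + L').
move: hL hL'; apply: filterS2 => n [B [mB PB h]] [B' [mB' PB' h']].
exists (B `|` B'); split.
- exact: measurableU.
- exact: measureU_le.
- move=> w nBB'; rewrite (le_trans (ler_normD _ _)) // lerD //.
  + by apply: h => ?; apply: nBB'; left.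
  + by apply: h' => ?; apply: nBB'; right.
Qed.

Lemma sboundedM f g : sbounded f -> sbounded g -> sbounded (fun n w => f n w * g n w).
Proof.
move=> bf bg e e0; have e20 : 0 < e / 2 by lra.
have [L hL] := bf _ e20; have [L' hL'] := bg _ e20; exists (L * L').
move: hL hL'; apply: filterS2 => n [B [mB PB h]] [B' [mB' PB' h']].
exists (B `|` B'); split.
- exact: measurableU.
- exact: measureU_le.
- move=> w nBB'; rewrite normrM ler_pM //.
  + by apply: h => ?; apply: nBB'; left.
  + by apply: h' => ?; apply: nBB'; right.
Qed.

Lemma sbounded_cst (c : R) : sbounded (fun _ _ => c).
Proof. by apply: (@sbounded_cvg _ c); exact: cvg_cst. Qed.

Lemma sbounded_norm f : sbounded f -> sbounded (fun n w => `|f n w|).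
Proof.
move=> bf e e0; have [L hL] := bf e e0; exists L; move: hL; apply: filterS => n [B [mB PB h]].
by exists B; split => // w /h; rewrite normr_id.
Qed.

Lemma sbounded_sum (I : Type) (r : seq I) (f : I -> nat -> T -> R) :
  (forall i, sbounded (f i)) -> sbounded (fun n w => \sum_(i <- r) f i n w).
Proof.
move=> bf; elim: r => [|i r IHr].
  by under eq_fun do under eq_fun do rewrite big_nil; exact: sbounded_cst.
under eq_fun do under eq_fun do rewrite big_cons.
exact: sboundedD.
Qed.

Lemma sbounded_L2 (f : nat -> T -> R) (C : R) : (forall n, L1 P (fun w => f n w ^+ 2)) ->
  (forall n, \int[P]_w (f n w ^+ 2) <= C) -> sbounded f.
Proof.
move=> f2 fC e e0.
have C0 : 0 <= C by apply: le_trans (fC 0%N); apply: E_ge0 => w; exact: sqr_ge0.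
(* Markov's inequality bounds the probability of f^2 >= K by C / K <= e. Off this event |f| <= K +
   1, which avoids a square root; the [+ 1] in [K] keeps it positive when [C = 0]. *)
pose K := (C + 1) / e; have K0 : 0 < K by rewrite divr_gt0 //; lra.
exists (K + 1); apply: nearW => n; exists [set w | K <= f n w ^+ 2]; split.
- by apply: measurable_ge; exact: L1_measurable (f2 n).
- rewrite (le_trans (E_markov (f2 n) _ K0)) //; first by move=> w; exact: sqr_ge0.
  rewrite lee_fin ler_pdivrMl // (le_trans (fC n)) // /K divfK ?gt_eqF //; lra.
- move=> w /negP; rewrite -ltNge -(real_normK (num_real (f n w))) => fK.
  rewrite leNgt; apply/negP => Kf; move: fK; rewrite ltNge => /negP; apply.
  rewrite expr2 (le_trans (_ : K <= 1 * `|f n w|)) ?ler_wpM2r ?mul1r //; lra.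
Qed.

Lemma whp_cvg0M (f g : nat -> T -> R) : f x.1 x.2 @[x --> whp] --> 0 -> sbounded g ->
  f x.1 x.2 * g x.1 x.2 @[x --> whp] --> 0.
Proof.
move=> /cvgrPdist_le f0 bg; apply/cvgrPdist_le => k k0 e e0.
have e20 : 0 < e / 2 by lra.
have [L hL] := bg _ e20.
have L0 : 0 < `|L| + 1 by rewrite ltr_pwDr.
have kL : 0 < k / (`|L| + 1) by rewrite divr_gt0.
move: hL (f0 _ kL _ e20); apply: filterS2 => n [B [mB PB h]] [B' [mB' PB' h']].
exists (B `|` B'); split.
- exact: measurableU.
- exact: measureU_le.
- move=> w nBB'; have /h gL : ~ B w by move=> ?; apply: nBB'; left.
  have /h' /= : ~ B' w by move=> ?; apply: nBB'; right.
  rewrite !sub0r !normrN normrM ler_pdivlMr // => fk; rewrite (le_trans _ fk) //.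
  by rewrite ler_wpM2l // (le_trans gL) // (le_trans (ler_norm L)) // lerDl.
Qed.

Lemma cos_lip (x y : R) : `|cos x - cos y| <= `|x - y|.
Proof.
wlog xy : x y / y <= x.
  by move=> h; have [/h//|/ltW/h] := leP y x; rewrite distrC [X in _ <= X]distrC.
have [z] := @MVT_segment R (cos : R -> R) (fun z => - sin z) y x xy
  (fun z _ => is_derive_cos z) (continuous_subspaceT (@continuous_cos R)).
by move=> _ ->; rewrite normrM normrN ler_piMl // sin_max.
Qed.

Lemma cos_slutsky (Y W : nat -> T -> R) (c l : R) :
  (forall n, measurable_fun [set: T] (Y n)) -> (forall n, measurable_fun [set: T] (W n)) ->
  Y x.1 x.2 - W x.1 x.2 @[x --> whp] --> 0 ->
  \int[P]_w cos (W n w + c) @[n --> \oo] --> l ->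
  \int[P]_w cos (Y n w + c) @[n --> \oo] --> l.
Proof.
move=> mY mW /cvgrPdist_le YW Wl.
suff : \int[P]_w cos (Y n w + c) - \int[P]_w cos (W n w + c) @[n --> \oo] --> 0.
  move=> h; have : \int[P]_w cos (Y n w + c) - \int[P]_w cos (W n w + c) +
      \int[P]_w cos (W n w + c) @[n --> \oo] --> 0 + l by exact: cvgD.
  by under eq_fun do rewrite subrK; rewrite add0r.
apply/cvgrPdist_le => e e0.
(* Off an event of probability at most e / 3 the cosines differ by at most e / 3; on it they differ
   by at most 2. *)
have e30 : 0 < e / 3 by lra.
have := YW _ e30 _ e30; apply: filterS => n [B [mB PB hB]].
have mc (Z : T -> R) : measurable_fun [set: T] Z -> L1 P (fun w => cos (Z w + c)).
  by move=> mZ; apply: L1_cos; exact: measurable_funD.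
rewrite sub0r normrN -EB; [|exact: mc|exact: mc].
have i1 : L1 P (fun w => e / 3 + 2 * \1_B w).
  by apply: L1D; [exact: L1_cst|apply: L1Z; exact: L1_indic].
apply: (le_trans (E_norm_le _ i1 _)).
- by apply: measurable_funB; apply: measurable_cos_fun; exact: measurable_funD.
- move=> w; rewrite indicE; have [Bw|nBw] := pselect (B w).
    rewrite mem_set // mulr1 (le_trans (ler_normB _ _)) //.
    by have := cos_max (Y n w + c); have := cos_max (W n w + c); lra.
  rewrite memNset // mulr0 addr0 (le_trans (cos_lip _ _)) //.
  have := hB w nBw; rewrite /= sub0r normrN.
  by rewrite opprD addrACA subrr addr0.
- rewrite ED; [|exact: L1_cst|by apply: L1Z; exact: L1_indic].
  rewrite (EZ 2 (L1_indic P mB)) Ecst E_indic //.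
  have : fine (P B) <= e / 3 by rewrite -lee_fin fineK // fin_num_measure.
  lra.
Qed.

End HighProbability.

Section BoundedMatrices.
Context d (T : measurableType d) (R : realType) (P : probability T R).

Definition sbounded_mx a b (A : nat -> T -> 'M[R]_(a, b)) :=
  forall i j, sbounded P (fun n w => A n w i j).

Lemma sbounded_mx_cvg a b (A : nat -> T -> 'M[R]_(a, b)) L :
  cvg_entries (whp P) (fun x => A x.1 x.2) L -> sbounded_mx A.
Proof. by move=> AL i j; exact: (@sbounded_cvg _ _ _ _ (fun n w => A n w i j)) (AL i j). Qed.

Lemma sbounded_mxD a b (A B : nat -> T -> 'M[R]_(a, b)) :
  sbounded_mx A -> sbounded_mx B -> sbounded_mx (fun n w => A n w + B n w).
Proof.
by move=> bA bB i j; under eq_fun do under eq_fun do rewrite mxE; exact: sboundedD.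
Qed.

Lemma sbounded_mxM a b c (A : nat -> T -> 'M[R]_(a, b)) (B : nat -> T -> 'M[R]_(b, c)) :
  sbounded_mx A -> sbounded_mx B -> sbounded_mx (fun n w => A n w *m B n w).
Proof.
move=> bA bB i j; under eq_fun do under eq_fun do rewrite mxE.
by apply: sbounded_sum => k; exact: sboundedM.
Qed.

Lemma sbounded_mx_cst a b (A : 'M[R]_(a, b)) : sbounded_mx (fun _ _ => A).
Proof. by move=> i j; exact: sbounded_cst. Qed.

Lemma cvg0_mulmxr a b c (A : nat -> T -> 'M[R]_(a, b)) (B : nat -> T -> 'M[R]_(b, c)) :
  cvg_entries (whp P) (fun x => A x.1 x.2) 0 -> sbounded_mx B ->
  cvg_entries (whp P) (fun x => A x.1 x.2 *m B x.1 x.2) 0.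
Proof.
move=> A0 bB i j; under eq_fun do rewrite mxE.
have -> : (0 : 'M[R]_(a, c)) i j = \sum_(k < b) 0 by rewrite mxE big1.
apply: (@cvg_sum_seq _ _ (whp P) _ _ _ (fun k x => A x.1 x.2 i k * B x.1 x.2 k j) (fun=> 0)) => k.
apply: (@whp_cvg0M _ _ _ _ (fun n w => A n w i k) (fun n w => B n w k j)) => //.
by have := A0 i k; rewrite mxE.
Qed.

End BoundedMatrices.

(** * Measurability of matrix operations *)

Section RandomMatrixOperations.
Context d (T : measurableType d) (R : realType).

Lemma random_mx_cst a b (C : 'M[R]_(a, b)) : random_mx (fun _ : T => C).
Proof. by move=> i j. Qed.

Lemma random_mxD a b (A B : T -> 'M[R]_(a, b)) : random_mx A -> random_mx B ->
  random_mx (fun w => A w + B w).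
Proof.
by move=> mA mB i j; under eq_fun do rewrite mxE; exact: measurable_funD.
Qed.

Lemma random_mxN a b (A : T -> 'M[R]_(a, b)) : random_mx A -> random_mx (fun w => - A w).
Proof.
move=> mA i j; under eq_fun do rewrite mxE -mulN1r.
exact: measurable_funM.
Qed.

Lemma random_mxZ a b c (A : T -> 'M[R]_(a, b)) : random_mx A -> random_mx (fun w => c *: A w).
Proof.
by move=> mA i j; under eq_fun do rewrite mxE; exact: measurable_funM.
Qed.

Lemma random_mxM a b c (A : T -> 'M[R]_(a, b)) (B : T -> 'M[R]_(b, c)) :
  random_mx A -> random_mx B -> random_mx (fun w => A w *m B w).
Proof.
move=> mA mB i j; under eq_fun do rewrite mxE.
by apply: measurable_sum => k; exact: measurable_funM.
Qed.

Lemma random_mx_tr a b (A : T -> 'M[R]_(a, b)) : random_mx A -> random_mx (fun w => (A w)^T).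
Proof. by move=> mA i j; under eq_fun do rewrite mxE; exact: mA. Qed.

Lemma random_col_mx a b c (A : T -> 'M[R]_(a, c)) (B : T -> 'M[R]_(b, c)) :
  random_mx A -> random_mx B -> random_mx (fun w => col_mx (A w) (B w)).
Proof.
move=> mA mB i j; under eq_fun do rewrite mxE.
by case: fintype.split => k; [exact: mA|exact: mB].
Qed.

Lemma measurable_det a (A : T -> 'M[R]_a) : random_mx A ->
  measurable_fun [set: T] (fun w => \det (A w)).
Proof.
move=> mA; apply: measurable_sum => s; apply: measurable_funM => //.
by apply: measurable_prod => i _; exact: mA.
Qed.

Lemma measurable_inv : measurable_fun [set: R] (fun x : R => x^-1).
Proof.
have -> : (fun x : R => x^-1) = (fun x => if x == 0 then 0 else x^-1).
  by apply/funext => x; case: eqP => // ->; rewrite invr0.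
apply: measurable_fun_if => //; first exact: measurable_fun_eqr.
rewrite setTI (_ : _ @^-1` _ = [set x : R | x != 0]); last first.
  by apply/seteqP; split => x /=; case: eqP.
apply: open_continuous_measurable_fun; first exact: open_neq.
by move=> x; rewrite inE /= => x0; exact: inv_continuous.
Qed.

Lemma random_mx_inv a (A : T -> 'M[R]_a) : random_mx A -> random_mx (fun w => invmx (A w)).
Proof.
move=> mA i j.
(* [invmx] returns a singular matrix unchanged, hence the first branch. *)
have -> : (fun w => invmx (A w) i j) = (fun w => if \det (A w) == 0 then A w i j else
    (\det (A w))^-1 * cofactor (A w) j i).
  apply/funext => w; rewrite /invmx unitmxE unitfE.
  by case: eqP => //= _; rewrite !mxE.
have md := measurable_det mA.
apply: measurable_fun_if => //; first exact: measurable_fun_eqr.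
  by apply: measurable_funTS; exact: mA.
apply: measurable_funTS; apply: measurable_funM.
  by apply: measurableT_comp; [exact: measurable_inv|].
apply: measurable_funM => //; apply: measurable_det => k l.
by under eq_fun do rewrite !mxE; exact: mA.
Qed.

End RandomMatrixOperations.

(** * Estimation errors *)

Lemma unitmx_row_free0 (R : fieldType) a (A : 'M[R]_a) :
  (forall v : 'rV[R]_a, v *m A = 0 -> v = 0) -> A \in unitmx.
Proof.
move=> A0; rewrite -row_free_unit -kermx_eq0; apply/eqP/row_matrixP => i.
by rewrite row0; apply: A0; rewrite -row_mul mulmx_ker row0.
Qed.

Lemma invmx_mul (R : fieldType) a (M N : 'M[R]_a) : M *m N \in unitmx ->
  invmx (M *m N) = invmx N *m invmx M.
Proof.
move=> MN; have := MN; rewrite unitmx_mul => /andP[Mu Nu].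
apply: (can_inj (mulKmx MN)).
by rewrite mulmxV // -mulmxA [N *m _]mulmxA mulmxV // mul1mx mulmxV.
Qed.

Section PositiveDefinite.
Context {R : realType}.

Lemma posdefmx_eq0 a (A : 'M[R]_a) (v : 'cV[R]_a) : posdefmx A ->
  (v^T *m A *m v) 0 0 = 0 -> v = 0.
Proof.
move=> [_ pA] vAv; apply: contrapT => /eqP /pA; rewrite vAv ltxx //.
Qed.

Lemma posdefmx_unit a (A : 'M[R]_a) : posdefmx A -> A \in unitmx.
Proof.
move=> pA; apply: unitmx_row_free0 => v vA; apply: (can_inj trmxK).
by rewrite trmx0; apply: (posdefmx_eq0 pA); rewrite trmxK vA mul0mx mxE.
Qed.

(** If v C A^-1 C' = 0, then x = A^-1 (v C)' satisfies x' A x = 0, so x = 0 and v C = 0; the full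
    row rank of [C] gives v = 0. *)
Lemma unitmx_congr_inv a b (A : 'M[R]_a) (C : 'M[R]_(b, a)) : posdefmx A ->
  \rank C = b -> C *m invmx A *m C^T \in unitmx.
Proof.
move=> pA rC; have Au := posdefmx_unit pA; have [sA _] := pA.
have fC : row_free C by rewrite /row_free rC.
apply: unitmx_row_free0 => v vA; apply: (row_free_inj fC); rewrite mul0mx.
have : invmx A *m (v *m C)^T = 0.
  apply: (posdefmx_eq0 pA); rewrite trmx_mul trmxK trmx_inv sA -!mulmxA mulKVmx //.
  by rewrite trmx_mul !mulmxA -[v *m C *m _]mulmxA -[v *m _ *m _]mulmxA vA mul0mx mxE.
move/(congr1 (mulmx A)); rewrite mulKVmx // mulmx0 => /(congr1 trmx).
by rewrite trmxK trmx0.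
Qed.

End PositiveDefinite.

(** * Exact formulas for the estimation errors *)

Section EstimationErrors.
Context d (T : measurableType d) (R : realType) (P : probability T R).
Variables (p q : nat) (mo : ultrastructural P p q).
Implicit Types (n : nat) (w : T).

Lemma Sigma_X_sym n : (Sigma_X mo n)^T = Sigma_X mo n.
Proof.
by rewrite !linearD /= linearZ /= trmx_mul trmxK !tr_scalar_mx.
Qed.

Lemma H_sym n w : (H mo n w)^T = H mo n w.
Proof.
by rewrite /H linearB /= !linearZ /= trmx_mul trmxK Sigma_X_sym.
Qed.

Definition second_moment n w : 'M[R]_p := n%:R^-1 *: ((X mo n w)^T *m X mo n w).

Lemma H_scaled n w : (0 < n)%N ->
  H mo n w = Num.sqrt n%:R *: (second_moment n w - Sigma_X mo n).
Proof. by move=> n0; rewrite /H /second_moment scalerBr scalerA sqrt_mulVn. Qed.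

(** With [Kbar_X_tr] this says that [K_X] is the identity minus the transpose of [Kbar_X], the
    relation behind the cancellation in [Bhat1_error]. *)
Lemma K_XE n : Sigma_X mo n \in unitmx ->
  K_X mo n = 1%:M - s_delta mo ^+ 2 *: invmx (Sigma_X mo n).
Proof.
move=> Su; rewrite /K_X -[Sigma_D mo n](addrK (s_delta mo ^+ 2)%:M) mulmxBr.
by rewrite mulVmx // mul_mx_scalar.
Qed.

Lemma Kbar_X_tr n : (Kbar_X mo n)^T = s_delta mo ^+ 2 *: invmx (Sigma_X mo n).
Proof.
rewrite /Kbar_X {1}/Sigma_X [X in (X *m _)^T]addrAC subrr add0r mul_scalar_mx.
by rewrite linearZ /= trmx_inv Sigma_X_sym.
Qed.

(** The bias correction in [h] combines with the centring of [H]: with S for [second_moment], (S -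
    Sigma_X) Sigma_X^-1 + I = S Sigma_X^-1. *)
Lemma scoreE n w : (0 < n)%N -> Sigma_X mo n \in unitmx -> score mo n w =
  (Num.sqrt n%:R)^-1 *: ((X mo n w)^T *m (E_mx mo n w - Delta_mx mo n w *m Bcoef mo n))
  + (Num.sqrt n%:R * s_delta mo ^+ 2) *:
    (second_moment n w *m invmx (Sigma_X mo n) *m Bcoef mo n).
Proof.
move=> n0 Su; rewrite /score linearD /= trmxK 2!trmx_mul trmxK H_sym Kbar_X_tr H_scaled //.
rewrite /h -addrA; congr (_ + _).
rewrite -2!scalemxAl -scalemxAr scalerA -scalerDr; congr (_ *: _).
by rewrite mulmxBl mulmxA mulKVmx // addrC subrK.
Qed.

(** Since Z = X B + (E - Delta B), the difference n^-1 X'Z - S K_X B equals n^-1 X'(E - Delta B) +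
    s_delta^2 S Sigma_X^-1 B, with S for [second_moment]. By [scoreE] this is n^(-1/2) times the
    score, without remainder. *)
Lemma Bhat1_error n w : (0 < n)%N -> Sigma_X mo n \in unitmx ->
  K_X mo n \in unitmx -> second_moment n w \in unitmx ->
  Num.sqrt n%:R *: (Bhat1 mo n w - Bcoef mo n) =
  invmx (K_X mo n) *m invmx (second_moment n w) *m score mo n w.
Proof.
move=> n0 Su Ku mu.
have n0' : n%:R != 0 :> R by rewrite pnatr_eq0 -lt0n.
have XX : (X mo n w)^T *m X mo n w = n%:R *: second_moment n w.
  by rewrite /second_moment scalerA divff // scale1r.
have XZ : (X mo n w)^T *m Z mo n w = n%:R *: second_moment n w *m Bcoef mo n +
    (X mo n w)^T *m (E_mx mo n w - Delta_mx mo n w *m Bcoef mo n).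
  rewrite -XX -mulmxA -mulmxDr; congr (_ *m _).
  by rewrite /Z /X [(_ + Delta_mx _ _ _) *m _]mulmxDl [E_mx _ _ _ - _]addrC addrA addrK.
have eB : Bcoef mo n = invmx (K_X mo n) *m invmx (second_moment n w) *m
    (second_moment n w *m (K_X mo n *m Bcoef mo n)).
  by rewrite -[invmx (K_X _ _) *m _ *m _]mulmxA mulKmx // mulKmx.
rewrite /Bhat1 XX XZ [X in _ *: (_ - X)]eB.
have -> : invmx (n%:R *: second_moment n w) = n%:R^-1 *: invmx (second_moment n w).
  by rewrite invmxZ // unitmxZ // unitfE.
set A := invmx (K_X _ _); set V' := invmx (second_moment _ _).
rewrite -[A *m (_ *: V')]scalemxAr -[X in _ *: (X - _)]scalemxAl [X in _ *: (X - _)]scalemxAr.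
rewrite -mulmxBr scalemxAr.
congr (_ *m _); rewrite scoreE // K_XE //.
set XE := (_^T *m (_ - _)); set S := second_moment n w; set V := invmx (Sigma_X _ _).
have cancel (a x y : 'M[R]_(p, q)) : a + x - (a - y) = x + y.
  by rewrite opprB addrC addrA subrK addrC.
rewrite mulmxBl mul1mx -[(_ *: V) *m _]scalemxAl mulmxBr -[S *m (_ *: _)]scalemxAr mulmxA.
rewrite [n%:R^-1 *: (_ + _)]scalerDr -[(_ *: S) *m _]scalemxAl [n%:R^-1 *: (_ *: _)]scalerA.
rewrite mulVf // scale1r cancel.
by rewrite scalerDr !scalerA sqrt_mulVn.
Qed.

Definition gain r1 (R1 : 'M[R]_(r1, p)) (Q : 'M[R]_p) : 'M[R]_(p, r1) :=
  invmx Q *m R1^T *m invmx (R1 *m invmx Q *m R1^T).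

(* The limit Q0 is that of Sh / n, whereas the estimator uses Sh. *)
Lemma gain_scale r1 (R1 : 'M[R]_(r1, p)) (Q : 'M[R]_p) (a : R) : a != 0 ->
  a *: Q \in unitmx -> R1 *m invmx (a *: Q) *m R1^T \in unitmx ->
  gain R1 (a *: Q) = gain R1 Q.
Proof.
move=> a0 Qu; rewrite /gain invmxZ // => Gu.
have E : R1 *m (a^-1 *: invmx Q) *m R1^T = a^-1 *: (R1 *m invmx Q *m R1^T).
  by rewrite -scalemxAr -scalemxAl.
rewrite E in Gu *.
by rewrite invmxZ // -2!scalemxAl -scalemxAr scalerA invrK mulVf // scale1r.
Qed.

(** Under the local alternative sqrt n (R1 B R2 - theta) = theta0. This shift is the source of the
    mean [mu] of the limit. *)
Lemma Btilde_error r1 r2 (R1 : 'M[R]_(r1, p)) (R2 : 'M[R]_(q, r2)) theta theta0 Sh n w :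
  (0 < n)%N ->
  R1 *m Bcoef mo n *m R2 = theta n + (Num.sqrt n%:R)^-1 *: theta0 ->
  let V := Num.sqrt n%:R *: (Bhat1 mo n w - Bcoef mo n) in
  Num.sqrt n%:R *: (Btilde mo R1 R2 theta Sh n w - Bcoef mo n) =
  V - gain R1 (Sh n w) *m (R1 *m V *m R2 + theta0) *m (invmx (R2^T *m R2) *m R2^T).
Proof.
move=> n0 restr V.
have s0 : Num.sqrt n%:R != 0 :> R by rewrite gt_eqF // sqrtr_gt0 ltr0n.
have -> : R1 *m V *m R2 + theta0 =
    Num.sqrt n%:R *: (R1 *m Bhat1 mo n w *m R2 - theta n).
  rewrite -scalemxAr -scalemxAl mulmxBr mulmxBl restr opprD addrA scalerBr scalerA.
  by rewrite divff // scale1r subrK.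
rewrite -scalemxAr -scalemxAl -scalerBr; congr (_ *: _).
by rewrite /Btilde /= addrAC !mulmxA.
Qed.

End EstimationErrors.

Section StackColumns.
Variable R : realType.

Lemma mxvec_index_val a b (i : 'I_a) (j : 'I_b) : mxvec_index i j = (i * b + j)%N :> nat.
Proof. by rewrite mxvec_index_tens. Qed.

Lemma stack_rows_col_mx a b c (M : 'M[R]_(a, c)) (N : 'M[R]_(b, c)) :
  stack_rows (col_mx M N) =
  castmx (esym (mulnDl a b c), erefl) (col_mx (stack_rows M) (stack_rows N)).
Proof.
apply/colP => k; case/mxvec_indexP: k => i j.
rewrite castmxE mxE mxvecE; case: (split_ordP i) => i' ->.
  rewrite col_mxEu; have -> : cast_ord (esym (esym (mulnDl a b c)))
      (mxvec_index (lshift b i') j) = lshift _ (mxvec_index i' j).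
    apply: val_inj; rewrite -[LHS]/(mxvec_index (lshift b i') j : nat).
    by rewrite -[RHS]/(mxvec_index i' j : nat) !mxvec_index_val.
  by rewrite col_mxEu [stack_rows _ _ _]mxE [cast_ord _ _]ord1 mxvecE.
rewrite col_mxEd; have -> : cast_ord (esym (esym (mulnDl a b c)))
    (mxvec_index (rshift a i') j) = rshift _ (mxvec_index i' j).
  apply: val_inj; rewrite -[LHS]/(mxvec_index (rshift a i') j : nat).
  by rewrite -[RHS]/(a * c + mxvec_index i' j)%N !mxvec_index_val mulnDl addnA.
by rewrite col_mxEd [stack_rows _ _ _]mxE [cast_ord _ _]ord1 mxvecE.
Qed.

Lemma mulmx_cast_rows a b c N (e : a = N) (A : 'M[R]_(a, b)) (u : 'M[R]_(b, c)) :
  castmx (e, erefl) A *m u = castmx (e, erefl) (A *m u).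
Proof. by case: N / e; rewrite !castmx_id. Qed.

Lemma congr_cast_rows a b N (e : a = N) (A : 'M[R]_(a, b)) (L : 'M[R]_b) :
  castmx (e, erefl) A *m L *m (castmx (e, erefl) A)^T = castmx (e, e) (A *m L *m A^T).
Proof. by case: N / e; rewrite !castmx_id. Qed.

End StackColumns.

Lemma whp_cvg_entries d (T : measurableType d) (R : realType) (P : probability T R) a b
  (A : nat -> 'M[R]_(a, b)) L : cvg_entries \oo A L -> cvg_entries (whp P) (fun x => A x.1) L.
Proof. by move=> AL i j; apply: (@whp_cvg _ _ _ P (fun n => A n i j)); exact: AL. Qed.

Lemma cvg_entries_near_eq d (T : measurableType d) (R : realType) (P : probability T R) a b
  (F G : nat * T -> 'M[R]_(a, b)) L :
  (\forall x \near whp P, F x = G x) -> cvg_entries (whp P) G L ->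
  cvg_entries (whp P) F L.
Proof.
move=> FG GL i j; apply: cvg_trans (GL i j); apply: near_eq_cvg.
by move: FG; apply: (@filterS _ (whp P) (whp_filter P)) => x /= ->.
Qed.

(** * Linearization of the scaled estimation errors *)

Section Estimators.
Context d (T : measurableType d) (R : realType) (P : probability T R).
Variables (p q r1 r2 : nat) (mo : ultrastructural P p q).
Variables (sM : 'cV[R]_p) (R1 : 'M[R]_(r1, p)) (R2 : 'M[R]_(q, r2))
  (theta : nat -> 'M[R]_(r1, r2)) (theta0 : 'M[R]_(r1, r2))
  (Sh : nat -> T -> 'M[R]_p) (Q0 : 'M[R]_p).
Hypotheses (hi : assumption_i mo) (hii : assumption_ii mo) (hiii : assumption_iii mo)
  (hiv : assumption_iv mo) (hv : assumption_v mo sM).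
Hypothesis R1_rank : \rank R1 = r1.
Hypothesis SigmaK_unit : Sigma mo sM *m K mo sM \in unitmx.
Hypothesis Sh_obs : observable mo Sh.
Hypothesis Q0_posdef : posdefmx Q0.
Hypothesis Sh_cvg : cvg_in_probability P (fun n w => n%:R^-1 *: Sh n w) Q0.
Hypothesis B_bounded : exists C : R, forall n i j, `|Bcoef mo n i j| <= C.
Hypothesis restriction : forall n, (0 < n)%N ->
  R1 *m Bcoef mo n *m R2 = theta n + (Num.sqrt n%:R)^-1 *: theta0.

Lemma random_X n : random_mx (X mo n).
Proof.
by move=> k i; under eq_fun do rewrite X_entry; exact: measurable_x_entry.
Qed.

Lemma random_Z n : random_mx (Z mo n).
Proof.
apply: random_mxD; last first.
  by move=> k j; under eq_fun do rewrite mxE; exact: measurable_funPT.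
apply: random_mxM; last exact: random_mx_cst.
apply: random_mxD; first exact: random_mx_cst.
by move=> k j; under eq_fun do rewrite mxE; exact: measurable_funPT.
Qed.

Lemma random_Sh n : random_mx (Sh n).
Proof.
move=> i j _ A mA; rewrite setTI.
have := @Sh_obs n i j A mA; apply: sigma_of_measurable => -[kl|kl].
  exact: random_X.
exact: random_Z.
Qed.

Lemma random_Bhat1 n : random_mx (Bhat1 mo n).
Proof.
have mX := random_mx_tr (@random_X n).
apply: random_mxM; last by apply: random_mxM => //; exact: random_Z.
apply: random_mxM; first exact: random_mx_cst.
by apply: random_mx_inv; apply: random_mxM => //; exact: random_X.
Qed.

Lemma random_Btilde n : random_mx (Btilde mo R1 R2 theta Sh n).
Proof.
have mB := @random_Bhat1 n; have mS := random_mx_inv (@random_Sh n).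
apply: random_mxD => //; apply: random_mxN.
do 2!(apply: random_mxM; last exact: random_mx_cst).
apply: random_mxM.
  apply: random_mxM; first by apply: random_mxM => //; exact: random_mx_cst.
  apply: random_mx_inv; do 2!(apply: random_mxM; try exact: random_mx_cst).
  exact: mS.
apply: random_mxD; last exact: random_mx_cst.
apply: random_mxM; last exact: random_mx_cst.
by apply: random_mxM; first exact: random_mx_cst.
Qed.

Definition scaled_error n w : 'M[R]_(p + p, q) := Num.sqrt n%:R *:
  col_mx (Bhat1 mo n w - Bcoef mo n) (Btilde mo R1 R2 theta Sh n w - Bcoef mo n).

Lemma random_scaled_error n : random_mx (scaled_error n).
Proof.
apply: random_mxZ; apply: random_col_mx.
  by apply: random_mxD; [exact: random_Bhat1|exact: random_mx_cst].
by apply: random_mxD; [exact: random_Btilde|exact: random_mx_cst].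
Qed.

(** For n > 0 the matrix is Sigma_X + n^(-1/2) H. The entries of [H] have bounded second moments, so
    the second term vanishes in probability by Chebyshev's inequality. *)
Lemma second_moment_cvg :
  cvg_entries (whp P) (fun x => second_moment mo x.1 x.2) (Sigma mo sM).
Proof.
have H0 : cvg_entries (whp P) (fun x => (Num.sqrt x.1%:R)^-1 *: H mo x.1 x.2) 0.
  move=> i j; rewrite mxE; under eq_fun do rewrite mxE.
  have [C C0 hC] := H_entry_bounded hi hii hiii hiv hv.
  have mH n : measurable_fun [set: T] (fun w => H mo n w i j).
    have mX := @random_X n; apply: random_mxD; last exact: random_mx_cst.
    by apply: random_mxZ; apply: random_mxM => //; exact: random_mx_tr.
  apply: (@whp_cvg0_L1 _ _ _ _ (fun n w => (Num.sqrt n%:R)^-1 * H mo n w i j)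
      (fun n => C * n%:R^-1)).
  - by move=> n; under eq_fun do rewrite exprMn; apply: L1Z; have [] := hC n i j.
  - by move=> n; exact: measurable_funM.
  - apply: nearW => n; have [iH EH] := hC n i j.
    under eq_Rintegral do rewrite exprMn.
    by rewrite EZ // exprVn sqr_sqrtr // mulrC ler_wpM2r // invr_ge0.
  - apply: cvg_scale0; apply: (cvg_trans _ (@cvg_harmonic R)).
    by rewrite -cvg_shiftS.
have : cvg_entries (whp P) (fun x => Sigma_X mo x.1 + (Num.sqrt x.1%:R)^-1 *: H mo x.1 x.2)
    (Sigma mo sM + 0).
  by apply: cvg_entriesD => //; apply: whp_cvg_entries; exact: Sigma_X_cvg hv.
rewrite addr0 => h i j; apply: cvg_trans (h i j); apply: near_eq_cvg.
have := whp_near P (nbhs_infty_gt 0); apply: (@filterS _ (whp P) (whp_filter P)) => x n0.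
rewrite H_scaled // scalerA mulVf ?scale1r ?subrKC //.
by rewrite gt_eqF // sqrtr_gt0 ltr0n.
Qed.

Local Notation A := (invmx (Sigma mo sM *m K mo sM)).
Definition error_factor n w : 'M[R]_p := invmx (K_X mo n) *m invmx (second_moment mo n w).

Lemma scale_cvg : cvg_entries (whp P) (fun x => error_factor x.1 x.2) A.
Proof.
rewrite invmx_mul //; apply: cvg_entriesM.
  apply: cvg_entries_inv; last exact: K_unit SigmaK_unit.
  by apply: whp_cvg_entries; exact: K_X_cvg hv SigmaK_unit.
apply: cvg_entries_inv; last exact: Sigma_unit SigmaK_unit.
exact: second_moment_cvg.
Qed.

Lemma gain_cvg : cvg_entries (whp P) (fun x => gain R1 (Sh x.1 x.2)) (gain R1 Q0).
Proof.
have Sc : cvg_entries (whp P) (fun x => x.1%:R^-1 *: Sh x.1 x.2) Q0.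
  move=> i j; apply: (@whp_cvg_prob _ _ _ _ (fun n w => (n%:R^-1 *: Sh n w) i j)).
    by move=> n; apply: random_mxZ; exact: random_Sh.
  by move=> e e0; exact: Sh_cvg.
have Qu := posdefmx_unit Q0_posdef.
have Gu := unitmx_congr_inv Q0_posdef R1_rank.
have Gc : cvg_entries (whp P) (fun x => R1 *m invmx (x.1%:R^-1 *: Sh x.1 x.2) *m R1^T)
    (R1 *m invmx Q0 *m R1^T).
  do 2!(apply: cvg_entriesM; try exact: cvg_entries_cst).
  exact: cvg_entries_inv.
have gc : cvg_entries (whp P) (fun x => gain R1 (x.1%:R^-1 *: Sh x.1 x.2)) (gain R1 Q0).
  apply: cvg_entriesM; last exact: cvg_entries_inv.
  apply: cvg_entriesM; last exact: cvg_entries_cst.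
  exact: cvg_entries_inv.
move=> i j; apply: cvg_trans (gc i j); apply: near_eq_cvg.
have n0 := whp_near P (nbhs_infty_gt 0).
apply: filterS3 n0 (cvg_entries_near_unit Sc Qu) (cvg_entries_near_unit Gc Gu) => x n0 xS xG.
by rewrite gain_scale // invr_eq0 pnatr_eq0 -lt0n.
Qed.

Lemma sbounded_score : sbounded_mx P (score mo).
Proof.
have [C C0 hC] := u_entry_bounded hi hii hiii hiv hv SigmaK_unit B_bounded.
move=> i j; have E n w : score mo n w i j = u mo n w (mxvec_index i j) 0.
  by rewrite uE [stack_rows _ _ _]mxE mxvecE.
under eq_fun do under eq_fun do rewrite E.
apply: (@sbounded_L2 _ _ _ _ _ C) => n //.
exact: (u_entry_L1_sqr hi hii hiii hiv hv SigmaK_unit B_bounded).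
Qed.

Definition unrestricted_error n w : 'M[R]_(p, q) := Num.sqrt n%:R *: (Bhat1 mo n w - Bcoef mo n).
Local Notation C2 := (invmx (R2^T *m R2) *m R2^T).

(** The two exact error formulas, as functions of the score, with every random or varying
    coefficient replaced by its limit. *)
Definition limit_map (W : 'M[R]_(p, q)) : 'M[R]_(p + p, q) :=
  col_mx (A *m W) (A *m W - gain R1 Q0 *m (R1 *m (A *m W) *m R2 + theta0) *m C2).

Lemma near_unrestricted_error : \forall x \near whp P, unrestricted_error x.1 x.2 =
  error_factor x.1 x.2 *m score mo x.1 x.2.
Proof.
have Su : \forall x \near whp P, Sigma_X mo x.1 \in unitmx.
  apply: (whp_near P (Q := fun n => Sigma_X mo n \in unitmx)).
  exact: (cvg_entries_near_unit (Sigma_X_cvg hv) (Sigma_unit SigmaK_unit)).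
have Ku : \forall x \near whp P, K_X mo x.1 \in unitmx.
  apply: (whp_near P (Q := fun n => K_X mo n \in unitmx)).
  exact: (cvg_entries_near_unit (K_X_cvg hv SigmaK_unit) (K_unit SigmaK_unit)).
have mu := cvg_entries_near_unit second_moment_cvg (Sigma_unit SigmaK_unit).
have n0 := whp_near P (nbhs_infty_gt 0).
near=> x; apply: Bhat1_error; near: x; [exact: n0|exact: Su|exact: Ku|exact: mu].
Unshelve. all: by end_near. Qed.

Lemma unrestricted_error_cvg : cvg_entries (whp P) (fun x => unrestricted_error x.1 x.2 - A
  *m score mo x.1 x.2) 0.
Proof.
apply: (@cvg_entries_near_eq _ _ _ P _ _ _ (fun x => (error_factor x.1 x.2 - A) *m score mo
  x.1 x.2)).
  by have := near_unrestricted_error; apply: (@filterS _ (whp P) (whp_filter P)) => x /= ->;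
    rewrite mulmxBl.
apply: (@cvg0_mulmxr _ _ _ _ _ _ _ (fun n w => error_factor n w - A)); last exact: sbounded_score.
rewrite -(subrr A); apply: cvg_entriesB; [exact: scale_cvg|exact: cvg_entries_cst].
Qed.

Lemma sbounded_unrestricted_error : sbounded_mx P unrestricted_error.
Proof.
have h : sbounded_mx P (fun n w => unrestricted_error n w - A *m score mo n w + A *m score mo n w).
  apply: sbounded_mxD.
    exact: (@sbounded_mx_cvg _ _ _ _ _ _ (fun n w => unrestricted_error n w - A *m score mo
      n w) _ unrestricted_error_cvg).
  by apply: sbounded_mxM; [exact: sbounded_mx_cst|exact: sbounded_score].
by move=> i j; have := h i j; under eq_fun do under eq_fun do rewrite subrK.
Qed.

Lemma error_cvg : cvg_entries (whp P)
  (fun x => scaled_error x.1 x.2 - limit_map (score mo x.1 x.2)) 0.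
Proof.
pose G n w := gain R1 (Sh n w); pose G0 := gain R1 Q0.
pose D n w := unrestricted_error n w - A *m score mo n w.
(* One factor is exchanged at a time: first [G] for its limit [G0], against a matrix bounded in
   probability, then the unrestricted error for its linear approximation, under fixed
   coefficients. *)
pose rem n w := D n w - ((G n w - G0) *m (R1 *m unrestricted_error n w *m R2 + theta0) *m C2
  + G0 *m (R1 *m D n w *m R2) *m C2).
have bR : sbounded_mx P (fun n w => R1 *m unrestricted_error n w *m R2 + theta0).
  apply: sbounded_mxD; last exact: sbounded_mx_cst.
  apply: sbounded_mxM; last exact: sbounded_mx_cst.
  by apply: sbounded_mxM; [exact: sbounded_mx_cst|exact: sbounded_unrestricted_error].
have rem0 : cvg_entries (whp P) (fun x => rem x.1 x.2) 0.
  rewrite -[X in cvg_entries _ _ X](subrr 0); apply: cvg_entriesB;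
    first exact: unrestricted_error_cvg.
  rewrite -[X in cvg_entries _ _ X](addr0 0); apply: cvg_entriesD.
    apply: (@cvg0_mulmxr _ _ _ _ _ _ _ (fun n w => (G n w - G0) *m (R1 *m
      unrestricted_error n w *m R2 + theta0)) (fun _ _ => C2));
      last exact: sbounded_mx_cst.
    apply: (@cvg0_mulmxr _ _ _ _ _ _ _ (fun n w => G n w - G0) (fun n w => R1 *m
      unrestricted_error n w *m R2 + theta0)) => //.
    by rewrite -(subrr G0); apply: cvg_entriesB; [exact: gain_cvg|exact: cvg_entries_cst].
  rewrite (_ : 0 = G0 *m (R1 *m 0 *m R2) *m C2); last by rewrite !(mulmx0, mul0mx).
  do 4!(apply: cvg_entriesM; try exact: cvg_entries_cst).
  exact: unrestricted_error_cvg.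
apply: (@cvg_entries_near_eq _ _ _ P _ _ _ (fun x => col_mx (D x.1 x.2) (rem x.1 x.2))).
  have := whp_near P (nbhs_infty_gt 0); apply: (@filterS _ (whp P) (whp_filter P)) => x n0.
  rewrite /scaled_error scale_col_mx (Btilde_error _ _ n0 (restriction n0)) /=.
  rewrite /limit_map opp_col_mx add_col_mx; congr col_mx.
  rewrite /rem /D /G /G0; rewrite -/(unrestricted_error x.1 x.2);
    move: (unrestricted_error x.1 x.2) (A *m score _ _ _) (gain _ _) (gain _ _) => v a g g0.
  have -> : R1 *m (v - a) *m R2 = R1 *m v *m R2 + theta0 - (R1 *m a *m R2 + theta0).
    by rewrite mulmxBr mulmxBl opprD addrACA subrr addr0.
  rewrite !mulmxBl mulmxBr mulmxBl addrA subrK.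
  by rewrite !opprD !opprK addrACA.
have E0 (G' : nat * T -> 'M[R]_(p, q)) : cvg_entries (whp P) G' 0 ->
    forall k j, G' x k j @[x --> whp P] --> 0.
  by move=> h k j; have := h k j; rewrite mxE.
move=> i j; rewrite mxE; under eq_fun do rewrite mxE.
case: fintype.split => k; first exact: (E0 _ unrestricted_error_cvg).
exact: (E0 _ rem0).
Qed.

End Estimators.

Lemma stack_rowsD (R : realType) a b (M N : 'M[R]_(a, b)) :
  stack_rows (M + N) = stack_rows M + stack_rows N.
Proof. by rewrite /stack_rows !linearD. Qed.

Lemma stack_rowsN (R : realType) a b (M : 'M[R]_(a, b)) : stack_rows (- M) = - stack_rows M.
Proof. by rewrite /stack_rows !linearN. Qed.

Lemma tight_sbounded d (T : measurableType d) (R : realType) (P : probability T R) a b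
  (Y : nat -> T -> 'M[R]_(a, b)) : (forall n, random_mx (Y n)) -> sbounded_mx P Y -> tight P Y.
Proof.
move=> mY bY e e0.
have : sbounded P (fun n w => l1norm (Y n w)).
  apply: (@sbounded_sum _ _ _ _ _ _ (fun k n w => `|mxvec (Y n w) 0 k|)) => k.
  apply: sbounded_norm; case/mxvec_indexP: k => i j.
  by under eq_fun do under eq_fun do rewrite mxvecE; exact: bY.
move=> /(_ _ e0)[L0 hL]; exists L0 => L L0L; move: hL; apply: filterS => n [B [mB PB hB]].
apply: le_trans PB; apply: le_measure; rewrite ?inE //.
  by apply: measurable_gt_fun; exact: measurable_l1norm.
move=> w /= Lw; apply: contrapT => /hB; apply/negP; rewrite -ltNge.
by rewrite (lt_le_trans (lt_trans L0L Lw)) // ler_norm.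
Qed.

Lemma subr_mxE (R : zmodType) a b (M N : 'M[R]_(a, b)) i j : (M - N) i j = M i j - N i j.
Proof. by rewrite !mxE. Qed.

Lemma sbounded_mxN d (T : measurableType d) (R : realType) (P : probability T R) a b
  (A : nat -> T -> 'M[R]_(a, b)) : sbounded_mx P A -> sbounded_mx P (fun n w => - A n w).
Proof.
move=> bA i j; under eq_fun do under eq_fun do rewrite mxE -mulN1r.
by apply: sboundedM => //; exact: sbounded_cst.
Qed.

Lemma sbounded_col_mx d (T : measurableType d) (R : realType) (P : probability T R) a b c
  (A : nat -> T -> 'M[R]_(a, c)) (B : nat -> T -> 'M[R]_(b, c)) :
  sbounded_mx P A -> sbounded_mx P B -> sbounded_mx P (fun n w => col_mx (A n w) (B n w)).
Proof.
move=> bA bB i j; under eq_fun do under eq_fun do rewrite mxE.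
by case: fintype.split => k; [exact: bA|exact: bB].
Qed.

Lemma measurable_affine (R : realType) (t c : R) :
  measurable_fun [set: R] (fun x : R => t * x + c).
Proof. by apply: measurable_funD => //; exact: measurable_funM. Qed.

(** * The limit law *)

(** The given transform is that of the point mass for [v = 0] and that of a normal law otherwise, so
    [law_unique] applies with the identity on the line as the second variable. *)
Lemma normal1_law d (T : measurableType d) (R : realType) (P : probability T R)
  (Z : T -> R) (m v : R) : measurable_fun [set: T] Z -> 0 <= v ->
  (forall t c : R, \int[P]_w cos (t * Z w + c) = expR (- (t ^+ 2 * v / 2)) * cos (t * m + c)) ->
  forall A, measurable A -> P (Z @^-1` A) = normal1 m v A.
Proof.
move=> mZ v0 EZ A mA; rewrite /normal1; case: eqP => [v00|/eqP v00].
  apply: (@law_unique R d T P _ _ (\d_m) Z id mZ) => // t c.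
  have mc : measurable_fun [set: R] (fun x : R => (cos (t * x + c))%:E).
    apply/measurable_EFinP; apply: measurable_cos_fun; exact: measurable_affine.
  rewrite EZ v00 mulr0 mul0r oppr0 expR0 mul1r /Rintegral integral_dirac //=.
  by rewrite indicE in_setT mul1r.
have s0 : Num.sqrt v != 0 by rewrite sqrtr_eq0 -ltNge lt_def v00.
apply: (@law_unique R d T P _ _ (normal_prob m (Num.sqrt v)) Z id mZ) => // t c.
by rewrite cos_normal // EZ sqr_sqrtr // [v * _]mulrC.
Qed.

Section LimitLaw.
Context {R : realType} d (T : measurableType d) (P : probability T R).
Variables (p q r1 r2 : nat) (mo : ultrastructural P p q).
Variables (sM : 'cV[R]_p) (R1 : 'M[R]_(r1, p)) (R2 : 'M[R]_(q, r2))
  (theta0 : 'M[R]_(r1, r2)) (Q0 : 'M[R]_p).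

(** The linear part of [limit_map] in row-stacked coordinates. The cast identifies p q + p q rows
    with (p + p) q rows. *)
Definition limit_matrix : 'M[R]_((p + p) * q, p * q) :=
  castmx (esym (mulnDl p p q), erefl) (col_mx (A1 mo sM) (A2 mo R1 R2 sM Q0)).

(** By [stack_rows_mul], the right factor of a product enters the Kronecker product transposed; here
    it is the orthogonal projection R2 (R2'R2)^-1 R2' when R2 has full column rank, and it is
    symmetric in any case. *)
Lemma stack_limit_map W : stack_rows (limit_map mo sM R1 R2 theta0 Q0 W) =
  limit_matrix *m stack_rows W + stack_rows (col_mx 0 (mu R1 R2 theta0 Q0)).
Proof.
have symR2 : (R2 *m (invmx (R2^T *m R2) *m R2^T))^T = R2 *m invmx (R2^T *m R2) *m R2^T.
  by rewrite !trmx_mul trmxK trmx_inv trmx_mul trmxK.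
have -> : limit_map mo sM R1 R2 theta0 Q0 W =
    col_mx (invmx (Sigma mo sM *m K mo sM) *m W *m 1%:M)
      (invmx (Sigma mo sM *m K mo sM) *m W *m 1%:M -
       (gain R1 Q0 *m R1 *m invmx (Sigma mo sM *m K mo sM)) *m W *m
       (R2 *m (invmx (R2^T *m R2) *m R2^T))) + col_mx 0 (mu R1 R2 theta0 Q0).
  rewrite add_col_mx addr0 /limit_map !mulmx1; congr col_mx.
  by rewrite /mu -/(gain R1 Q0) -addrA -opprD mulmxDr mulmxDl !mulmxA.
rewrite stack_rowsD; congr (_ + _).
rewrite stack_rows_col_mx stack_rowsD stack_rowsN !stack_rows_mul symR2 trmx1.
by rewrite /limit_matrix mulmx_cast_rows mul_col_mx mulmxBl.
Qed.

(** Symmetry of [Lambda] identifies the lower left block, given as a transpose, with A2 Lambda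
    A1'. *)
Lemma limit_covE (Lambda : 'M[R]_(p * q)) : Lambda^T = Lambda ->
  limit_cov mo R1 R2 sM Q0 Lambda = limit_matrix *m Lambda *m limit_matrix^T.
Proof.
move=> sL; rewrite /limit_matrix congr_cast_rows; congr castmx.
rewrite tr_col_mx mul_col_mx mul_col_row; congr block_mx.
by rewrite !trmx_mul trmxK sL mulmxA.
Qed.

End LimitLaw.

Theorem theorem3p2 (R : realType) (d : measure_display) (T : measurableType d)
  (P : probability T R) (p q r1 r2 : nat) (mo : ultrastructural P p q)
  (sM : 'cV[R]_p) (R1 : 'M[R]_(r1, p)) (R2 : 'M[R]_(q, r2))
  (theta : nat -> 'M[R]_(r1, r2)) (theta0 : 'M[R]_(r1, r2))
  (Lambda : 'M[R]_(p * q)) (Sh : nat -> T -> 'M[R]_p) (Q0 : 'M[R]_p)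
  (se_ge0 : 0 <= s_eps mo) (sd_ge0 : 0 <= s_delta mo) (sp_ge0 : 0 <= s_psi mo)
  (hi : assumption_i mo) (hii : assumption_ii mo) (hiii : assumption_iii mo)
  (hiv : assumption_iv mo) (hv : assumption_v mo sM)
  (hvi : assumption_vi mo R1 R2)
  (SigmaK_unit : Sigma mo sM *m K mo sM \in unitmx)
  (hLambda :
    expectation_mx P (fun w => u mo n w *m (u mo n w)^T) @[n --> \oo]
      --> Lambda)
  (Sh_obs : observable mo Sh)
  (Sh_posdef : \forall n \near \oo, {ae P, forall w, posdefmx (Sh n w)})
  (Q0_posdef : posdefmx Q0)
  (Sh_cvg : cvg_in_probability P (fun n w => n%:R^-1 *: Sh n w) Q0)
  (B_bounded : exists C : R, forall n i j, `|Bcoef mo n i j| <= C)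
  (restriction : forall n, (0 < n)%N ->
    R1 *m Bcoef mo n *m R2 = theta n + (Num.sqrt n%:R)^-1 *: theta0) :
  exists (d' : measure_display) (T' : measurableType d')
      (P' : probability T' R) (eta1 etastar : T' -> 'M[R]_(p, q)),
    cvg_in_distribution P P'
      (fun n w => Num.sqrt n%:R *:
         col_mx (Bhat1 mo n w - Bcoef mo n)
                (Btilde mo R1 R2 theta Sh n w - Bcoef mo n))
      (fun w => col_mx (eta1 w) (etastar w)) /\
    matrix_normal P' (fun w => col_mx (eta1 w) (etastar w))
      (col_mx 0 (mu R1 R2 theta0 Q0))
      (limit_cov mo R1 R2 sM Q0 Lambda).
Proof.
have [_ R1_rank _] := hvi.
have symL := Lambda_sym hLambda.
have psdL := Lambda_psd hi hii hiii hiv hv SigmaK_unit B_bounded hLambda.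
have [d' [T' [P' [xi [mxi Exi]]]]] := gaussian_vector symL psdL.
pose F := limit_matrix mo sM R1 R2 Q0.
pose m := stack_rows (col_mx (0 : 'M[R]_(p, q)) (mu R1 R2 theta0 Q0)).
pose g := limit_map mo sM R1 R2 theta0 Q0.
(* One Gaussian vector with covariance [Lambda] drives both halves of the limit, which yields their
   joint law. *)
pose eta w := g (vec_mx (xi w)^T).
(* Applying [g] changes the direction of the pairing to [F^T *m c] and adds a constant, which the
   phase absorbs. The transforms of [g] of the score thus reduce to those of the score itself. *)
have pairE (c : 'cV[R]_((p + p) * q)) (W : 'M[R]_(p, q)) (a : R) :
    (c^T *m stack_rows (g W)) 0 0 + a =
    ((F^T *m c)^T *m stack_rows W) 0 0 + ((c^T *m m) 0 0 + a).
  by rewrite stack_limit_map mulmxDr mxE trmx_mul trmxK mulmxA addrA.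
have covE (c : 'cV[R]_((p + p) * q)) : (c^T *m limit_cov mo R1 R2 sM Q0 Lambda *m c) 0 0 =
    ((F^T *m c)^T *m Lambda *m (F^T *m c)) 0 0.
  by rewrite (limit_covE _ _ _ _ _ symL) trmx_mul trmxK !mulmxA.
have Eeta (c : 'cV[R]_((p + p) * q)) (a : R) :
    \int[P']_w cos ((c^T *m stack_rows (eta w)) 0 0 + a) =
    expR (- ((c^T *m limit_cov mo R1 R2 sM Q0 Lambda *m c) 0 0 / 2)) *
      cos ((c^T *m m) 0 0 + a).
  under eq_Rintegral => w _.
    rewrite pairE /stack_rows vec_mxK trmxK.
    over.
  by rewrite Exi covE.
have random_g d0 (T0 : measurableType d0) (W : T0 -> 'M[R]_(p, q)) :
    random_mx W -> random_mx (fun w => g (W w)).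
  move=> mW; have mA := random_mxM (random_mx_cst (invmx (Sigma mo sM *m K mo sM))) mW.
  apply: random_col_mx => //; apply: random_mxD => //; apply: random_mxN.
  apply: random_mxM; last exact: random_mx_cst.
  apply: random_mxM; first exact: random_mx_cst.
  apply: random_mxD; last exact: random_mx_cst.
  apply: random_mxM; last exact: random_mx_cst.
  by apply: random_mxM => //; exact: random_mx_cst.
have meta : random_mx eta.
  by apply: random_g => i j; under eq_fun do rewrite !mxE; exact: mxi.
have mY n : random_mx (scaled_error mo R1 R2 theta Sh n).
  exact: random_scaled_error.
exists d', T', P', (fun w => usubmx (eta w)), (fun w => dsubmx (eta w)).
have -> : (fun w => col_mx (usubmx (eta w)) (dsubmx (eta w))) = eta.
  by apply/funext => w; rewrite vsubmxK.
have sym_cov : (limit_cov mo R1 R2 sM Q0 Lambda)^T = limit_cov mo R1 R2 sM Q0 Lambda.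
  by rewrite (limit_covE _ _ _ _ _ symL) !trmx_mul trmxK symL mulmxA.
have psd_cov (c : 'cV[R]_((p + p) * q)) : 0 <= (c^T *m limit_cov mo R1 R2 sM Q0 Lambda *m c) 0 0.
  by rewrite covE; exact: psdL.
have mpair d0 (T0 : measurableType d0) (W : T0 -> 'M[R]_(p + p, q))
    (c : 'cV[R]_((p + p) * q)) : random_mx W ->
    measurable_fun [set: T0] (fun w => (c^T *m stack_rows (W w)) 0 0).
  by move=> mW; under eq_fun do rewrite pairing_stack; exact: measurable_pairing.
have Yg := error_cvg hi hii hiii hiv hv R1_rank SigmaK_unit Sh_obs Q0_posdef Sh_cvg
  B_bounded restriction.
have Yg0 i j : scaled_error mo R1 R2 theta Sh x.1 x.2 i j - g (score mo x.1 x.2) i j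
    @[x --> whp P] --> 0.
  by have := Yg i j; rewrite mxE; under eq_fun do rewrite subr_mxE.
have cYg0 (r : R) i j : r * (scaled_error mo R1 R2 theta Sh x.1 x.2 i j -
    g (score mo x.1 x.2) i j) @[x --> whp P] --> 0.
  by apply: cvg_scale0; exact: Yg0.
have bg : sbounded_mx P (fun n w => g (score mo n w)).
  have bA := sbounded_mxM (sbounded_mx_cst P (invmx (Sigma mo sM *m K mo sM)))
    (sbounded_score hi hii hiii hiv hv SigmaK_unit B_bounded).
  apply: sbounded_col_mx => //; apply: sbounded_mxD => //; apply: sbounded_mxN.
  apply: sbounded_mxM; last exact: sbounded_mx_cst.
  apply: sbounded_mxM; first exact: sbounded_mx_cst.
  apply: sbounded_mxD; last exact: sbounded_mx_cst.
  apply: sbounded_mxM; last exact: sbounded_mx_cst.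
  by apply: sbounded_mxM => //; exact: sbounded_mx_cst.
have mscore n := random_g _ _ _ (score_measurable mo n).
split.
  apply: (@levy_continuity R d T P d' T' P' (p + p) q (scaled_error mo R1 R2 theta Sh) eta) => //.
    move=> c a; rewrite Eeta.
    apply: (@cos_slutsky _ _ _ _ (fun n w => (c^T *m stack_rows (scaled_error mo R1 R2
      theta Sh n w)) 0 0)
        (fun n w => (c^T *m stack_rows (g (score mo n w))) 0 0)).
    - by move=> n; exact: mpair.
    - by move=> n; exact: mpair.
    - under eq_fun do rewrite !pairing_stack -sumrB.
      have sum0 : \sum_(k < (p + p) * q) 0 = 0 :> R by rewrite big1.
      have h : \sum_k (c k 0 * mxvec (scaled_error mo R1 R2 theta Sh x.1 x.2) 0 k
          - c k 0 * mxvec (g (score mo x.1 x.2)) 0 k) @[x --> whp P] -->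
          \sum_(k < (p + p) * q) (0 : R).
        apply: cvg_sum_seq => k; under eq_fun do rewrite -mulrBr.
        case/mxvec_indexP: k => i j; under eq_fun do rewrite !mxvecE.
        exact: cYg0.
      by rewrite sum0 in h.
    - under eq_fun do under eq_Rintegral do rewrite pairE -uE.
      rewrite covE.
      exact: (score_clt hi hii hiii hiv hv SigmaK_unit B_bounded hLambda).
  apply: tight_sbounded => //.
  have bD := @sbounded_mx_cvg _ _ _ _ _ _
    (fun n w => scaled_error mo R1 R2 theta Sh n w - g (score mo n w)) _ Yg.
  move=> i j; have := sbounded_mxD bD bg i j.
  by under eq_fun do under eq_fun do rewrite subrK.
split => //.
move=> c A mA; apply: (normal1_law (Z := fun w => (c^T *m stack_rows (eta w)) 0 0)) => //.
  exact: mpair.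
(* The transform at [t] of the combination with coefficients [c] is the joint transform at
   [t *: c]. *)
move=> t a.
have lin (W : 'cV[R]_((p + p) * q)) : ((t *: c)^T *m W) 0 0 = t * (c^T *m W) 0 0.
  by rewrite linearZ /= -scalemxAl mxE.
have quad (Om : 'M[R]_((p + p) * q)) :
    ((t *: c)^T *m Om *m (t *: c)) 0 0 = t ^+ 2 * (c^T *m Om *m c) 0 0.
  by rewrite [(t *: c)^T]linearZ /= -2!scalemxAl -scalemxAr scalerA mxE.
by have := Eeta (t *: c) a; under eq_Rintegral do rewrite lin; rewrite lin quad.
Qed.
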